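(* Let $\omega,\beta>0$ be fixed. Assume that $\{\varepsilon_k\}\subset\mathbb{R}^+$ is a sequence converging to zero. If $\varphi_k\in\mathscr{G}_{\varepsilon_k}$, then there exist a subsequence of $\{\varepsilon_k\}$, denoted by the same $\varepsilon_k$, and $\{y_k\}\subset\mathbb{R}^n$ such that $\varphi_k(\cdot+y_k)$ converges in $H^1(\mathbb{R}^n)$ to $\varphi_0$ as $\varepsilon_k\to0$.
   Context: $0<\beta<n/2$ is the standing range. $L_\beta=D^{-2\beta}$, $L_{\beta/2}=D^{-\beta}$ are the Fourier multipliers with symbols $|\xi|^{-2\beta}$, $|\xi|^{-\beta}$; $X_\beta=H^1(\mathbb{R}^n)\cap\dot H^{-\beta}(\mathbb{R}^n)$ with $\|u\|_{X_\beta}^2=\|u\|_{H^1}^2+\|L_{\beta/2}u\|_{L^2}^2$. For $\varepsilon\ge0$ let $$I_\varepsilon(u)=\int_{\mathbb{R}^n}\big(\varepsilon|L_{\beta/2}u|^2+|\nabla u|^2+\omega|u|^2\big)\,dx,$$ $$m_\varepsilon=\inf_{u\in X_\beta\setminus\{0\}}\frac{I_\varepsilon(u)}{\|u\|_{L^4}^2}\ (\varepsilon>0),\qquad m_0=\inf_{u\in H^1(\mathbb{R}^n)\setminus\{0\}}\frac{I_0(u)}{\|u\|_{L^4}^2}.$$ $\mathscr{G}_\varepsilon$ denotes the set of ground states of $\omega\varphi-\Delta\varphi+\varepsilon L_\beta\varphi=\varphi^3$, i.e. solutions of this equation obtained as rescaled minimizers of $m_\varepsilon$ (so that $I_\varepsilon(\varphi)=\|\varphi\|_{L^4}^4=m_\varepsilon^2$).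 The function $\varphi_0\in H^1(\mathbb{R}^n)$ is the ground state of $\omega\varphi_0-\Delta\varphi_0=\varphi_0^3$, unique up to translation, so that $\mathscr{G}_0=\{\varphi_0(\cdot+y):y\in\mathbb{R}^n\}$.
   Formalization: Ground states are closed under φ ↦ −φ, so uniqueness of φ_0 and the limit are stated up to sign: G_0 consists of translates of φ_0 or −φ_0, and φ_k(·+y_k) converges along the subsequence to sφ_0 with one fixed sign s = ±1. *)

(* Defs.v *)
From HB Require Import structures.
From mathcomp Require Import all_boot all_order all_algebra.
From mathcomp Require Import all_classical all_reals all_analysis.

Set Implicit Arguments.
Unset Strict Implicit.
Unset Printing Implicit Defensive.

Import Order.TTheory GRing.Theory Num.Theory.
Import numFieldNormedType.Exports.

Local Open Scope classical_set_scope.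
Local Open Scope ring_scope.

(* R^n is 'rV[R]_n, with the sigma-algebra generated by the coordinates (that
   is, the Borel sets); functions on R^n are actual functions, so equality in
   L^2, H^1, ... is equality almost everywhere. *)

Section measurable_rV.
Context (R : realType) (n : nat).

Let coor (i : 'I_n) (x : 'rV[R]_n) : R := x 0 i.

Let rV_set0 : g_sigma_preimage coor set0.
Proof. exact: sigma_algebra0. Qed.

Let rV_setC A : g_sigma_preimage coor A -> g_sigma_preimage coor (~` A).
Proof. exact: sigma_algebraC. Qed.

Let rV_bigcup (F : (set 'rV[R]_n)^nat) :
  (forall i, g_sigma_preimage coor (F i)) ->
  g_sigma_preimage coor (\bigcup_i (F i)).
Proof. exact: sigma_algebra_bigcup. Qed.

HB.instance Definition _ :=
  @isMeasurable.Build (measure_tuple_display R.-ocitv.-measurable.-sigma)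
    'rV[R]_n (g_sigma_preimage coor) rV_set0 rV_setC rV_bigcup.

Lemma measurable_coor (i : 'I_n) :
  measurable_fun [set: 'rV[R]_n] (fun x : 'rV[R]_n => x 0 i).
Proof.
move=> _ Y mY; rewrite setTI; apply: sub_sigma_algebra => /=.
rewrite -bigcup_seq/=; exists i => /=; first by rewrite mem_index_enum.
by exists Y => //; rewrite setTI.
Qed.

Lemma measurable_fun_rVP d (T : measurableType d) (f : T -> 'rV[R]_n) :
  (forall i, measurable_fun [set: T] (fun x => f x 0 i)) ->
  measurable_fun [set: T] f.
Proof.
move=> mf; apply: (@measurability _ _ _ _ _ _
  (\big[setU/set0]_(i < n) preimage_set_system setT (coor i) measurable)) => //.
move=> _ [A + <-]; rewrite -bigcup_seq => -[i _ [B mB <-]].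
by rewrite setTI -comp_preimage; exact: mf.
Qed.

End measurable_rV.

Section lebesgue.
Context (R : realType).

Definition rV_cons (n : nat) (p : 'rV[R]_n * R) : 'rV[R]_n.+1 :=
  \row_i if unlift ord0 i is Some j then p.1 0 j else p.2.

Lemma measurable_rV_cons n : measurable_fun [set: 'rV[R]_n * R] (@rV_cons n).
Proof.
apply: measurable_fun_rVP => i; rewrite /rV_cons.
under eq_fun do rewrite mxE.
case: (unlift ord0 i) => [j|]; last exact: measurable_snd.
exact: measurableT_comp (measurable_coor j) measurable_fst.
Qed.

Definition lebesgue_rV_step n (m : {measure set 'rV[R]_n -> \bar R}) :=
  pushforward (m \x (@lebesgue_measure R))%E (@rV_cons n).

Section lebesgue_rV_step_measure.
Context (n : nat) (m : {measure set 'rV[R]_n -> \bar R}).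

Let stepE : {m' : {measure set 'rV[R]_n.+1 -> \bar R} |
  lebesgue_rV_step m = m' :> (set _ -> _)}.
Proof.
unshelve eexists (pushforward (m \x (@lebesgue_measure R))%E (@rV_cons n)).
  exact: measurable_rV_cons.
by [].
Qed.

Let step0 : lebesgue_rV_step m set0 = 0%E.
Proof. by case: stepE => m' ->; exact: measure0. Qed.

Let step_ge0 A : (0 <= lebesgue_rV_step m A)%E.
Proof. by case: stepE => m' ->; exact: measure_ge0. Qed.

Let step_sigma_additive : semi_sigma_additive (lebesgue_rV_step m).
Proof. by case: stepE => m' ->; exact: measure_semi_sigma_additive. Qed.

HB.instance Definition _ := isMeasure.Build _ _ _
  (lebesgue_rV_step m) step0 step_ge0 step_sigma_additive.

End lebesgue_rV_step_measure.

Fixpoint lebesgue_rV (n : nat) : {measure set 'rV[R]_n -> \bar R} :=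
  match n with
  | 0 => \d_(0 : 'rV[R]_0)
  | k.+1 => lebesgue_rV_step (lebesgue_rV k)
  end.

Lemma lebesgue_rV_box n (a b : 'rV[R]_n) : (forall i, a 0 i <= b 0 i) ->
  lebesgue_rV n [set x | forall i, x 0 i \in `[a 0 i, b 0 i]] =
  (\prod_(i < n) (b 0 i - a 0 i))%:E.
Proof.
elim: n a b => [|n IH] a b ab.
  rewrite big_ord0 /= diracE mem_set//=.
  by case.
pose a' : 'rV[R]_n := \row_i a 0 (lift ord0 i).
pose b' : 'rV[R]_n := \row_i b 0 (lift ord0 i).
pose B := [set x : 'rV[R]_n | forall i, x 0 i \in `[a' 0 i, b' 0 i]].
have mB : measurable B.
  have -> : B = \bigcap_(i in [set: 'I_n])
      ((fun x : 'rV[R]_n => x 0 i) @^-1` `[a' 0 i, b' 0 i]%classic).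
    rewrite predeqE => x; split=> [Bx i _|Bx i]; first exact: Bx.
    exact: (Bx i Logic.I).
  apply: fin_bigcap_measurable => // i _.
  rewrite -[X in measurable X]setTI.
  exact: (@measurable_coor R n i measurableT _ (measurable_itv _)).
have E : @rV_cons n @^-1` [set x | forall i, x 0 i \in `[a 0 i, b 0 i]] =
    B `*` `[a 0 ord0, b 0 ord0]%classic.
  rewrite predeqE => -[x t]; split=> /=.
    move=> H; split=> [i|].
      by have := H (lift ord0 i); rewrite /rV_cons !mxE liftK.
    by have := H ord0; rewrite /rV_cons mxE unlift_none.
  move=> [Bx tab] i; rewrite /rV_cons mxE.
  case: unliftP => [j ->|-> //].
  by have := Bx j; rewrite !mxE.
rewrite /= /lebesgue_rV_step /pushforward E product_measure1E//=.
rewrite IH; last by move=> i; rewrite !mxE.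
rewrite lebesgue_measure_itv/= lte_fin big_ord_recl mulrC EFinM.
congr (_ * _)%E.
  by congr (_%:E); apply: eq_bigr => i _; rewrite !mxE.
case: ltP => // ba; suff -> : b 0 ord0 = a 0 ord0 by rewrite subrr.
by apply/eqP; rewrite eq_le ba ab.
Qed.

End lebesgue.

Section sobolev.
Context (R : realType) (n : nat).
Notation Rn := 'rV[R]_n.
Notation mu := (lebesgue_rV R n).
Implicit Types (u v g : Rn -> R) (i : 'I_n).

Definition L2 u : Prop := u \in Lfun mu 2%:E.

Definition L4norm u : R := fine ('N[mu]_4%:E [EFin \o u])%E.

Definition dotv (x y : Rn) : R := \sum_(i < n) x 0 i * y 0 i.

Definition enorm (x : Rn) : R := Num.sqrt (dotv x x).

Definition pderiv i (f : Rn -> R) : Rn -> R :=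
  fun x => 'D_(delta_mx 0 i) (f : Rn -> R^o) x.

Definition smooth (f : Rn -> R) : Prop :=
  forall (s : seq 'I_n) (x : Rn),
    differentiable (foldr pderiv f s : Rn -> R^o) x.

Definition test_function (f : Rn -> R) : Prop :=
  smooth f /\ compact (closure [set x | f x != 0]).

Definition is_weak_pderiv i u g : Prop :=
  L2 g /\ forall eta, test_function eta ->
    \int[mu]_x (u x * pderiv i eta x) = - \int[mu]_x (g x * eta x).

(* Weak derivatives are unique up to a null set: this is a representative,
   meaningful when one exists. *)
Definition weak_pderiv i u : Rn -> R := get [set g | is_weak_pderiv i u g].

Definition H1 u : Prop := L2 u /\ forall i, exists g, is_weak_pderiv i u g.

Definition H1norm u : R :=
  Num.sqrt (\int[mu]_x (u x ^+ 2 + \sum_(i < n) weak_pderiv i u x ^+ 2)).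

(* The Plancherel transform of a real u in L^2 is
     (2 pi)^(-n/2) (C - i S),
   where C and S are the L^2-limits as N -> oo of
   \int_(|x| <= N) u(x) k(x . xi) dx for k = cos and k = sin respectively. *)
Definition is_L2_transform (k : R -> R) u v : Prop :=
  L2 v /\
  (\int[mu]_xi
     ((\int[mu]_(x in [set x | enorm x <= N%:R]) (u x * k (dotv x xi))
       - v xi) ^+ 2)%:E @[N --> \oo] --> 0)%E.

(* A real even symbol acts on the cosine and sine parts separately. *)
Definition is_fourier_multiplier (sigma : Rn -> R) u g : Prop :=
  L2 g /\ forall k, k = cos \/ k = sin -> exists v,
    is_L2_transform k u v /\ is_L2_transform k g (fun xi => sigma xi * v xi).

Definition is_Lop (b : R) u g : Prop :=
  is_fourier_multiplier (fun xi => enorm xi `^ (- (2 * b))) u g.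

(* L_b = D^(-2b); as for weak_pderiv, a representative of an a.e. class. *)
Definition Lop (b : R) u : Rn -> R := get [set g | is_Lop b u g].

Definition X_space (b : R) u : Prop := H1 u /\ exists g, is_Lop (b / 2) u g.

End sobolev.

Section ground_states.
Context (R : realType) (n : nat) (omega b : R).
Notation Rn := 'rV[R]_n.
Notation mu := (lebesgue_rV R n).
Implicit Types (u v phi : Rn -> R) (e : R).

Definition energy e u : R :=
  \int[mu]_x (e * Lop (b / 2) u x ^+ 2
              + \sum_(i < n) weak_pderiv i u x ^+ 2 + omega * u x ^+ 2).

Definition energy_space e u : Prop := if e == 0 then H1 u else X_space b u.

Definition nonzero u : Prop := ~ (u = cst 0 %[ae mu]).

(* If the L^4 norm of u is infinite, then L4norm u = 0 and the quotient is 0,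
   in accordance with 1 / oo = 0. *)
Definition energy_quotient e u : R := energy e u / L4norm u ^+ 2.

Definition minimum e : R :=
  inf [set energy_quotient e u | u in [set u | energy_space e u /\ nonzero u]].

Definition minimizer e u : Prop :=
  [/\ energy_space e u, nonzero u & energy_quotient e u = minimum e].

(* Weak form of  omega phi - Laplacian phi + e L_b phi = phi^3,  where L_b is
   split symmetrically since L_b phi need not be in L^2 for phi in X_b. *)
Definition solution e phi : Prop :=
  [/\ energy_space e phi, phi \in Lfun mu 4%:E &
    forall v, energy_space e v ->
      \int[mu]_x (omega * (phi x * v x)
                  + \sum_(i < n) weak_pderiv i phi x * weak_pderiv i v x
                  + e * (Lop (b / 2) phi x * Lop (b / 2) v x))
      = \int[mu]_x (phi x ^+ 3 * v x)].

Definition ground_state e phi : Prop :=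
  solution e phi /\ exists (u : Rn -> R) (c : R),
    [/\ minimizer e u, 0 < c & phi = (fun x => c * u x)].

End ground_states.

(* Main.v *)
Require Import Defs.
From HB Require Import structures.
From mathcomp Require Import all_boot all_order all_algebra.
From mathcomp Require Import all_classical all_reals all_analysis.
From mathcomp Require Import measurable_realfun ring lra.
Set Implicit Arguments.
Unset Strict Implicit.
Unset Printing Implicit Defensive.
Import Order.TTheory GRing.Theory Num.Theory.
Import numFieldNormedType.Exports.
Local Open Scope classical_set_scope.
Local Open Scope ring_scope.

(** A ground state for the parameter [e] is a minimizer of the quotient of the
  quadratic energy by the squared [L^4] norm, rescaled so that its energy and
  the fourth power of its norm coincide; both are then the square of the
  minimum ([ground_state_facts]). For [e = 0] this says that the inequality
  [M * N4 u <= H1energy u ^ 2], with [M = N4 phi0], holds on [H^1] with equality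
  at [phi0]. Everything about the embedding of [H^1] into [L^4] is read off this
  inequality by dilations: it can only have an extremal function in dimension
  at most three ([sobolev_dimension]), it interpolates between [L^2] and the
  gradient ([sobolev_interpolation]), and it prevents bounded sequences from
  spreading out evenly ([nonvanishing]).

  The fourth powers of the norms of the ground states [phi k] tend to [M]
  ([ground_state_mass_cvg]): the inequality above bounds them from below, and
  truncations of [phi0] are competitors that bound them from above. Here
  [b < n / 2] is used: the symbol of [D^(-b)] is square integrable at the origin,
  so that compactly supported [H^1] functions belong to the space [X]
  ([compact_support_X]).

  After a translation that puts a window carrying mass at the origin, a
  subsequence of the [phi k] converges weakly in [H^1] to some nonzero [psi]
  ([nonzero_weak_limit]). Convergence is strong on bounded sets and the nonlocal
  term vanishes in the limit, so [psi] solves the limit equation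
  ([weak_limit_equation]). Hence its energy is [N4 psi], which the inequality
  above bounds from below by [M]. With [v k] the translate of [phi k], the energy
  of [v k - psi] is at most [N4 (phi k) - 2 * form (v k) psi + H1energy psi],
  which tends to [M - H1energy psi]. Therefore the energy of [psi] is exactly [M], and
  convergence is strong ([weak_limit_strong]). Thus [psi] is a ground state of
  the limit problem, and uniqueness identifies it with a translate of [phi0] up
  to sign.

  The Hilbert space theory of [L^2] rests on [riesz], from which weak
  compactness and the density of test functions follow. The Fourier transform
  on [L^2] serves three facts about the operators [L_b]: they are well defined
  ([multiplier_unique]), homogeneous ([multiplierZ]), and bounded by the [L^1]
  and [L^2] norms ([Lop_exists]). The first and the last depend on Parseval's
  identity, which is regularized by the kernel [exp (- |x_1| - ... - |x_n|)]
  because its transform is an explicit positive function. *)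

(** * Subsequences and limits of real functions *)

Lemma extract_subsequence (P : nat -> nat -> Prop) :
  (forall j N, exists2 k, (N <= k)%N & P j k) ->
  exists2 sub : nat -> nat, {homo sub : i j / (i < j)%N} & forall j, P j (sub j).
Proof.
move=> H.
have /choice[f fP] : forall p : nat * nat, exists k, (p.2 <= k)%N /\ P p.1 k.
  by move=> [j N]; have [k] := H j N; exists k.
pose sub := fix sub j := if j is i.+1 then f (j, (sub i).+1) else f (0%N, 0%N).
exists sub; last by case=> [|j]; [exact: (proj2 (fP (0%N, 0%N)))|exact: (proj2 (fP (j.+1, _)))].
apply: homo_ltn => [j i k|i]; first exact: ltn_trans.
exact: (proj1 (fP (i.+1, (sub i).+1))).
Qed.

Section real_limits.
Context (R : realType) (I : Type) (F : set_system I) {FF : Filter F}.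
Implicit Types (f g : I -> R) (a b c : R).

Lemma rcvgD f g a b : f i @[i --> F] --> a -> g i @[i --> F] --> b ->
  f i + g i @[i --> F] --> a + b.
Proof. exact: cvgD. Qed.

Lemma rcvgB f g a b : f i @[i --> F] --> a -> g i @[i --> F] --> b ->
  f i - g i @[i --> F] --> a - b.
Proof. exact: cvgB. Qed.

Lemma rcvgM f g a b : f i @[i --> F] --> a -> g i @[i --> F] --> b ->
  f i * g i @[i --> F] --> a * b.
Proof. exact: cvgM. Qed.

Lemma rcvg_cst a : (fun _ : I => a) i @[i --> F] --> a.
Proof. exact: cvg_cst. Qed.

Lemma rcvgZ f a c : f i @[i --> F] --> a -> c * f i @[i --> F] --> c * a.
Proof. by move=> fa; apply: rcvgM => //; exact: rcvg_cst. Qed.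

Lemma rcvgX f a k : f i @[i --> F] --> a -> f i ^+ k @[i --> F] --> a ^+ k.
Proof.
move=> fa; elim: k => [|k IH].
  by under eq_fun do rewrite expr0; rewrite expr0; exact: rcvg_cst.
by under eq_fun do rewrite exprS; rewrite exprS; exact: rcvgM.
Qed.

End real_limits.
Arguments rcvg_cst {R I F FF} a.
Arguments rcvgZ {R I F FF f a} c _.

Section real_limits_le.
Context (R : realType) (I : Type) (F : set_system I) {FF : ProperFilter F}.
Implicit Types (f g : I -> R) (a b c : R).

Lemma rcvg_le f g a b : f i @[i --> F] --> a -> g i @[i --> F] --> b ->
  (forall i, f i <= g i) -> a <= b.
Proof.
move=> fa gb fg; rewrite -subr_ge0.
have H : g i - f i @[i --> F] --> b - a by exact: rcvgB.
have := limr_ge (cvgP _ H).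
by rewrite (cvg_lim _ H)//; apply; apply: nearW => i; rewrite subr_ge0.
Qed.

Lemma rcvg_le_cst f a b : f i @[i --> F] --> a -> (forall i, f i <= b) -> a <= b.
Proof. by move=> fa fb; exact (rcvg_le fa (rcvg_cst b) fb). Qed.

Lemma rcvg_ge_cst f a b : f i @[i --> F] --> a -> (forall i, b <= f i) -> b <= a.
Proof. by move=> fa fb; exact (rcvg_le (rcvg_cst b) fa fb). Qed.

Lemma rcvg_squeeze0 f g : (forall i, 0 <= f i <= g i) -> g i @[i --> F] --> (0 : R) ->
  f i @[i --> F] --> (0 : R).
Proof.
move=> fg g0; apply: (squeeze_cvgr (f := fun _ => 0) (h := g)) => //.
- exact: nearW.
- exact: rcvg_cst.
Qed.

End real_limits_le.

Lemma norm_lt_sqr (R : realType) (a b : R) : 0 < b -> a ^+ 2 < b ^+ 2 -> `|a| < b.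
Proof. by move=> b0 H; rewrite -ltr_sqr ?nnegrE ?normr_ge0 ?(ltW b0)// real_normK// num_real. Qed.

Lemma sqr_le_norm (R : realType) (a b : R) : `|a| <= b -> a ^+ 2 <= b ^+ 2.
Proof.
by move=> ab; rewrite -real_normK ?num_real// ler_sqr ?nnegrE// (le_trans _ ab).
Qed.

Lemma rcvg_eq (R : realType) (f g : nat -> R) (a : R) : f =1 g ->
  f k @[k --> \oo] --> a -> g k @[k --> \oo] --> a.
Proof. by move=> /funext ->. Qed.

Lemma rcvg_unique (R : realType) (f : nat -> R) (a b : R) :
  f k @[k --> \oo] --> a -> f k @[k --> \oo] --> b -> a = b.
Proof. exact: (cvg_unique (@norm_hausdorff _ R^o)). Qed.

Section big_limits.
Context (R : realType) (T I : Type) (F : set_system T) {FF : Filter F}.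

Lemma rcvg_prod (s : seq I) (f : T -> I -> R) (l : I -> R) :
  (forall i, f x i @[x --> F] --> l i) ->
  \prod_(i <- s) f x i @[x --> F] --> \prod_(i <- s) l i.
Proof.
move=> fl; elim: s => [|i s IH].
  by rewrite big_nil; under eq_fun do rewrite big_nil; exact: rcvg_cst.
by rewrite big_cons; under eq_fun do rewrite big_cons; exact: rcvgM.
Qed.

Lemma rcvg_sum (s : seq I) (f : T -> I -> R) (l : I -> R) :
  (forall i, f x i @[x --> F] --> l i) ->
  \sum_(i <- s) f x i @[x --> F] --> \sum_(i <- s) l i.
Proof.
move=> fl; elim: s => [|i s IH].
  by rewrite big_nil; under eq_fun do rewrite big_nil; exact: rcvg_cst.
by rewrite big_cons; under eq_fun do rewrite big_cons; exact: rcvgD.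
Qed.

End big_limits.

Section null_sequences.
Context (R : realType).
Implicit Types f h : nat -> R.

(** Errors that vanish in the limit may be preceded by an arbitrarily small
  constant error. *)
Lemma rcvg_approx0 f : (forall k, 0 <= f k) ->
  (forall e : R, 0 < e -> exists2 h, h k @[k --> \oo] --> (0 : R) & forall k, f k <= e + h k) ->
  f k @[k --> \oo] --> (0 : R).
Proof.
move=> f0 H; apply/cvgrPdist_lt => e e0.
have [h h0 fh] := H (e / 2) (divr_gt0 e0 (ltr0n R 2)).
have /cvgrPdist_lt /(_ (e / 2) (divr_gt0 e0 (ltr0n R 2))) := h0; apply: filterS => k.
rewrite !sub0r !normrN (ger0_norm (f0 k)) => hk; have := fh k; have := ler_norm (h k).
have arith (a b c d : R) : b <= c -> d <= a / 2 + b -> c < a / 2 -> d < a by lra.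
by move=> h1 h2; exact: (arith _ _ _ _ h1 h2 hk).
Qed.

Lemma rcvg_sqr0 f : f k ^+ 2 @[k --> \oo] --> (0 : R) -> f k @[k --> \oo] --> (0 : R).
Proof.
move=> H; apply/cvgrPdist_lt => e e0.
have /cvgrPdist_lt /(_ (e ^+ 2) (exprn_gt0 2 e0)) := H; apply: filterS => k.
rewrite !sub0r !normrN normrX => h; rewrite -(ltr_pXn2r (n := 2))// nnegrE//.
exact: ltW.
Qed.

Lemma rcvg_subsequence f a (sub : nat -> nat) : {homo sub : i j / (i < j)%N} ->
  f k @[k --> \oo] --> (a : R) -> f (sub k) @[k --> \oo] --> (a : R).
Proof.
move=> hs fa; have ge k : (k <= sub k)%N.
  by elim: k => // k IH; exact: leq_ltn_trans IH (hs _ _ (ltnSn k)).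
apply/cvgrPdist_lt => e e0; have /cvgrPdist_lt /(_ e e0) [N _ HN] := fa.
by exists N => // k /= Nk; apply: HN => /=; exact: leq_trans Nk (ge k).
Qed.

End null_sequences.

(** * Real-valued integrals *)

Section rintegral.
Context d (T : measurableType d) (R : realType) (mu : {measure set T -> \bar R}).
Implicit Types (f g u v w : T -> R) (c : R).

Notation intg f := (mu.-integrable [set: T] (EFin \o f)).
Notation J f := (Rintegral mu [set: T] f).

Lemma intg_measurable f : intg f -> measurable_fun [set: T] f.
Proof. by move=> /measurable_int/measurable_EFinP. Qed.

Lemma intgD f g : intg f -> intg g -> intg (fun x => f x + g x).
Proof. by move=> fi gi; exact: (integrableD measurableT fi gi). Qed.

Lemma intgZ c f : intg f -> intg (fun x => c * f x).
Proof. by move=> fi; exact: (integrableZl measurableT c fi). Qed.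

Lemma intgN f : intg f -> intg (fun x => - f x).
Proof.
move=> fi; have := intgZ (-1) fi.
by under [X in _.-integrable _ (_ \o X)]eq_fun do rewrite mulN1r.
Qed.

Lemma intgB f g : intg f -> intg g -> intg (fun x => f x - g x).
Proof. by move=> fi gi; exact: intgD fi (intgN gi). Qed.

Lemma intg0 : intg (fun _ => 0).
Proof. exact: integrable0. Qed.

Lemma intg_sum (I : Type) (s : seq I) (F : I -> T -> R) :
  (forall i, intg (F i)) -> intg (fun x => \sum_(i <- s) F i x).
Proof.
move=> Fi; elim: s => [|i s IH].
  under [X in _.-integrable _ (_ \o X)]eq_fun do rewrite big_nil.
  exact: intg0.
under [X in _.-integrable _ (_ \o X)]eq_fun do rewrite big_cons.
exact: intgD.
Qed.

Lemma intg_le f g : measurable_fun [set: T] f -> (forall x, `|f x| <= g x) ->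
  intg g -> intg f.
Proof.
move=> mf fg; apply: le_integrable => //; first exact/measurable_EFinP.
by move=> x _ /=; rewrite lee_fin (le_trans (fg x))// ler_norm.
Qed.

Lemma intg_eq f g : f =1 g -> intg f -> intg g.
Proof. by move=> /funext ->. Qed.

Lemma intg_norm f : intg f -> intg (fun x => `|f x|).
Proof. exact: integrable_norm. Qed.

Lemma ge0_intg f : measurable_fun [set: T] f -> (forall x, 0 <= f x) ->
  (\int[mu]_x (f x)%:E < +oo)%E -> intg f.
Proof.
move=> mf f0 fy; apply/integrableP; split; first exact/measurable_EFinP.
by under eq_integral do rewrite /= ger0_norm//.
Qed.

Lemma J_EFin f : intg f -> (\int[mu]_x (f x)%:E)%E = (J f)%:E.
Proof. by move=> fi; rewrite /Rintegral fineK// integrable_fin_num. Qed.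

Lemma JD f g : intg f -> intg g -> J (fun x => f x + g x) = J f + J g.
Proof. exact: RintegralD. Qed.

Lemma JZ c f : intg f -> J (fun x => c * f x) = c * J f.
Proof. by move=> fi; rewrite RintegralZl. Qed.

Lemma JB f g : intg f -> intg g -> J (fun x => f x - g x) = J f - J g.
Proof. exact: RintegralB. Qed.

Lemma JN f : intg f -> J (fun x => - f x) = - J f.
Proof.
by move=> fi; under eq_Rintegral do rewrite -mulN1r; rewrite JZ// mulN1r.
Qed.

Lemma J0 : J (fun _ => 0) = 0.
Proof. by rewrite /Rintegral integral0. Qed.

Lemma J_sum (I : Type) (s : seq I) (F : I -> T -> R) :
  (forall i, intg (F i)) ->
  J (fun x => \sum_(i <- s) F i x) = \sum_(i <- s) J (F i).
Proof.
move=> Fi; elim: s => [|i s IH].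
  by rewrite big_nil -[RHS]J0; apply: eq_Rintegral => x _; rewrite big_nil.
rewrite big_cons -IH -JD//; last exact: intg_sum.
by apply: eq_Rintegral => x _; rewrite big_cons.
Qed.

Lemma J_ge0 f : (forall x, 0 <= f x) -> 0 <= J f.
Proof. by move=> f0; apply: Rintegral_ge0 => x _. Qed.

Lemma J_le f g : intg f -> intg g -> (forall x, f x <= g x) -> J f <= J g.
Proof. by move=> fi gi fg; apply: le_Rintegral => // x _. Qed.

Lemma J_norm f : intg f -> `|J f| <= J (fun x => `|f x|).
Proof. exact: le_normr_Rintegral. Qed.

Lemma J_eq f g : f =1 g -> J f = J g.
Proof. by move=> /funext ->. Qed.

Lemma J_ae f g : measurable_fun [set: T] f -> measurable_fun [set: T] g ->
  f = g %[ae mu] -> J f = J g.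
Proof.
move=> mf mg fg; rewrite /Rintegral; congr fine; apply: ae_eq_integral => //.
- exact/measurable_EFinP.
- exact/measurable_EFinP.
- by apply: filterS fg => x /= e xT; rewrite e.
Qed.

Lemma eintg_ae (f g : T -> \bar R) : measurable_fun [set: T] g ->
  ae_eq mu setT f g -> mu.-integrable setT f -> mu.-integrable setT g.
Proof.
move=> mg fg /integrableP[mf fi]; apply/integrableP; split => //.
suff <- : (\int[mu]_x `|f x| = \int[mu]_x `|g x|)%E by [].
apply: ae_eq_integral => //; [exact: measurableT_comp|exact: measurableT_comp|].
by apply: filterS fg => x /= e xT; rewrite e.
Qed.

Lemma intg_ae f g : measurable_fun [set: T] g ->
  f = g %[ae mu] -> intg f -> intg g.
Proof.
move=> mg fg; apply: eintg_ae; first exact/measurable_EFinP.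
by apply: filterS fg => x /= e xT; rewrite e.
Qed.

Lemma J_dct (F : nat -> T -> R) f g : (forall k, measurable_fun [set: T] (F k)) ->
  (forall x, F k x @[k --> \oo] --> f x) -> (forall k x, `|F k x| <= g x) ->
  intg g -> intg f /\ J (F k) @[k --> \oo] --> J f.
Proof.
move=> mF Ff Fg gi.
have mf : measurable_fun [set: T] f.
  by apply: (measurable_fun_cvg mF) => x _; exact: Ff.
have [] := @dominated_convergence _ _ _ mu _ measurableT
  (fun k => EFin \o F k) (EFin \o f) (EFin \o g).
- by move=> k; apply/measurable_EFinP.
- exact/measurable_EFinP.
- by apply/nearW => x _; apply: cvg_EFin; [exact: nearW|exact: Ff].
- exact: gi.
- by apply/nearW => x k _; rewrite /= lee_fin.
move=> fi _ H; split => //; apply: fine_cvg.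
by rewrite -J_EFin.
Qed.

Lemma J_fatou (F : nat -> T -> R) f C : (forall k, intg (F k)) ->
  (forall k x, 0 <= F k x) -> (forall x, F k x @[k --> \oo] --> f x) ->
  (forall k, J (F k) <= C) -> intg f /\ J f <= C.
Proof.
move=> Fi F0 Ff JC.
have f0 x : 0 <= f x.
  by have := limr_ge (cvgP _ (Ff x)); rewrite (cvg_lim _ (Ff x))//; apply; exact: nearW.
have mf : measurable_fun [set: T] f.
  by apply: (@measurable_fun_cvg _ _ _ _ F) => [k|x _]; [exact: intg_measurable|exact: Ff].
have H : (\int[mu]_x (f x)%:E <= C%:E)%E.
  have := @fatou _ _ _ mu _ measurableT (fun k => EFin \o F k)
    (fun k => measurable_int _ (Fi k)) (fun k x _ => F0 k x).
  have -> : (fun x => limn_einf (fun k => (EFin \o F k) x)) = EFin \o f.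
    apply/funext => x; rewrite (cvg_limn_einf_sup (l := (f x)%:E))//.
    by apply: cvg_EFin; [exact: nearW|exact: Ff].
  move=> /le_trans; apply.
  rewrite limn_einf_lim; apply: lime_le; first exact: is_cvg_einfs.
  apply: nearW => k; rewrite /einfs; apply: ge_ereal_inf; exists (J (F k))%:E; last by rewrite lee_fin.
  by exists k; rewrite /= -?J_EFin.
split; first by apply: ge0_intg => //; exact: le_lt_trans H (ltry _).
by rewrite -lee_fin -J_EFin//; apply: ge0_intg => //; exact: le_lt_trans H (ltry _).
Qed.

End rintegral.

(** * Square integrable functions *)

Section square_integrable.
Context d (T : measurableType d) (R : realType) (mu : {measure set T -> \bar R}).
Implicit Types (f g u v w : T -> R) (c : R).
Notation intg f := (mu.-integrable [set: T] (EFin \o f)).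
Notation J f := (Rintegral mu [set: T] f).

Definition sqint u := measurable_fun [set: T] u /\ intg (fun x => u x ^+ 2).

Lemma sqintP u : u \in Lfun mu 2%:E <-> sqint u.
Proof.
split=> [u2|[mu_ ui]].
  split; last exact: Lfun2_integrable_sqr.
  by have /sub_Lfun_mfun := u2; rewrite inE.
rewrite inE; apply/andP; split; rewrite inE//= /finite_norm unlock.
apply: poweR_lty; have /integrableP[_] := ui; congr (_ < _)%E.
by apply: eq_integral => x _ /=; rewrite powR_mulrn// normrX.
Qed.

Lemma sqint_mul u v : sqint u -> sqint v -> intg (fun x => u x * v x).
Proof.
move=> [mu_ u2] [mv v2]; apply: (intg_le _ _ (intgD u2 v2)).
  exact: measurable_funM.
move=> x; rewrite normrM -[u x ^+ 2]real_normK ?num_real//.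
rewrite -[v x ^+ 2]real_normK ?num_real//.
have := sqr_ge0 (`|u x| - `|v x|); have := normr_ge0 (u x); have := normr_ge0 (v x); nra.
Qed.

Lemma sqint_le u v : measurable_fun [set: T] u -> (forall x, `|u x| <= `|v x|) ->
  sqint v -> sqint u.
Proof.
move=> mu_ uv [mv v2]; split=> //; apply: (intg_le _ _ v2).
  exact: measurable_funX.
move=> x; rewrite normrX -[leRHS]real_normK ?num_real//.
by rewrite lerXn2r// nnegrE.
Qed.

Lemma sqintD u v : sqint u -> sqint v -> sqint (fun x => u x + v x).
Proof.
move=> u2 v2; split; first by apply: measurable_funD; [case: u2|case: v2].
apply: (intg_eq _ (intgD (intgD u2.2 v2.2) (intgZ 2 (sqint_mul u2 v2)))).
by move=> x; ring.
Qed.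

Lemma sqintZ c u : sqint u -> sqint (fun x => c * u x).
Proof.
move=> [mu_ u2]; split; first exact: measurable_funM.
by apply: (intg_eq _ (intgZ (c ^+ 2) u2)) => x; ring.
Qed.

Lemma sqintN u : sqint u -> sqint (fun x => - u x).
Proof.
move=> /(sqintZ (-1)) [m i]; split.
  by apply: eq_measurable_fun m => x _; rewrite mulN1r.
by apply: intg_eq i => x; ring.
Qed.

Lemma sqintB u v : sqint u -> sqint v -> sqint (fun x => u x - v x).
Proof. by move=> u2 v2; exact: sqintD u2 (sqintN v2). Qed.

Lemma sqint0 : sqint (fun _ => 0).
Proof. by split=> //; apply: (intg_eq _ (intg0 mu)) => x; ring. Qed.

Lemma sqint_ae u v : measurable_fun [set: T] v -> u = v %[ae mu] -> sqint u -> sqint v.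
Proof.
move=> mv uv [mu_ u2]; split=> //.
apply: (@intg_ae _ _ _ _ (fun x => u x ^+ 2)) => //; first exact: measurable_funX.
by apply: filterS uv => x /= ->.
Qed.

Lemma J_sqrZ c u : sqint u -> J (fun x => (c * u x) ^+ 2) = c ^+ 2 * J (fun x => u x ^+ 2).
Proof. by move=> [_ u2]; rewrite -JZ//; apply: J_eq => x; ring. Qed.

Lemma J_sqr_ge0 u : 0 <= J (fun x => u x ^+ 2).
Proof. by apply: J_ge0 => x; exact: sqr_ge0. Qed.

Lemma J_sqrD u v : sqint u -> sqint v ->
  J (fun x => (u x + v x) ^+ 2) =
  J (fun x => u x ^+ 2) + 2 * J (fun x => u x * v x) + J (fun x => v x ^+ 2).
Proof.
move=> u2 v2; have uv := sqint_mul u2 v2; have [_ ui] := u2; have [_ vi] := v2.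
rewrite -JZ// -JD//; last exact: intgZ.
rewrite -JD//; last by apply: intgD => //; exact: intgZ.
by apply: J_eq => x; ring.
Qed.

Lemma J_sqrD_le u v : sqint u -> sqint v -> J (fun x => (u x + v x) ^+ 2) <=
  2 * J (fun x => u x ^+ 2) + 2 * J (fun x => v x ^+ 2).
Proof.
move=> u2 v2; have [_ ui] := u2; have [_ vi] := v2.
rewrite -!JZ// -JD; try exact: intgZ.
apply: J_le; [by case: (sqintD u2 v2)| by apply: intgD; exact: intgZ|move=> x].
by have := sqr_ge0 (u x - v x); nra.
Qed.

Lemma J_sqrB_le u v : sqint u -> sqint v -> J (fun x => (u x - v x) ^+ 2) <=
  2 * J (fun x => u x ^+ 2) + 2 * J (fun x => v x ^+ 2).
Proof.
move=> u2 v2; apply: le_trans (J_sqrD_le u2 (sqintN v2)) _.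
by rewrite (_ : J (fun x => (- v x) ^+ 2) = J (fun x => v x ^+ 2))//; apply: J_eq => x; ring.
Qed.

(** The square norm of [u + t v] is a nonnegative polynomial in [t]. *)
Lemma cauchy_schwarz u v : sqint u -> sqint v ->
  J (fun x => u x * v x) ^+ 2 <= J (fun x => u x ^+ 2) * J (fun x => v x ^+ 2).
Proof.
move=> u2 v2; set B := J (fun x => u x * v x).
have H t : 0 <= J (fun x => u x ^+ 2) + 2 * t * B + t ^+ 2 * J (fun x => v x ^+ 2).
  have := J_sqr_ge0 (fun x => u x + t * v x).
  rewrite J_sqrD//; last exact: sqintZ.
  rewrite J_sqrZ// (_ : J (fun x => u x * (t * v x)) = t * B) ?mulrA//.
  by rewrite -JZ; [apply: J_eq => x; ring|exact: sqint_mul].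
have := J_sqr_ge0 u; have := J_sqr_ge0 v.
move: H; move: (J (fun x => u x ^+ 2)) (J (fun x => v x ^+ 2)) B => a b B H b0 a0.
have [b1|b1] := eqVneq b 0.
  rewrite b1 mulr0; have [->|B0] := eqVneq B 0; first by rewrite expr0n.
  have := H (- (a + 1) / (2 * B)); rewrite b1 mulr0 addr0.
  have -> : 2 * (- (a + 1) / (2 * B)) * B = - (a + 1) by field.
  by lra.
have := H (- B / b); have bp : 0 < b by lra.
have -> : a + 2 * (- B / b) * B + (- B / b) ^+ 2 * b = (a * b - B ^+ 2) / b by field.
by rewrite pmulr_lge0 ?invr_gt0// subr_ge0.
Qed.

Lemma J_sqr_eq0 u : sqint u -> J (fun x => u x ^+ 2) = 0 -> u = cst 0 %[ae mu].
Proof.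
move=> [mu_ u2] u0.
have H : (\int[mu]_x `|(u x ^+ 2)%:E| = 0)%E.
  under eq_integral do rewrite /= ger0_norm ?sqr_ge0//.
  by rewrite J_EFin// u0.
have [/(_ H) + _] := ae_eq_integral_abs mu measurableT (measurable_int _ u2).
by apply: filterS => x /(_ Logic.I) /= [] /eqP; rewrite sqrf_eq0 => /eqP.
Qed.

Lemma cvg_of_sqr (a b : nat -> R) (l : R) :
  (forall k, (a k - l) ^+ 2 <= b k) -> b k @[k --> \oo] --> 0 ->
  a k @[k --> \oo] --> l.
Proof.
move=> ab b0; apply/cvgrPdist_lt => e e0.
have /cvgrPdist_lt/(_ (e ^+ 2)) := b0; rewrite exprn_gt0// => /(_ isT).
apply: filterS => k; rewrite sub0r normrN => /(le_lt_trans (ler_norm _)) bk.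
rewrite distrC -(ltr_pXn2r (n := 2)) ?nnegrE ?(ltW e0)//.
by rewrite real_normK ?num_real// (le_lt_trans (ab k)).
Qed.

Lemma ip_cvg (u_ : nat -> T -> R) u v : (forall k, sqint (u_ k)) -> sqint u ->
  sqint v -> J (fun x => (u_ k x - u x) ^+ 2) @[k --> \oo] --> 0 ->
  J (fun x => u_ k x * v x) @[k --> \oo] --> J (fun x => u x * v x).
Proof.
move=> uk2 u2 v2 uku.
apply: (cvg_of_sqr (b := fun k => J (fun x => (u_ k x - u x) ^+ 2) * J (fun x => v x ^+ 2))).
  move=> k; rewrite -JB; [|exact: sqint_mul|exact: sqint_mul].
  rewrite (_ : J _ = J (fun x => (u_ k x - u x) * v x)); last by apply: J_eq => x; ring.
  by apply: cauchy_schwarz => //; exact: sqintB.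
by rewrite -[X in _ --> X](mul0r (J (fun x => v x ^+ 2))); apply: rcvgM => //; exact: rcvg_cst.
Qed.

Lemma J_sqr_cvg (u_ : nat -> T -> R) u : (forall k, sqint (u_ k)) -> sqint u ->
  J (fun x => (u_ k x - u x) ^+ 2) @[k --> \oo] --> 0 ->
  J (fun x => u_ k x ^+ 2) @[k --> \oo] --> J (fun x => u x ^+ 2).
Proof.
move=> uk2 u2 uku; have H := ip_cvg uk2 u2 u2 uku.
have -> : (fun k => J (fun x => u_ k x ^+ 2)) = (fun k =>
   J (fun x => (u_ k x - u x) ^+ 2) + 2 * J (fun x => u_ k x * u x) - J (fun x => u x ^+ 2)).
  apply/funext => k; rewrite (J_sqrD (uk2 k) (sqintN u2)).
  rewrite (_ : J (fun x => u_ k x * - u x) = - J (fun x => u_ k x * u x)); last first.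
    by rewrite -JN; [apply: J_eq => x; ring|exact: sqint_mul].
  rewrite (_ : J (fun x => (- u x) ^+ 2) = J (fun x => u x ^+ 2)); last first.
    by apply: J_eq => x; ring.
  by ring.
rewrite [X in _ --> X](_ : _ = 0 + 2 * J (fun x => u x * u x) - J (fun x => u x ^+ 2)); last first.
  by rewrite (_ : J (fun x => u x * u x) = J (fun x => u x ^+ 2)); [ring|exact: J_eq].
exact (rcvgB (rcvgD uku (rcvgZ 2 H)) (rcvg_cst _)).
Qed.

Lemma sqint_lim_unique (u_ : nat -> T -> R) u v : (forall k, sqint (u_ k)) ->
  sqint u -> sqint v ->
  J (fun x => (u_ k x - u x) ^+ 2) @[k --> \oo] --> 0 ->
  J (fun x => (u_ k x - v x) ^+ 2) @[k --> \oo] --> 0 -> u = v %[ae mu].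
Proof.
move=> uk2 u2 v2 cu cv.
suff : (fun x => u x - v x) = cst 0 %[ae mu].
  by apply: filterS => x /= H xT; apply/eqP; rewrite -subr_eq0 H.
apply: J_sqr_eq0; first exact: sqintB.
apply/eqP; rewrite eq_le J_sqr_ge0 andbT.
have H k : J (fun x => (u x - v x) ^+ 2) <=
    2 * J (fun x => (u_ k x - v x) ^+ 2) + 2 * J (fun x => (u_ k x - u x) ^+ 2).
  rewrite (le_trans _ (J_sqrB_le (sqintB (uk2 k) v2) (sqintB (uk2 k) u2)))//.
  by rewrite le_eqVlt; apply/orP; left; apply/eqP/J_eq => x; ring.
rewrite [leRHS](_ : 0 = 2 * 0 + 2 * 0)//; last by rewrite mulr0 addr0.
exact (rcvg_ge_cst (rcvgD (rcvgZ 2 cv) (rcvgZ 2 cu)) H).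
Qed.

(** This is the Riesz--Fischer theorem: along a subsequence with summable
  increments the functions converge almost everywhere, and Fatou's lemma
  controls the distance to the pointwise limit. *)
Lemma sqint_complete (u_ : nat -> T -> R) : (forall k, sqint (u_ k)) ->
  (forall e, 0 < e -> exists N, forall k l, (N <= k)%N -> (N <= l)%N ->
     J (fun x => (u_ k x - u_ l x) ^+ 2) <= e) ->
  exists2 u, sqint u & J (fun x => (u_ k x - u x) ^+ 2) @[k --> \oo] --> 0.
Proof.
move=> u2 Cu.
have [n_ n_incr n_P] : exists2 n_ : nat -> nat, {homo n_ : i j / (i < j)%N} &
    forall j, forall k l, (n_ j <= k)%N -> (n_ j <= l)%N ->
     J (fun x => (u_ k x - u_ l x) ^+ 2) <= 4 ^- j.
  apply: (@extract_subsequence (fun j n => forall k l, (n <= k)%N -> (n <= l)%N ->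
     J (fun x => (u_ k x - u_ l x) ^+ 2) <= 4 ^- j)) => j N.
  have [|M MP] := Cu (4 ^- j); first by rewrite invr_gt0 exprn_gt0.
  exists (maxn N M); first exact: leq_maxl.
  by move=> k l; rewrite !geq_max => /andP[_ ?] /andP[_ ?]; exact: MP.
pose dl k x := u_ (n_ k.+1) x - u_ (n_ k) x.
have dl2 k : sqint (dl k) by exact: sqintB.
(* Finiteness of [G] makes the increments summable, because
   [t <= 2 ^- k + 2 ^ k * t ^ 2]. *)
pose G x : \bar R := (\sum_(0 <= k <oo) (2 ^+ k * dl k x ^+ 2)%:E)%E.
have mdl k : measurable_fun [set: T] (fun x => (2 ^+ k * dl k x ^+ 2)%:E).
  by apply/measurable_EFinP; apply: measurable_funM => //; apply: measurable_funX; case: (dl2 k).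
have dl0 k x : (0 <= (2 ^+ k * dl k x ^+ 2)%:E)%E.
  by rewrite lee_fin mulr_ge0 ?sqr_ge0// exprn_ge0.
have mG : measurable_fun [set: T] G.
  by apply: ge0_emeasurable_sum => // k x _ _; exact: dl0.
have iG : mu.-integrable [set: T] G.
  apply/integrableP; split => //.
  under eq_integral do rewrite gee0_abs ?nneseries_ge0//.
  rewrite integral_nneseries//.
  apply: (@le_lt_trans _ _ (\sum_(0 <= k <oo) (1 / 2 ^+ k)%:E)%E).
    apply: lee_nneseries => [k _ _|k _]; first exact: integral_ge0.
    rewrite J_EFin; last by apply: intgZ; case: (dl2 k).
    rewrite lee_fin JZ; last by case: (dl2 k).
    have := n_P k (n_ k.+1) (n_ k); rewrite leqnn => /(_ _ isT).
    move=> /(_ (ltnW (n_incr _ _ (leqnn _)))) H.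
    have := ler_wpM2l (exprn_ge0 k (ler0n R 2)) H; move/le_trans; apply.
    rewrite -[4 in leLHS]/(4%:R) (_ : 4%:R = 2 * 2 :> R); last by rewrite -natrM.
    by rewrite exprMn invfM mulrA divff ?mul1r// expf_neq0.
  apply: (@le_lt_trans _ _ 2%:E); last exact: ltry.
  apply: lime_le; first by apply: is_cvg_nneseries => k _ _; rewrite lee_fin divr_ge0// exprn_ge0.
  apply: nearW => k; rewrite /= sumEFin lee_fin.
  rewrite [leLHS](_ : _ = 2 - 2 / 2 ^+ k) ?gerBl ?divr_ge0 ?exprn_ge0//.
  elim: k => [|k IH]; first by rewrite big_geq// expr0 divr1 subrr.
  rewrite big_nat_recr//= IH exprS invfM.
  by have : (2 ^+ k : R) != 0 by [rewrite expf_neq0//]; move=> ?; field.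
pose A := [set x | (G x < +oo)%E].
have mA : measurable A by rewrite -[A]setTI; exact: emeasurable_fun_infty_o.
have aeA : {ae mu, forall x, A x}.
  have := integrable_ae measurableT iG; apply: filterS => x /(_ Logic.I).
  by rewrite /A /= fin_numElt => /andP[].
(* Setting the functions to zero on the null set where [G] is infinite makes
   them converge everywhere. *)
pose v k x := u_ (n_ k) x * \1_A x.
have vu k : u_ (n_ k) = v k %[ae mu].
  by apply: filterS aeA => x Ax _; rewrite /v indicE mem_set// mulr1.
have mv k : measurable_fun [set: T] (v k).
  by apply: measurable_funM; [case: (u2 (n_ k))|exact: measurable_indic].
have v2 k : sqint (v k) by exact: (sqint_ae (mv k) (vu k)).
have Jv k l : J (fun x => (v k x - v l x) ^+ 2) = J (fun x => (u_ (n_ k) x - u_ (n_ l) x) ^+ 2).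
  apply: J_ae; [by have [] := sqintB (v2 k) (v2 l) => + _; exact: measurable_funX|
   by have [] := sqintB (u2 (n_ k)) (u2 (n_ l)) => + _; exact: measurable_funX|].
  by apply: filterS2 (vu k) (vu l) => x /= e1 e2 xT; rewrite e1// e2.
have cv x : cvgn (fun k => v k x).
  have [Ax|nAx] := pselect (A x); last first.
    rewrite (_ : (fun k => v k x) = fun _ => 0); first exact: is_cvg_cst.
    by apply/funext => k; rewrite /v indicE memNset// mulr0.
  rewrite (_ : (fun k => v k x) = (fun k => u_ (n_ 0%N) x + series (dl ^~ x) k)); last first.
    apply/funext => k; rewrite /v indicE mem_set// mulr1 seriesEnat/=.
    by rewrite telescope_sumr// addrC subrK.
  apply: is_cvgD; first exact: is_cvg_cst.
  apply: normed_cvg; apply: nondecreasing_is_cvgn.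
    by apply: nondecreasing_series => k _ _; exact: normr_ge0.
  exists (2 + fine (G x)) => _ [k _ <-]; rewrite /= /series/=.
  apply: (@le_trans _ _ (\sum_(0 <= i < k) (1 / 2 ^+ i + 2 ^+ i * dl i x ^+ 2))).
    apply: ler_sum => i _; rewrite -[X in _ <= _ + _ * X]real_normK ?num_real//.
    set t := `|dl i x|; have t0 : 0 <= t by exact: normr_ge0.
    have p0 : (0 : R) < 2 ^+ i by exact: exprn_gt0.
    have -> : 1 / 2 ^+ i + 2 ^+ i * t ^+ 2 = t + (((2 ^+ i * t) ^+ 2 - 2 ^+ i * t + 1)) / 2 ^+ i.
      by field; rewrite gt_eqF.
    rewrite lerDl divr_ge0 ?(ltW p0)//.
    by have := sqr_ge0 (2 ^+ i * t - 1 / 2); lra.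
  rewrite big_split/= lerD//.
    rewrite [leLHS](_ : _ = 2 - 2 / 2 ^+ k) ?gerBl ?divr_ge0 ?exprn_ge0//.
    elim: k => [|k IH]; first by rewrite big_geq// expr0 divr1 subrr.
    rewrite big_nat_recr//= IH exprS invfM.
    by have : (2 ^+ k : R) != 0 by [rewrite expf_neq0//]; move=> ?; field.
  have G0 : (0 <= G x)%E by apply: nneseries_ge0 => i _ _; exact: dl0.
  rewrite -lee_fin fineK ?ge0_fin_numE// -sumEFin.
  by apply: nneseries_lim_ge => i _ _; exact: dl0.
pose u x := limn (fun k => v k x).
have vlim x : v k x @[k --> \oo] --> u x by exact: cv.
have mu_ : measurable_fun [set: T] u.
  by apply: (@measurable_fun_cvg _ _ _ _ v) => // x _; exact: vlim.
have D k : intg (fun x => (u x - v k x) ^+ 2) /\ J (fun x => (u x - v k x) ^+ 2) <= 4 ^- k.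
  apply: (@J_fatou _ _ _ _ (fun l x => (v (l + k)%N x - v k x) ^+ 2)).
  - by move=> l; case: (sqintB (v2 (l + k)%N) (v2 k)).
  - by move=> l x; exact: sqr_ge0.
  - move=> x; apply: rcvgX; apply: rcvgB; last exact: rcvg_cst.
    by have := vlim x; rewrite -(cvg_shiftn k).
  - move=> l; rewrite Jv; apply: n_P => //.
    by have [->|l0] := posnP l; rewrite ?leqnn// ltnW// n_incr// -{1}[k]add0n ltn_add2r.
have usq : sqint u.
  have uv : sqint (fun x => u x - v 0%N x).
    by split; [apply: measurable_funB|case: (D 0%N)].
  split=> //; have [_] := sqintD uv (v2 0%N); apply: intg_eq => x; ring.
exists u => //; apply/cvgrPdist_le => e e0.
have [|N NP] := Cu (e / 4); first by rewrite divr_gt0.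
have [k [kN ke]] : exists k, (N <= n_ k)%N /\ 4 ^- k <= e / 4.
  have : \forall k \near \oo, 4 ^- k <= e / 4 :> R.
    have := @cvg_geometric R 1 (4^-1); rewrite ger0_norm// invf_lt1// ltr1n => /(_ isT).
    move=> /cvgrPdist_le/(_ (e / 4)); rewrite divr_gt0// => /(_ isT); apply: filterS => k.
    by rewrite sub0r normrN /= mul1r exprVn; apply: le_trans; rewrite ler_norm.
  case=> K _ KP; exists (maxn K N); split; last by apply: KP => /=; exact: leq_maxl.
  apply: (@leq_trans (maxn K N)); first exact: leq_maxr.
  elim: (maxn K N) => // m IH; exact: leq_ltn_trans IH (n_incr _ _ (leqnn _)).
exists N => // l /= Nl; rewrite sub0r normrN ger0_norm ?J_sqr_ge0//.
have -> : J (fun x => (u_ l x - u x) ^+ 2) = J (fun x => ((u_ l x - u_ (n_ k) x) - (u x - v k x)) ^+ 2).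
  apply: J_ae; [by have [] := sqintB (u2 l) usq => + _; exact: measurable_funX|
   by have [] := sqintB (sqintB (u2 l) (u2 (n_ k))) (sqintB usq (v2 k)) => + _; exact: measurable_funX|].
  by apply: filterS (vu k) => x /= e1 xT; rewrite e1//; ring.
apply: le_trans (J_sqrB_le (sqintB (u2 l) (u2 (n_ k))) (sqintB usq (v2 k))) _.
have := NP _ _ Nl kN; have := (D k).2; move: ke.
by rewrite (_ : e = 2 * (e / 4) + 2 * (e / 4)); [lra|field].
Qed.

End square_integrable.

(** * Iterated integrals *)

Section fubini.
Context d1 d2 (T1 : measurableType d1) (T2 : measurableType d2) (R : realType).
Context (m1 : {measure set T1 -> \bar R}) (m2 : {measure set T2 -> \bar R}).
Context (s1 : sigma_finite [set: T1] m1) (s2 : sigma_finite [set: T2] m2).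

Let M1 : {sigma_finite_measure set T1 -> \bar R} :=
  HB.pack_for (SigmaFiniteMeasure.type T1 R) (Measure.sort m1)
    (@isSFinite.Build _ _ _ m1 (sfinite_measure_sigma_finite s1))
    (@isSigmaFinite.Build _ _ _ (Measure.sort m1) s1).
Let M2 : {sigma_finite_measure set T2 -> \bar R} :=
  HB.pack_for (SigmaFiniteMeasure.type T2 R) (Measure.sort m2)
    (@isSFinite.Build _ _ _ m2 (sfinite_measure_sigma_finite s2))
    (@isSigmaFinite.Build _ _ _ (Measure.sort m2) s2).

Lemma tonelli (f : T1 * T2 -> \bar R) : measurable_fun [set: T1 * T2] f ->
  (forall z, (0 <= f z)%E) ->
  (\int[m1]_x \int[m2]_y f (x, y) = \int[m2]_y \int[m1]_x f (x, y))%E.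
Proof. exact: (@fubini_tonelli _ _ _ _ _ M1 M2). Qed.

Lemma measurable_tonelli1 (f : T1 * T2 -> \bar R) : measurable_fun [set: T1 * T2] f ->
  (forall z, (0 <= f z)%E) ->
  measurable_fun [set: T1] (fun x => \int[m2]_y f (x, y))%E.
Proof. exact: (@measurable_fun_fubini_tonelli_F _ _ _ _ _ M2). Qed.

Lemma fubini_real (f : T1 * T2 -> R) : measurable_fun [set: T1 * T2] f ->
  (\int[m1]_x \int[m2]_y `|f (x, y)|%:E < +oo)%E ->
  [/\ m1.-integrable setT (EFin \o (fun x => \int[m2]_y f (x, y))),
      m2.-integrable setT (EFin \o (fun y => \int[m1]_x f (x, y))) &
   \int[m1]_x (\int[m2]_y f (x, y)) = \int[m2]_y (\int[m1]_x f (x, y))].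
Proof.
move=> mf fy; have mEf : measurable_fun setT (EFin \o f) by exact/measurable_EFinP.
have fi := (@integrable12ltyP _ _ _ _ _ M1 M2 (EFin \o f) mEf).2 fy.
have E1 : ae_eq m1 setT (fubini_F m2 (EFin \o f)) (EFin \o (fun x => \int[m2]_y f (x, y))).
  have := @ae_integrable1 _ _ _ _ _ M1 M2 _ fi; apply: filterS => x xi xT.
  by rewrite /= -J_EFin.
have E2 : ae_eq m2 setT (fubini_G m1 (EFin \o f)) (EFin \o (fun y => \int[m1]_x f (x, y))).
  have := @ae_integrable2 _ _ _ _ _ M1 M2 _ fi; apply: filterS => x xi xT.
  by rewrite /= -J_EFin.
have mF := @measurable_fubini_F _ _ _ _ _ M1 M2 _ fi.
have mG := @measurable_fubini_G _ _ _ _ _ M1 M2 _ fi.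
have iF := @integrable_fubini_F _ _ _ _ _ M1 M2 _ fi.
have iG : m2.-integrable setT (fubini_G m1 (EFin \o f)).
  apply: (@integrable_fubini_F _ _ _ _ _ M2 M1 (EFin \o (fun z => f (z.2, z.1)))).
  have ms : measurable_fun setT (EFin \o (fun z : T2 * T1 => f (z.2, z.1))).
    by apply/measurable_EFinP; apply: (measurableT_comp mf); exact: measurable_swap.
  apply/(@integrable21ltyP _ _ _ _ _ M2 M1) => //.
have mF' : measurable_fun [set: T1] (EFin \o (fun x => \int[m2]_y f (x, y))).
  apply/measurable_EFinP; apply: (measurableT_comp (f := fine) _ mF); exact: fine_measurable.
have mG' : measurable_fun [set: T2] (EFin \o (fun y => \int[m1]_x f (x, y))).
  apply/measurable_EFinP; apply: (measurableT_comp (f := fine) _ mG); exact: fine_measurable.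
split.
- exact: (eintg_ae mF' E1 iF).
- exact: (eintg_ae mG' E2 iG).
- rewrite {1}/Rintegral [RHS]/Rintegral; congr fine.
  transitivity (\int[m1]_x fubini_F m2 (EFin \o f) x)%E.
    by symmetry; exact: ae_eq_integral.
  rewrite (@Fubini _ _ _ _ _ M1 M2 _ fi); exact: ae_eq_integral.
Qed.

(** A bounded kernel leaves an integrand dominated by a tensor product of
  integrable functions; the trigonometric kernels are of this kind. *)
Lemma fubini_bounded_kernel (f : T1 -> R) (g : T2 -> R) (k : T1 * T2 -> R) (C : R) :
  m1.-integrable setT (EFin \o f) -> m2.-integrable setT (EFin \o g) ->
  measurable_fun [set: T1 * T2] k -> (forall z, `|k z| <= C) ->
  [/\ m1.-integrable setT (EFin \o (fun x => f x * \int[m2]_y (g y * k (x, y)))),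
      m2.-integrable setT (EFin \o (fun y => g y * \int[m1]_x (f x * k (x, y)))) &
  \int[m1]_x (f x * \int[m2]_y (g y * k (x, y))) =
  \int[m2]_y (g y * \int[m1]_x (f x * k (x, y)))].
Proof.
move=> fi gi mk kC; have mf := intg_measurable fi; have mg := intg_measurable gi.
have gk x : m2.-integrable setT (EFin \o (fun y => g y * k (x, y))).
  apply: (intg_le _ _ (intgZ C (intg_norm gi))).
    apply: measurable_funM => //; apply: (measurableT_comp mk); exact: measurable_pair1.
  by move=> y; rewrite normrM mulrC ler_wpM2r.
have fk y : m1.-integrable setT (EFin \o (fun x => f x * k (x, y))).
  apply: (intg_le _ _ (intgZ C (intg_norm fi))).
    apply: measurable_funM => //; apply: (measurableT_comp mk); exact: measurable_pair2.
  by move=> x; rewrite normrM mulrC ler_wpM2r.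
have C0 : 0 <= C by have := kC (point, point); apply: le_trans; exact: normr_ge0.
have := @fubini_real (fun z => f z.1 * (g z.2 * k z)).
case.
- apply: measurable_funM; first by apply: (measurableT_comp mf); exact: measurable_fst.
  by apply: measurable_funM => //; apply: (measurableT_comp mg); exact: measurable_snd.
- apply: (@le_lt_trans _ _ (\int[m1]_x (C * `|f x| * \int[m2]_y `|g y|)%:E)%E).
    apply: ge0_le_integral => //.
    + by move=> x _; exact: integral_ge0.
    + apply: (@measurable_tonelli1 (fun z => `|f z.1 * (g z.2 * k z)|%:E)) => //.
      apply/measurable_EFinP; apply: measurableT_comp => //.
      apply: measurable_funM; first by apply: (measurableT_comp mf); exact: measurable_fst.
      by apply: measurable_funM => //; apply: (measurableT_comp mg); exact: measurable_snd.
    + apply/measurable_EFinP; apply: measurable_funM => //; apply: measurable_funM => //.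
      exact: measurableT_comp.
    move=> x _; rewrite J_EFin; last first.
      by apply: (intg_norm (f := fun y => f x * (g y * k (x, y)))); exact: intgZ.
    rewrite lee_fin -JZ; last exact: intg_norm.
    apply: J_le; [by apply: (intg_norm (f := fun y => f x * (g y * k (x, y)))); exact: intgZ|by apply: intgZ; exact: intg_norm|].
    move=> y; rewrite !normrM [C * _]mulrC -!mulrA ler_wpM2l// mulrC ler_wpM2r//.
  rewrite (_ : (fun x => _) = EFin \o (fun x => (C * \int[m2]_y `|g y|) * `|f x|)).
    rewrite (J_EFin (intgZ _ (intg_norm fi))); exact: ltry.
  by apply/funext => x /=; congr EFin; ring.
move=> /= i1 i2 e; split.
- by apply: intg_eq i1 => x; rewrite JZ.
- apply: intg_eq i2 => y; rewrite -JZ//; apply: J_eq => x; ring.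
- transitivity (\int[m1]_x \int[m2]_y (f x * (g y * k (x, y)))).
    by apply: J_eq => x; rewrite JZ.
  by rewrite e; apply: J_eq => y; rewrite -JZ//; apply: J_eq => x; ring.
Qed.

End fubini.

Section fubini_slices.
Context d1 d2 (T1 : measurableType d1) (T2 : measurableType d2) (R : realType).
Context (m1 : {measure set T1 -> \bar R}) (m2 : {measure set T2 -> \bar R}).

(** Tonelli turns the bound on the sections into absolute integrability of
  [f]. *)
Lemma fubini_slices (f : T1 * T2 -> R) (B : T2 -> R) :
  sigma_finite [set: T1] m1 -> sigma_finite [set: T2] m2 ->
  measurable_fun [set: T1 * T2] f ->
  (forall y, m1.-integrable setT (EFin \o (fun x => f (x, y)))) ->
  (forall y, \int[m1]_x `|f (x, y)| <= B y) ->
  m2.-integrable setT (EFin \o B) ->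
  [/\ m1.-integrable setT (EFin \o (fun x => \int[m2]_y f (x, y))),
      m2.-integrable setT (EFin \o (fun y => \int[m1]_x f (x, y))) &
      \int[m1]_x (\int[m2]_y f (x, y)) = \int[m2]_y (\int[m1]_x f (x, y))].
Proof.
move=> s1 s2 mf fi fB Bi; apply: fubini_real => //.
have mf' : measurable_fun [set: T1 * T2] (fun z => `|f z|%:E).
  by apply/measurable_EFinP; exact: measurableT_comp.
rewrite (tonelli s1 s2 mf'); last by move=> z; rewrite lee_fin.
apply: (@le_lt_trans _ _ (\int[m2]_y (B y)%:E)%E); last by rewrite J_EFin ?ltry.
have B0 y : 0 <= B y by apply: le_trans (fB y); exact: J_ge0.
apply: ge0_le_integral => //.
- by move=> y _; apply: integral_ge0 => x _; rewrite lee_fin.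
- apply: (measurable_tonelli1 s1 (f := fun z => `|f (z.2, z.1)|%:E)); last by move=> z; rewrite lee_fin.
  exact: measurableT_comp mf' (measurable_fun_pair measurable_snd measurable_fst).
- by apply/measurable_EFinP; exact: intg_measurable Bi.
by move=> y _; rewrite J_EFin ?lee_fin//; exact: intg_norm (fi y).
Qed.

End fubini_slices.

(** * Lebesgue measure on row vectors *)

Lemma max0B (R : realDomainType) (t : R) : t = Num.max t 0 - Num.max (- t) 0.
Proof.
case: (leP t 0) => h; first by rewrite max_l ?oppr_ge0// opprK add0r.
by rewrite max_r ?oppr_le0 ?ltW// subr0.
Qed.

Section lebesgue_rV_theory.
Context (R : realType).
Implicit Types n : nat.

Definition box n (a b : 'rV[R]_n) : set 'rV[R]_n :=
  [set x | forall i, x 0 i \in `[a 0 i, b 0 i]].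

Lemma measurable_box n (a b : 'rV[R]_n) : measurable (box a b).
Proof.
have -> : box a b = \bigcap_(i in [set: 'I_n])
    ((fun x : 'rV[R]_n => x 0 i) @^-1` `[a 0 i, b 0 i]%classic).
  rewrite predeqE => x; split=> [Bx i _|Bx i]; first exact: Bx.
  exact: (Bx i Logic.I).
apply: fin_bigcap_measurable => // i _.
rewrite -[X in measurable X]setTI.
exact: (@measurable_coor R n i measurableT _ (measurable_itv _)).
Qed.

Lemma box_measure_lty n (a b : 'rV[R]_n) : (lebesgue_rV R n (box a b) < +oo)%E.
Proof.
have [ab|] := pselect (forall i, a 0 i <= b 0 i).
  by rewrite /box lebesgue_rV_box// ltry.
move=> /existsNP[i /negP ab]; rewrite (_ : box a b = set0) ?measure0//.
rewrite -subset0 => x /(_ i); rewrite in_itv/= => /andP[h1 h2].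
by move: ab; rewrite (le_trans h1 h2).
Qed.

Definition cube n (r : R) : set 'rV[R]_n := box (const_mx (- r)) (const_mx r).

Lemma cubeP n r (x : 'rV[R]_n) : cube r x <-> forall i, `|x 0 i| <= r.
Proof.
by split=> H i; have := H i; rewrite ?in_itv/= !mxE ler_norml.
Qed.

Lemma measurable_cube n r : measurable (cube (n := n) r).
Proof. exact: measurable_box. Qed.

Lemma bigcup_cube n : \bigcup_k cube (n := n) k%:R = setT.
Proof.
rewrite -subTset => x _.
exists (\max_(i < n) Num.bound `|x ord0 i|%R)%N => //; apply/cubeP => i.
apply: (le_trans (ltW (archi_boundP (normr_ge0 _)))).
by rewrite ler_nat; exact: (leq_bigmax i).
Qed.

Lemma lebesgue_rV_sigma_finite n : sigma_finite [set: 'rV[R]_n] (lebesgue_rV R n).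
Proof.
exists (fun k => cube k%:R); first by rewrite bigcup_cube.
by move=> k; split; [exact: measurable_cube|exact: box_measure_lty].
Qed.

Definition boxes n : set (set 'rV[R]_n) := [set A | exists a b, A = box a b].

Lemma boxes_setI n : setI_closed (@boxes n).
Proof.
move=> _ _ [a [b ->]] [c [d ->]].
exists (\row_i Num.max (a 0 i) (c 0 i)), (\row_i Num.min (b 0 i) (d 0 i)).
apply/seteqP; split=> x.
  move=> [H1 H2] i; have := H1 i; have := H2 i.
  by rewrite !in_itv/= !mxE ge_max le_min => /andP[-> ->] /andP[-> ->].
move=> H; split=> i; have := H i; rewrite !in_itv/= !mxE ge_max le_min.
  by move=> /andP[/andP[-> _] /andP[-> _]].
by move=> /andP[/andP[_ ->] /andP[_ ->]].
Qed.

Lemma measurable_boxes n : @measurable _ 'rV[R]_n = <<s @boxes n >>.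
Proof.
apply/seteqP; split; last first.
  apply: smallest_sub; first exact: sigma_algebra_measurable.
  by move=> _ [a [b ->]]; exact: measurable_box.
apply: smallest_sub; first exact: smallest_sigma_algebra.
move=> A; rewrite -bigcup_seq => -[i _ [B mB <-]]; rewrite setTI.
pose T' := g_sigma_algebraType (@boxes n).
suff m : measurable_fun [set: T'] (fun x : T' => (x : 'rV[R]_n) 0 i).
  by have := m measurableT B mB; rewrite setTI.
apply: (measurability _ (RGenCInfty.measurableE R)).
move=> _ [_ [s ->] <-]; rewrite setTI.
rewrite (_ : _ @^-1` _ = \bigcup_k (box
  (\row_j (if j == i then s else - k%:R)) (const_mx k%:R) : set 'rV[R]_n)).
  apply: (@bigcupT_measurable _ T') => k; apply: sub_sigma_algebra.
  by exists (\row_j (if j == i then s else - k%:R)), (const_mx k%:R).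
apply/seteqP; split=> x /=; rewrite in_itv/= andbT.
  move=> sx; have [k _ /cubeP kx] : (\bigcup_k cube k%:R) x by rewrite bigcup_cube.
  exists k => // j; rewrite in_itv/= !mxE; have := kx j; rewrite ler_norml.
  by case: eqP => [->|_] /andP[h1 h2]; rewrite ?sx ?h1 h2.
by move=> [k _ /(_ i)]; rewrite in_itv/= !mxE eqxx => /andP[].
Qed.

(** Boxes generate the sigma-algebra, are stable under intersection, and cubes
  exhaust the space. *)
Lemma lebesgue_rV_unique n (m : {measure set 'rV[R]_n -> \bar R}) :
  (forall a b, m (box a b) = lebesgue_rV R n (box a b)) ->
  forall A, measurable A -> m A = lebesgue_rV R n A.
Proof.
move=> mb; apply: (measure_unique (@boxes n) (fun k => cube k%:R)).
- exact: measurable_boxes.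
- exact: boxes_setI.
- by move=> k; exists (const_mx (- k%:R)), (const_mx k%:R).
- exact: bigcup_cube.
- by move=> _ [a [b ->]].
- by move=> k; rewrite mb box_measure_lty.
Qed.

(** Continuous functions are limits of their values on finer and finer grids,
  where they only take countably many values. *)
Lemma continuous_measurable_rV n (f : 'rV[R]_n -> R) : continuous f ->
  measurable_fun [set: 'rV[R]_n] f.
Proof.
move=> cf.
pose z k (x : 'rV[R]_n) : {ffun 'I_n -> int} := [ffun i => Num.floor (k.+1%:R * x 0 i)].
pose r k (y : {ffun 'I_n -> int}) : 'rV[R]_n := \row_i ((y i)%:~R / k.+1%:R).
apply: (@measurable_fun_cvg _ _ _ _ (fun k x => f (r k (z k x)))).
  move=> k _ Y mY; rewrite setTI.
  rewrite (_ : _ @^-1` _ = \bigcup_(y in [set y | Y (f (r k y))]) (z k @^-1` [set y])); last first.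
    by apply/seteqP; split=> [x Yx|x [y Yy /= ->]//]; exists (z k x).
  rewrite bigcup_mkcond; apply: countable_bigcupT_measurable => // y.
  case: ifP => // _.
  have -> : z k @^-1` [set y] = \bigcap_(i in [set: 'I_n])
      ((fun x : 'rV[R]_n => k.+1%:R * x 0 i) @^-1` `[(y i)%:~R, (y i + 1)%:~R[%classic).
    apply/seteqP; split=> x.
      move=> /ffunP + i _ => /(_ i); rewrite ffunE /= in_itv/= => <-.
      by rewrite floor_le_tmp /= lt_succ_floor.
    move=> H; apply/ffunP => i; have := H i Logic.I; rewrite /= in_itv/= ffunE.
    by move=> h; apply/eqP; rewrite floor_eq.
  apply: fin_bigcap_measurable => // i _.
  rewrite -[X in measurable X]setTI.
  apply: (_ : measurable_fun _ _) => //; apply: measurable_funM => //; exact: measurable_coor.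
move=> x _; apply: (@cvg_comp _ _ _ (fun k => r k (z k x)) f _ (nbhs x)); last exact: cf.
apply/cvg_ballP => e e0; near=> k; split=> // i j; rewrite (ord1 i) /ball /= mxE ffunE.
have k0 : (0 : R) < k.+1%:R by rewrite ltr0n.
have h1 := floor_le_tmp (k.+1%:R * x 0 j); have h2 := lt_succ_floor (k.+1%:R * x 0 j).
rewrite intrD1 in h2.
set t := (Num.floor _)%:~R in h1 h2 *.
have -> : x 0 j - t / k.+1%:R = (k.+1%:R * x 0 j - t) / k.+1%:R by field; rewrite gt_eqF.
rewrite normrM normfV (ger0_norm (ltW k0)) ltr_pdivrMr// ger0_norm ?subr_ge0//.
apply: (@lt_le_trans _ _ 1); first by rewrite ltrBlDr addrC.
near: k; have [K KP] : exists K, e^-1 <= K%:R.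
  by exists (Num.bound e^-1); rewrite ltW// archi_boundP// invr_ge0 ltW.
exists K => // k /= Kk; rewrite mulrC -ler_pdivrMr// div1r (le_trans KP)// ler_nat.
exact: leq_trans Kk (leqnSn _).
Unshelve. all: by end_near. Qed.

Lemma measurable_row_sub n d (T : measurableType d) (f g : T -> 'rV[R]_n) :
  measurable_fun [set: T] f -> measurable_fun [set: T] g ->
  measurable_fun [set: T] (fun x => f x - g x).
Proof.
move=> mf mg; apply: measurable_fun_rVP => i.
under eq_fun do rewrite !mxE; apply: measurable_funB.
  exact: (measurableT_comp (measurable_coor i) mf).
exact: (measurableT_comp (measurable_coor i) mg).
Qed.

Lemma measurable_row_affine n d (T : measurableType d) (l : R) (f : T -> 'rV[R]_n) (g : T -> 'rV[R]_n) :
  measurable_fun [set: T] f -> measurable_fun [set: T] g ->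
  measurable_fun [set: T] (fun x => l *: f x + g x).
Proof.
move=> mf mg; apply: measurable_fun_rVP => i.
under eq_fun do rewrite !mxE; apply: measurable_funD.
  by apply: measurable_funM => //; exact: (measurableT_comp (measurable_coor i) mf).
exact: (measurableT_comp (measurable_coor i) mg).
Qed.

Lemma measurable_dotv n d (T : measurableType d) (f g : T -> 'rV[R]_n) :
  measurable_fun [set: T] f -> measurable_fun [set: T] g ->
  measurable_fun [set: T] (fun x => dotv (f x) (g x)).
Proof.
move=> mf mg; apply: measurable_sum => i; apply: measurable_funM.
  exact: (measurableT_comp (measurable_coor i) mf).
exact: (measurableT_comp (measurable_coor i) mg).
Qed.

Section affine_change_of_variables.
Context (n : nat).
Notation Rn := 'rV[R]_n.
Notation mu := (lebesgue_rV R n).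
Implicit Types (l : R) (y : Rn) (f : Rn -> R).

Let aff l y (x : Rn) : Rn := l *: x + y.

Let maff l y : measurable_fun [set: Rn] (aff l y).
Proof. exact: measurable_row_affine. Qed.

(** As functions of [A], the two sides are measures up to a constant factor,
  so it is enough to compare them on boxes. *)
Lemma lebesgue_rV_affine l y (A : set Rn) : l != 0 -> measurable A ->
  mu (aff l y @^-1` A) = ((`|l| ^- n)%:E * mu A)%E.
Proof.
move=> l0 mA.
have ln0 : 0 < `|l| ^+ n by rewrite exprn_gt0// normr_gt0.
suff : ((`|l| ^+ n)%:E * pushforward mu (aff l y) A = mu A)%E.
  rewrite /pushforward/= => <-.
  by rewrite muleA -EFinM mulVf ?mul1e// gt_eqF.
have [pf pfE] : {m' : {measure set Rn -> \bar R} |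
    pushforward mu (aff l y) = m' :> (set _ -> _)}.
  by unshelve eexists (pushforward mu (aff l y)); [exact: maff|].
rewrite pfE -[LHS]/(mscale (NngNum (ltW ln0)) pf A).
apply: (lebesgue_rV_unique (m := mscale (NngNum (ltW ln0)) pf)) => // {A mA} a b.
transitivity ((`|l| ^+ n)%:E * pf (box a b))%E; first by [].
rewrite -pfE /pushforward.
have [ab|] := pselect (forall i, a 0 i <= b 0 i); last first.
  move=> /existsNP[i /negP ab]; rewrite (_ : box a b = set0).
    by rewrite preimage_set0 !measure0 mule0.
  rewrite -subset0 => x /(_ i); rewrite in_itv/= => /andP[h1 h2].
  by move: ab; rewrite (le_trans h1 h2).
have [a' [b' [ab' bE]]] : exists a' b' : Rn, (forall i, a' 0 i <= b' 0 i) /\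
    aff l y @^-1` box a b = box a' b' /\ forall i, b' 0 i - a' 0 i = `|l|^-1 * (b 0 i - a 0 i).
  have [lp|ln] := ltP 0 l.
    exists (l^-1 *: (a - y)), (l^-1 *: (b - y)).
    split; first by move=> i; rewrite !mxE ler_pM2l ?invr_gt0// lerD2r.
    split; last by move=> i; rewrite !mxE gtr0_norm//; ring.
    apply/seteqP; split=> x H i; have := H i; rewrite /aff !in_itv/= !mxE;
      by rewrite ![l^-1 * _]mulrC ler_pdivrMr// ler_pdivlMr// lerBlDr lerBrDr [x 0 i * l]mulrC.
  have {}ln : l < 0 by rewrite lt_neqAle l0.
  exists (l^-1 *: (b - y)), (l^-1 *: (a - y)).
  split; first by move=> i; rewrite !mxE ler_nM2l ?invr_lt0// lerD2r.
  split; last by move=> i; rewrite !mxE ltr0_norm// invrN; ring.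
  apply/seteqP; split=> x H i; have := H i; rewrite /aff !in_itv/= !mxE;
    by rewrite ![l^-1 * _]mulrC ler_ndivrMr// ler_ndivlMr// lerBlDr lerBrDr [x 0 i * l]mulrC andbC.
move: bE => [-> bE]; rewrite /box !lebesgue_rV_box// -EFinM; congr EFin.
under eq_bigr do rewrite bE.
by rewrite big_split/= prodr_const card_ord exprVn mulrA mulfV ?mul1r// gt_eqF.
Qed.

Lemma ge0_integral_affine l y (f : Rn -> \bar R) : l != 0 ->
  measurable_fun [set: Rn] f -> (forall x, (0 <= f x)%E) ->
  (\int[mu]_x f (l *: x + y)%R = (`|l| ^- n)%:E * \int[mu]_x f x)%E.
Proof.
move=> l0 mf f0.
have ln0 : 0 < `|l| ^- n by rewrite invr_gt0 exprn_gt0// normr_gt0.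
rewrite -(ge0_integral_mscale mu measurableT (NngNum (ltW ln0)) mf)//.
rewrite -[LHS](ge0_integral_pushforward (maff l y) mu measurableT mf)//.
by apply: eq_measure_integral => A mA _ /=; exact: lebesgue_rV_affine.
Qed.

Lemma measurable_affine_comp l y f : measurable_fun [set: Rn] f ->
  measurable_fun [set: Rn] (fun x => f (l *: x + y)).
Proof. by move=> mf; exact: (measurableT_comp mf (maff l y)). Qed.

Lemma intg_affine l y f : l != 0 -> mu.-integrable setT (EFin \o f) ->
  mu.-integrable setT (EFin \o (fun x => f (l *: x + y))).
Proof.
move=> l0 fi; have mf := intg_measurable fi.
apply/integrableP; split; first by apply/measurable_EFinP; exact: measurable_affine_comp.
rewrite (ge0_integral_affine y (f := fun x => `|(f x)%:E|%E))//.
  by apply: lte_mul_pinfty; [rewrite lee_fin invr_ge0 exprn_ge0| |have /integrableP[] := fi].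
by apply: measurableT_comp => //; exact/measurable_EFinP.
Qed.

Lemma J_affine l y f : l != 0 -> mu.-integrable setT (EFin \o f) ->
  \int[mu]_x f (l *: x + y) = `|l| ^- n * \int[mu]_x f x.
Proof.
move=> l0 fi; have mf := intg_measurable fi.
rewrite (_ : f = fun x => Num.max (f x) 0 - Num.max (- f x) 0); last first.
  by apply/funext => x; exact: max0B.
have H (g : Rn -> R) : mu.-integrable setT (EFin \o g) -> (forall x, 0 <= g x) ->
    \int[mu]_x g (l *: x + y) = `|l| ^- n * \int[mu]_x g x.
  move=> gi g0; rewrite /Rintegral (ge0_integral_affine y (f := EFin \o g))//.
    by rewrite fineM// integrable_fin_num.
  exact: measurable_int gi.
have ip : mu.-integrable setT (EFin \o (fun x => Num.max (f x) 0)).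
  apply: (intg_le _ _ (intg_norm fi)); first exact: measurable_maxr.
  by move=> x; case: (ltP (f x) 0) => h; rewrite ?normr0.
have im : mu.-integrable setT (EFin \o (fun x => Num.max (- f x) 0)).
  apply: (intg_le _ _ (intg_norm fi)); first by apply: measurable_maxr => //; exact: measurableT_comp.
  by move=> x; case: (ltP (- f x) 0) => h; rewrite ?normr0 ?normrN.
rewrite [in RHS]JB// mulrBr -!H//; last 2 first.
- by move=> x; rewrite le_max lexx orbT.
- by move=> x; rewrite le_max lexx orbT.
by rewrite JB//; [exact: (intg_affine y l0 ip)|exact: (intg_affine y l0 im)].
Qed.

Lemma J_translate y f : mu.-integrable setT (EFin \o f) ->
  \int[mu]_x f (x + y) = \int[mu]_x f x.
Proof.
move=> fi; have := J_affine y (oner_neq0 R) fi; rewrite normr1 expr1n invr1 mul1r => <-.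
by apply: J_eq => x; rewrite scale1r.
Qed.

Lemma intg_translate y f : mu.-integrable setT (EFin \o f) ->
  mu.-integrable setT (EFin \o (fun x => f (x + y))).
Proof.
by move=> fi; apply: intg_eq (intg_affine y (oner_neq0 R) fi) => x; rewrite scale1r.
Qed.

Lemma J_reflect f : mu.-integrable setT (EFin \o f) ->
  \int[mu]_x f (- x) = \int[mu]_x f x.
Proof.
move=> fi; have N1 : (-1 : R) != 0 by rewrite oppr_eq0 oner_neq0.
have := J_affine 0 N1 fi; rewrite normrN normr1 expr1n invr1 mul1r => <-.
by apply: J_eq => x; rewrite scaleN1r addr0.
Qed.

Lemma ae_translate y (P : Rn -> Prop) : {ae mu, forall x, P x} ->
  {ae mu, forall x, P (x + y)}.
Proof.
move=> [A [mA A0 PA]]; exists (aff 1 y @^-1` A); split.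
- by rewrite -[X in measurable X]setTI; exact: maff.
- by rewrite lebesgue_rV_affine ?oner_neq0// A0 mule0.
- by move=> x /= nP; apply: PA => /=; rewrite /aff scale1r.
Qed.

Lemma odd_J0 f : mu.-integrable setT (EFin \o f) -> (forall x, f (- x) = - f x) ->
  \int[mu]_x f x = 0.
Proof.
move=> fi fN; have := J_reflect fi; under eq_Rintegral do rewrite fN.
by rewrite JN// => /eqP; rewrite eq_sym -addr_eq0 -mulr2n mulrn_eq0/= => /eqP.
Qed.

End affine_change_of_variables.

Section slicing.
Context (n : nat).

Lemma ge0_integral_rV_cons (f : 'rV[R]_n.+1 -> \bar R) :
  measurable_fun [set: 'rV[R]_n.+1] f -> (forall x, (0 <= f x)%E) ->
  (\int[lebesgue_rV R n.+1]_x f x =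
   \int[lebesgue_rV R n]_x \int[lebesgue_measure]_t f (rV_cons (x, t)))%E.
Proof.
move=> mf f0.
pose M1 : {sigma_finite_measure set _ -> \bar R} :=
  HB.pack_for (SigmaFiniteMeasure.type 'rV[R]_n R) (Measure.sort (lebesgue_rV R n))
    (@isSFinite.Build _ _ _ (lebesgue_rV R n) (sfinite_measure_sigma_finite (lebesgue_rV_sigma_finite n)))
    (@isSigmaFinite.Build _ _ _ (Measure.sort (lebesgue_rV R n)) (lebesgue_rV_sigma_finite n)).
have [pf pfE] : {m' : {measure set 'rV[R]_n.+1 -> \bar R} |
    pushforward (M1 \x (@lebesgue_measure R))%E (@rV_cons R n) = m' :> (set _ -> _)}.
  by unshelve eexists (pushforward (M1 \x (@lebesgue_measure R))%E (@rV_cons R n));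
    [exact: measurable_rV_cons|].
transitivity (\int[pf]_x f x)%E.
  by apply: eq_measure_integral => A mA _; rewrite -pfE.
pose pm : {measure set _ -> \bar R} := (M1 \x (@lebesgue_measure R))%E.
rewrite -pfE; transitivity (\int[pm]_z f (rV_cons z))%E.
  refine (@ge0_integral_pushforward _ _ _ _ _ _ _ pm setT f measurableT mf (fun y _ => f0 y)).
  exact: measurable_rV_cons.
apply: (@fubini_tonelli1 _ _ _ _ _ M1 (@lebesgue_measure R) (fun z => f (rV_cons z))) => [|z]; last exact: f0.
by apply: (measurableT_comp mf); exact: measurable_rV_cons.
Qed.

Lemma J_rV_cons (f : 'rV[R]_n.+1 -> R) :
  (lebesgue_rV R n.+1).-integrable setT (EFin \o f) ->
  (forall x, (@lebesgue_measure R).-integrable setT (EFin \o (fun t => f (rV_cons (x, t))))) ->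
  \int[lebesgue_rV R n.+1]_x f x =
  \int[lebesgue_rV R n]_x \int[lebesgue_measure]_t f (rV_cons (x, t)).
Proof.
move=> fi fx; have mf := intg_measurable fi.
have H (g : 'rV[R]_n.+1 -> R) : (lebesgue_rV R n.+1).-integrable setT (EFin \o g) -> 
    (forall x, (@lebesgue_measure R).-integrable setT (EFin \o (fun t => g (rV_cons (x, t))))) ->
    (forall x, 0 <= g x) ->
    (lebesgue_rV R n).-integrable setT (EFin \o (fun x => \int[lebesgue_measure]_t g (rV_cons (x, t)))) /\
    \int[lebesgue_rV R n.+1]_x g x =
    \int[lebesgue_rV R n]_x \int[lebesgue_measure]_t g (rV_cons (x, t)).
  move=> gi gx g0; have mg := intg_measurable gi.
  have E := ge0_integral_rV_cons (f := EFin \o g) (measurable_int _ gi) g0.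
  have E2 : (fun x => \int[lebesgue_measure]_t (EFin \o g) (rV_cons (x, t)))%E =
      EFin \o (fun x => \int[lebesgue_measure]_t g (rV_cons (x, t))).
    by apply/funext => x /=; rewrite J_EFin.
  split; last by rewrite /Rintegral E E2.
  apply: ge0_intg.
  - apply/measurable_EFinP; rewrite -[X in measurable_fun _ X]/(EFin \o _) -E2.
    apply: (measurable_tonelli1 (m2 := lebesgue_measure) _ (f := fun z => (g (rV_cons z))%:E)) => //.
    + exact: sigma_finiteT.
    + apply/measurable_EFinP; apply: (measurableT_comp mg); exact: measurable_rV_cons.
    + by move=> z; rewrite lee_fin.
  - by move=> x; apply: J_ge0.
  - have := integrable_lty measurableT gi; by rewrite E E2.
have mx (g : R -> R) : (@lebesgue_measure R).-integrable setT (EFin \o g) ->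
    (@lebesgue_measure R).-integrable setT (EFin \o (fun x => Num.max (g x) 0)).
  move=> gi; apply: (intg_le _ _ (intg_norm gi)).
    by apply: measurable_maxr => //; exact: intg_measurable gi.
  by move=> x; case: (ltP (g x) 0) => h; rewrite ?normr0.
have ip : (lebesgue_rV R n.+1).-integrable setT (EFin \o (fun x => Num.max (f x) 0)).
  apply: (intg_le _ _ (intg_norm fi)); first exact: measurable_maxr.
  by move=> x; case: (ltP (f x) 0) => h; rewrite ?normr0.
have im : (lebesgue_rV R n.+1).-integrable setT (EFin \o (fun x => Num.max (- f x) 0)).
  apply: (intg_le _ _ (intg_norm fi)); first by apply: measurable_maxr => //; exact: measurableT_comp.
  by move=> x; case: (ltP (- f x) 0) => h; rewrite ?normr0 ?normrN.
have [p1 p2] := H _ ip (fun x => mx _ (fx x)) (fun x => ltac:(by rewrite le_max lexx orbT)).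
have [q1 q2] := H _ im (fun x => mx _ (intgN (fx x))) (fun x => ltac:(by rewrite le_max lexx orbT)).
transitivity (\int[lebesgue_rV R n.+1]_x (Num.max (f x) 0 - Num.max (- f x) 0)).
  by apply: J_eq => x; exact: max0B.
rewrite (JB ip im) p2 q2 -(JB p1 q1); apply: J_eq => x; rewrite -JB.
- by apply: J_eq => t; rewrite -max0B.
- exact: mx.
- by apply: mx; exact: intgN.
Qed.

End slicing.

Lemma ge0_integral_prod n (f : 'I_n -> R -> R) :
  (forall i, measurable_fun [set: R] (f i)) -> (forall i t, 0 <= f i t) ->
  (\int[lebesgue_rV R n]_x (\prod_(i < n) f i (x 0 i))%:E =
   \prod_(i < n) \int[lebesgue_measure]_t (f i t)%:E)%E.
Proof.
elim: n f => [|n IH] f mf f0.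
  rewrite big_ord0; under eq_integral do rewrite big_ord0.
  rewrite /= integral_dirac//= diracE mem_set// mul1e//.
have mp m (g : 'I_m -> R -> R) : (forall i, measurable_fun [set: R] (g i)) ->
    measurable_fun [set: 'rV[R]_m] (fun x : 'rV[R]_m => \prod_(i < m) g i (x 0 i)).
  move=> mg; apply: measurable_prod => i _.
  exact: (measurableT_comp (mg i) (measurable_coor i)).
rewrite ge0_integral_rV_cons//; last 2 first.
- by apply/measurable_EFinP; exact: mp.
- by move=> x; rewrite lee_fin prodr_ge0.
rewrite big_ord_recl -IH//.
rewrite -ge0_integralZl//; last 3 first.
- by apply/measurable_EFinP; apply: (mp _ (fun i => f (lift ord0 i))).
- by move=> x _; rewrite lee_fin prodr_ge0.
- by apply: integral_ge0 => t _; rewrite lee_fin.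
apply: eq_integral => x _.
rewrite muleC -ge0_integralZl//; last 3 first.
- by apply/measurable_EFinP; exact: (mf ord0).
- by move=> t _; rewrite lee_fin.
- by rewrite lee_fin prodr_ge0.
apply: eq_integral => t _; rewrite -EFinM; congr EFin.
rewrite big_ord_recl mulrC /rV_cons mxE unlift_none; congr (_ * _).
by apply: eq_bigr => i _; rewrite mxE liftK.
Qed.

End lebesgue_rV_theory.

(** * Smooth functions and test functions *)

Section smooth_functions.
Context (R : realType) (n : nat).
Notation Rn := 'rV[R]_n.
Implicit Types (f g : Rn -> R) (i j : 'I_n) (x y v : Rn).

Lemma derive_line f x v : 'D_v (f : Rn -> R^o) x = derive1 (fun h : R => f (h *: v + x) : R^o) 0.
Proof.
rewrite /derive /derive1; congr (lim _); apply/funext => A /=; apply/propeqP.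
by split; apply: filterS => h /=; rewrite addr0 scale0r add0r.
Qed.

(** Only the stability of the class under the partial derivatives has to be
  checked, so that iterated derivatives never have to be computed. *)
Lemma smooth_coind (P : (Rn -> R) -> Prop) :
  (forall f, P f -> (forall x, differentiable (f : Rn -> R^o) x) /\
     forall i, P (pderiv i f)) -> forall f, P f -> smooth f.
Proof.
move=> HP f Pf s; elim/last_ind: s f Pf => [|s i IH] f Pf x.
  exact: (HP f Pf).1.
by rewrite foldr_rcons; apply: IH; exact: (HP f Pf).2.
Qed.

Lemma smooth_differentiable f x : smooth f -> differentiable (f : Rn -> R^o) x.
Proof. by move=> /(_ [::]). Qed.

Lemma smooth_pderiv i f : smooth f -> smooth (pderiv i f).
Proof. by move=> sf s x; have := sf (rcons s i) x; rewrite foldr_rcons. Qed.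

Lemma smooth_derivable f x v : smooth f -> derivable (f : Rn -> R^o) x v.
Proof. by move=> sf; apply: diff_derivable; exact: smooth_differentiable. Qed.

Lemma smooth_continuous f : smooth f -> continuous f.
Proof. by move=> sf x; exact: (differentiable_continuous (smooth_differentiable x sf)). Qed.

Lemma smooth_measurable f : smooth f -> measurable_fun [set: Rn] f.
Proof. by move=> sf; apply: continuous_measurable_rV; exact: smooth_continuous. Qed.

Lemma pderivD i f g : smooth f -> smooth g ->
  pderiv i (fun x => f x + g x) = (fun x => pderiv i f x + pderiv i g x).
Proof.
move=> sf sg; apply/funext => x.
rewrite /pderiv; exact (deriveD (smooth_derivable sf) (smooth_derivable sg)).
Qed.

Lemma pderivM i f g : smooth f -> smooth g ->
  pderiv i (fun x => f x * g x) = (fun x => pderiv i f x * g x + f x * pderiv i g x).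
Proof.
move=> sf sg; apply/funext => x; rewrite addrC [pderiv i f x * _]mulrC.
rewrite /pderiv; exact (deriveM (smooth_derivable sf) (smooth_derivable sg)).
Qed.

Lemma pderiv_cst i (c : R) : pderiv i (fun=> c) = (fun _ : Rn => 0).
Proof. by apply/funext => x; exact: derive_cst. Qed.

Lemma smooth_cst (c : R) : smooth (fun _ : Rn => c).
Proof.
apply: (@smooth_coind (fun f => exists c, f = fun=> c)); last by exists c.
move=> _ [{}c ->]; split=> [x|i]; first exact: differentiable_cst.
by exists 0; rewrite pderiv_cst.
Qed.

(** Products of smooth functions are not stable under the partial derivatives;
  their finite sums are, by the Leibniz rule. *)
Inductive smooth_products : (Rn -> R) -> Prop :=
| smooth_products_mul f g : smooth f -> smooth g -> smooth_products (fun x => f x * g x)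
| smooth_products_add f g : smooth_products f -> smooth_products g ->
    smooth_products (fun x => f x + g x).

Lemma smooth_products_differentiable f : smooth_products f ->
  forall x, differentiable (f : Rn -> R^o) x.
Proof.
elim=> [{}f g sf sg x|{}f g _ df _ dg x].
  exact: (differentiableM (smooth_differentiable x sf) (smooth_differentiable x sg)).
exact: differentiableD.
Qed.

Lemma smooth_products_smooth f : smooth_products f -> smooth f.
Proof.
apply: smooth_coind => {}f pf; split; first exact: smooth_products_differentiable.
move=> i; elim: pf => [{}f g sf sg|{}f g pf df pg dg].
  rewrite pderivM//; apply: smooth_products_add; apply: smooth_products_mul => //;
    exact: smooth_pderiv.
rewrite (_ : pderiv _ _ = fun x => pderiv i f x + pderiv i g x); first exact: smooth_products_add.
apply/funext => x; apply: deriveD; apply: diff_derivable; exact: smooth_products_differentiable.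
Qed.

Lemma smoothM f g : smooth f -> smooth g -> smooth (fun x => f x * g x).
Proof. by move=> sf sg; apply: smooth_products_smooth; exact: smooth_products_mul. Qed.

Lemma smoothD f g : smooth f -> smooth g -> smooth (fun x => f x + g x).
Proof.
move=> sf sg; apply: smooth_products_smooth.
rewrite (_ : (fun x => f x + g x) = fun x => f x * 1 + g x * 1); last first.
  by apply/funext => x; rewrite !mulr1.
by apply: smooth_products_add; apply: smooth_products_mul => //; exact: smooth_cst.
Qed.

Lemma smoothZ (c : R) f : smooth f -> smooth (fun x => c * f x).
Proof. by move=> sf; apply: smoothM => //; exact: smooth_cst. Qed.

Lemma pderivZ i (c : R) f : smooth f -> pderiv i (fun x => c * f x) = (fun x => c * pderiv i f x).
Proof.
move=> sf; rewrite (pderivM _ (smooth_cst c) sf) pderiv_cst.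
by apply/funext => x; rewrite mul0r add0r.
Qed.

(** Quotients of smooth functions by powers of [f] form a class that is stable
  under the partial derivatives. *)
Lemma smoothV f : smooth f -> (forall x, f x != 0) -> smooth (fun x => (f x)^-1).
Proof.
move=> sf f0; pose q (p : Rn -> R) k x := p x * (f x)^-1 ^+ k.
have dV x : differentiable (fun x => (f x)^-1 : R^o) x.
  exact: (differentiableV (smooth_differentiable x sf)).
have eq0 p x : smooth p -> differentiable (q p 0%N : Rn -> R^o) x.
  move=> sp; rewrite (_ : q p 0%N = p); first exact: smooth_differentiable.
  by apply/funext => z; rewrite /q mulr1.
have dq p k x : smooth p -> differentiable (q p k : Rn -> R^o) x.
  move=> sp; elim: k => [|k IH]; first exact: eq0.
  rewrite (_ : q p k.+1 = fun x => q p k x * (f x)^-1); last first.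
    by apply/funext => z; rewrite /q exprSr mulrA.
  exact: differentiableM.
have Dq i p k : smooth p -> pderiv i (q p k) =
    q (fun x => pderiv i p x * f x - k%:R * (p x * pderiv i f x)) k.+1.
  move=> sp; apply/funext => x; rewrite /pderiv; elim: k => [|k IH].
    rewrite (_ : q p 0%N = p); last by apply/funext => z; rewrite /q mulr1.
    by rewrite /q expr1 mul0r subr0 mulfK.
  rewrite (_ : q p k.+1 = fun x => q p k x * (f x)^-1); last first.
    by apply/funext => z; rewrite /q exprSr mulrA.
  etransitivity; first exact (deriveM (diff_derivable (dq p k x sp)) (diff_derivable (dV x))).
  rewrite IH; transitivity (q p k x * (- (f x) ^- 2 * 'D_(delta_mx 0 i) (f : Rn -> R^o) x) +
    (f x)^-1 * q (fun x => 'D_(delta_mx 0 i) (p : Rn -> R^o) x * f x - k%:R * (p x * 'D_(delta_mx 0 i) (f : Rn -> R^o) x)) k.+1 x).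
    congr (_ + _); congr (_ * _).
    exact (deriveV (f0 x) (smooth_derivable sf)).
  by rewrite /q -[k.+1%:R]natr1 -!exprVn !exprS; field; exact: f0.
apply: (@smooth_coind (fun h => exists p k, smooth p /\ h = q p k)); last first.
  exists (fun=> 1), 1%N; split; first exact: smooth_cst.
  by apply/funext => x; rewrite /q expr1 mul1r.
move=> _ [p [k [sp ->]]]; split => [x|i]; first exact: dq.
exists (fun x => pderiv i p x * f x - k%:R * (p x * pderiv i f x)), k.+1; split; last exact: Dq.
rewrite (_ : (fun x => _) = fun x => pderiv i p x * f x + (- k%:R) * (p x * pderiv i f x)); last first.
  by apply/funext => x; rewrite mulNr.
by apply: smoothD; [|apply: smoothZ]; apply: smoothM => //; exact: smooth_pderiv.
Qed.

Lemma smooth_prod (I : Type) (s : seq I) (F : I -> Rn -> R) :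
  (forall k, smooth (F k)) -> smooth (fun x => \prod_(k <- s) F k x).
Proof.
move=> sF; elim: s => [|k s IH].
  by under [X in smooth X]eq_fun do rewrite big_nil; exact: smooth_cst.
by under [X in smooth X]eq_fun do rewrite big_cons; exact: smoothM.
Qed.

Lemma differentiable_affine (l : R) y f x :
  (forall z, differentiable (f : Rn -> R^o) z) ->
  differentiable (fun x => f (l *: x + y) : R^o) x.
Proof.
move=> df; by apply: (@differentiable_comp _ _ _ _ (fun x : Rn => l *: x + y) (f : Rn -> R^o)).
Qed.

Lemma pderiv_affine i (l : R) y f : smooth f ->
  pderiv i (fun x => f (l *: x + y)) = (fun x => l * pderiv i f (l *: x + y)).
Proof.
move=> sf; apply/funext => x; rewrite /pderiv !derive_line.
set v := delta_mx 0 i.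
rewrite (_ : (fun h => _) = (fun h => f (h *: v + (l *: x + y)) : R^o) \o ( *%R l)); last first.
  by apply/funext => h /=; congr f; rewrite scalerDr scalerA addrA.
rewrite derive1_comp.
- rewrite mulr0 mulrC; congr (_ * _).
  by rewrite (derive1Ml (f := id))// derive1_id mulr1.
- exact: derivableM.
- by rewrite mulr0; apply: (derivable1P (f : Rn -> R^o) (l *: x + y) v).1; exact: (smooth_derivable sf).
Qed.

Lemma smooth_affine (l : R) y f : smooth f -> smooth (fun x => f (l *: x + y)).
Proof.
move=> sf; apply: (@smooth_coind (fun g => exists c f, smooth f /\ g = fun x => c * f (l *: x + y))).
  move=> _ [c [{}f [{}sf ->]]]; split => [x|i].
    apply: (@differentiableZ _ _ _ (fun x => f (l *: x + y) : R^o)).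
    by apply: differentiable_affine => z; exact: smooth_differentiable.
  exists (c * l), (pderiv i f); split; first exact: smooth_pderiv.
  apply/funext => x; rewrite -mulrA; move: (pderiv_affine i l y sf) => /(congr1 (@^~ x)) <-.
  apply: (@deriveZ _ _ _ (fun x => f (l *: x + y) : R^o)).
  by apply: diff_derivable; apply: differentiable_affine => z; exact: smooth_differentiable.
by exists 1, f; split => //; apply/funext => x; rewrite mul1r.
Qed.

(** Each [F k] is the [k]-th derivative of [F 0], and the multiples of the
  [F k] form a class that is stable under the partial derivatives. *)
Lemma smooth_coordinate (F : nat -> R -> R) (a b : R) i :
  (forall k (t : R), is_derive t (1 : R) (F k : R -> R^o) (F k.+1 t)) ->
  smooth (fun x : Rn => F 0%N (a * x 0 i + b)).
Proof.
move=> dF.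
have dl k (x : Rn) : differentiable (fun x => F k (a * x 0 i + b) : R^o) x.
  apply: (@differentiable_comp _ _ _ _ (fun x : Rn => a * x 0 i + b : R^o) (F k : R -> R^o)).
    apply: differentiableD => //; apply: (@differentiableZ _ _ _ (fun x : Rn => x 0 i : R^o)).
    exact: differentiable_coord.
  by apply/derivable1_diffP; have [] := dF k (a * x 0 i + b).
apply: (@smooth_coind (fun g => exists k c, g = fun x => c * F k (a * x 0 i + b))).
  move=> _ [k [c ->]]; split => [x|j].
    by apply: (@differentiableZ _ _ _ (fun x => F k (a * x 0 i + b) : R^o)).
  exists k.+1, (c * (a * (i == j)%:R)); apply/funext => x.
  rewrite /pderiv -mulrA.
  rewrite (@deriveZ _ _ _ (fun x => F k (a * x 0 i + b) : R^o)); last exact: diff_derivable.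
  congr (_ * _); rewrite derive_line; set v := delta_mx 0 j.
  rewrite (_ : (fun h => _) = (F k : R -> R^o) \o (fun h => (a * v 0 i) * h + (a * x 0 i + b))); last first.
    by apply/funext => h /=; congr F; rewrite !mxE; ring.
  have der : is_derive (0 : R) 1 (fun h : R => (a * v 0 i) * h + (a * x 0 i + b) : R^o) (a * v 0 i).
    by apply: is_derive_eq; rewrite addr0 scaler1.
  rewrite derive1_comp; last 2 first.
  - by case: der.
  - by have [] := dF k (a * v 0 i * 0 + (a * x 0 i + b)).
  rewrite !derive1E (@derive_val _ _ _ _ _ _ _ der) (@derive_val _ _ _ _ _ _ _ (dF k _)).
  by rewrite mulr0 add0r mulrC /v mxE eqxx/= eq_sym.
by exists 0%N, 1; apply/funext => x; rewrite mul1r.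
Qed.

End smooth_functions.

Section flat_exponential.
Context (R : realType).
Implicit Types (p : {poly R}) (t : R).

(** These are the functions that appear as derivatives of [exp (- 1 / t)],
  extended by zero to the negative half line. *)
Definition flat_exp p t : R := if 0 < t then p.[t^-1] * expR (- t^-1) else 0.

(** The exponential beats every power of [1 / t]; the quadratic bound gives
  the derivative zero at the origin. *)
Lemma flat_exp_bound p : exists C, 0 <= C /\ forall t, `|t| <= 1 -> `|flat_exp p t| <= C * t ^+ 2.
Proof.
pose m := size p; pose A := \sum_(i < m) `|p`_i|.
have A0 : 0 <= A by exact: sumr_ge0.
exists (A * m.+2`!%:R); split; first by rewrite mulr_ge0.
move=> t t1; rewrite /flat_exp; case: ifPn => t0; last first.
  by rewrite normr0 mulr_ge0 ?sqr_ge0// mulr_ge0.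
have s1 : 1 <= t^-1 by rewrite invf_ge1// -(gtr0_norm t0).
have s0 : 0 < t^-1 by rewrite invr_gt0.
set s := t^-1 in s1 s0 *.
have -> : t ^+ 2 = s ^- 2 by rewrite /s exprVn invrK.
rewrite normrM (ger0_norm (expR_ge0 _)) expRN.
have h1 : `|p.[s]| <= A * s ^+ m.
  rewrite horner_coef (le_trans (ler_norm_sum _ _ _))// mulr_suml.
  apply: ler_sum => i _; rewrite normrM ler_wpM2l// ger0_norm ?exprn_ge0 ?(ltW s0)//.
  by rewrite ler_weXn2l// ltnW.
have h2 : s ^+ m.+2 <= m.+2`!%:R * expR s.
  have := expR_ge1Dxn m.+1 (ltW s0); rewrite -ler_pdivrMl ?ltr0n ?fact_gt0//.
  by rewrite mulrC; lra.
rewrite ler_pdivrMr ?expR_gt0// (le_trans h1)//.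
rewrite -!mulrA ler_wpM2l// [_^-1 * _]mulrC mulrA ler_pdivlMr ?exprn_gt0//.
by rewrite -exprD addn2.
Qed.

Lemma flat_exp_derive p t : is_derive t (1 : R) (flat_exp p : R -> R^o) (flat_exp ('X^2 * (p - p^`())) t).
Proof.
have o1 : (1 : R) != 0 by exact: oner_neq0.
have [t0|t0|->] := ltgtP t 0.
- rewrite {2}/flat_exp ltNge (ltW t0)/=.
  apply: (near_eq_is_derive (f := fun _ : R => 0 : R^o)) => //.
  near=> s; rewrite /flat_exp ltNge ltW//.
  by near: s; exact: lt_nbhsl.
- rewrite {2}/flat_exp t0.
  have t1 : t != 0 by rewrite gt_eqF.
  have dV : is_derive t (1 : R) (fun s : R => s^-1 : R^o) (- t ^- 2).
    by have := is_deriveV (f := id) t1 (is_derive_id t 1); rewrite /GRing.scale/= mulr1.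
  apply: (near_eq_is_derive (f := fun s : R => p.[s^-1] * expR (- s^-1) : R^o)) => //.
    near=> s; rewrite /flat_exp ifT//.
    by near: s; exact: lt_nbhsr.
  have d1 : is_derive t (1 : R) (fun s : R => p.[s^-1] : R^o) (p^`().[t^-1] * - t ^- 2).
    exact: (is_derive1_comp (is_derive_poly p t^-1) dV).
  have d2 : is_derive t (1 : R) (fun s : R => expR (- s^-1) : R^o) (expR (- t^-1) * t ^- 2).
    have := is_derive1_comp (g := fun s : R => - s^-1) (is_derive_expR (- t^-1)) (is_deriveN dV).
    by rewrite opprK.
  apply: (is_derive_eq (is_deriveM d1 d2)).
  change (p.[t^-1] * (expR (- t^-1) * t ^- 2) + expR (- t^-1) * (p^`().[t^-1] * - t ^- 2) =
    ('X^2 * (p - p^`())).[t^-1] * expR (- t^-1)).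
  by rewrite hornerM hornerXn hornerD hornerN exprVn; ring.
- rewrite {2}/flat_exp ltxx.
  have [C [C0 HC]] := flat_exp_bound p.
  have f0 : flat_exp p 0 = 0 by rewrite /flat_exp ltxx.
  have cv : h^-1 *: (flat_exp p (h *: 1 + 0) - flat_exp p 0) @[h --> (0:R)^'] --> (0 : R^o).
    apply: (cvg_to_0_linear (K := C) (k := 1)) => // h /andP[h0 h1].
    rewrite f0 subr0 addr0 /GRing.scale/= mulr1 normrM normfV ler_pdivrMl//.
    by rewrite (le_trans (HC _ (ltW h1)))// -(real_normK (num_real h)) expr2 mulrCA.
  apply: DeriveDef; first by apply/cvg_ex; exists 0.
  by apply: cvg_lim => //.
Unshelve. all: by end_near. Qed.

(** The [k]-th derivative of the bump is [flat_exp (flat_poly k)]. *)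
Fixpoint flat_poly k : {poly R} := if k is m.+1 then 'X^2 * (flat_poly m - (flat_poly m)^`()) else 1.

Definition bump (t : R) := flat_exp 1 t.

Lemma bumpE t : bump t = if 0 < t then expR (- t^-1) else 0.
Proof. by rewrite /bump /flat_exp hornerC mul1r. Qed.

Lemma bump_ge0 t : 0 <= bump t.
Proof. by rewrite bumpE; case: ifP => // _; exact: expR_ge0. Qed.

Lemma bump_le1 t : bump t <= 1.
Proof. by rewrite bumpE; case: ifPn => // t0; rewrite expR_le1 oppr_le0 invr_ge0 ltW. Qed.

Lemma bump_le0 t : t <= 0 -> bump t = 0.
Proof. by move=> t0; rewrite bumpE ltNge t0. Qed.

Lemma bump_gt0 t : 0 < t -> 0 < bump t.
Proof. by move=> t0; rewrite bumpE t0 expR_gt0. Qed.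

Lemma bump_ndecr s t : s <= t -> bump s <= bump t.
Proof.
move=> st; have [s0|s0] := leP s 0; first by rewrite bump_le0// bump_ge0.
by rewrite !bumpE s0 (lt_le_trans s0 st) ler_expR lerN2 lef_pV2// posrE// (lt_le_trans s0 st).
Qed.

Lemma smooth_bump n (a b : R) (i : 'I_n) : smooth (fun x : 'rV[R]_n => bump (a * x 0 i + b)).
Proof.
apply: (smooth_coordinate (F := fun k => flat_exp (flat_poly k))) => k t.
exact: flat_exp_derive.
Qed.

(** The argument crosses the flat point of the bump with slope [k ^ 2], so that
  the bumps tend to the indicator of a closed half line. *)
Lemma bump_cvg (t : R) : bump (k%:R ^+ 2 * t + k%:R) @[k --> \oo] --> ((0 <= t)%R%:R : R).
Proof.
have [t0|t0] := leP 0 t.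
- apply/cvgrPdist_le => e e0; near=> k.
  have k0 : (0 : R) < k%:R by rewrite ltr0n; near: k; exact: nbhs_infty_gt.
  have tk : k%:R <= k%:R ^+ 2 * t + k%:R by rewrite lerDr mulr_ge0// sqr_ge0.
  rewrite ger0_norm ?subr_ge0 ?bump_le1// lerBlDr -lerBlDl (le_trans _ (bump_ndecr tk))//.
  rewrite bumpE k0; apply: le_trans (expR_ge1Dx _); rewrite lerD2l lerN2 invf_ple ?posrE//.
  near: k; exists (Num.bound e^-1) => // k /= kb.
  apply: (@le_trans _ _ (Num.bound e^-1)%:R); last by rewrite ler_nat.
  by rewrite ltW// archi_boundP// invr_ge0 ltW.
- apply: cvg_near_cst; near=> k.
  rewrite bump_le0// expr2 -mulrA -{3}[k%:R]mulr1 -mulrDr.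
  rewrite mulr_ge0_le0// -lerBrDr sub0r.
  have tn : 0 < - t by rewrite oppr_gt0.
  rewrite -lerN2 opprK -mulrN -ler_pdivrMr// div1r.
  near: k; exists (Num.bound (- t)^-1) => // k /= kb.
  apply: (@le_trans _ _ (Num.bound (- t)^-1)%:R); last by rewrite ler_nat.
  by rewrite ltW// archi_boundP// invr_ge0 oppr_ge0 ltW.
Unshelve. all: by end_near. Qed.

End flat_exponential.

Section cutoff.
Context (R : realType).

Definition step (t : R) := bump t * (bump t + bump (1 - t))^-1.

Lemma step_denominator (t : R) : 0 < bump t + bump (1 - t).
Proof.
have [t0|t0] := ltP 0 t; first by rewrite ltr_pwDl// ?bump_gt0// bump_ge0.
by rewrite ltr_wpDl ?bump_ge0// bump_gt0// subr_gt0 (le_lt_trans t0).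
Qed.

Lemma step_ge0 (t : R) : 0 <= step t.
Proof. by rewrite /step mulr_ge0 ?bump_ge0// invr_ge0 ltW// step_denominator. Qed.

Lemma step_le1 (t : R) : step t <= 1.
Proof. by rewrite /step ler_pdivrMr ?step_denominator// mul1r lerDl bump_ge0. Qed.

Lemma step_eq0 (t : R) : t <= 0 -> step t = 0.
Proof. by move=> t0; rewrite /step bump_le0// mul0r. Qed.

Lemma step_eq1 (t : R) : 1 <= t -> step t = 1.
Proof.
move=> t1; rewrite /step [bump (1 - t)]bump_le0 ?subr_le0// addr0 mulfV// gt_eqF// bump_gt0//.
exact: lt_le_trans t1.
Qed.

Definition cutoff n (x : 'rV[R]_n) : R := \prod_(i < n) (step (2 - x 0 i) * step (2 + x 0 i)).

Lemma smooth_cutoff n : smooth (@cutoff n).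
Proof.
have S a b i : smooth (fun x : 'rV[R]_n => step (a * x 0 i + b)).
  apply: smoothM; first exact: smooth_bump.
  apply: smoothV; last by move=> x; rewrite gt_eqF// step_denominator.
  apply: smoothD; first exact: smooth_bump.
  have := @smooth_bump R n (- a) (1 - b) i.
  by congr smooth; apply/funext => x; congr bump; ring.
apply: smooth_prod => i; apply: smoothM.
  by have := S (-1) 2 i; congr smooth; apply/funext => x; congr step; ring.
by have := S 1 2 i; congr smooth; apply/funext => x; congr step; ring.
Qed.

Lemma cutoff_ge0 n (x : 'rV[R]_n) : 0 <= cutoff x.
Proof. by apply: prodr_ge0 => i _; rewrite mulr_ge0// step_ge0. Qed.

Lemma cutoff_le1 n (x : 'rV[R]_n) : cutoff x <= 1.
Proof.
apply: prodr_ile1 => i _; rewrite mulr_ge0 ?step_ge0//=.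
by rewrite mulr_ile1 ?step_ge0 ?step_le1.
Qed.

Lemma cutoff_eq1 n (x : 'rV[R]_n) : cube 1 x -> cutoff x = 1.
Proof.
move=> /cubeP x1; apply: big1 => i _; have := x1 i; rewrite ler_norml => /andP[h1 h2].
by rewrite !step_eq1 ?mulr1//; lra.
Qed.

Lemma cutoff_eq0 n (x : 'rV[R]_n) : ~ cube 2 x -> cutoff x = 0.
Proof.
move=> x2; have [i xi] : exists i, 2 < `|x 0 i|.
  apply: contrapT => H; apply: x2; apply/cubeP => i; rewrite leNgt; apply/negP => ri.
  by apply: H; exists i.
apply/eqP/prodf_eq0; exists i => //; rewrite mulf_eq0; apply/orP.
have [xp|xn] := leP 0 (x 0 i).
  by left; rewrite step_eq0// subr_le0 ltW// -(ger0_norm xp).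
by right; rewrite step_eq0//; move: xi; rewrite ltr0_norm//; lra.
Qed.

End cutoff.

Section test_functions.
Context (R : realType) (n : nat).
Notation Rn := 'rV[R]_n.
Notation mu := (lebesgue_rV R n).
Implicit Types (f g eta chi : Rn -> R) (i j : 'I_n) (x y v : Rn).

Lemma compact_cube (r : R) : compact (cube (n := n) r).
Proof.
rewrite (_ : cube r = [set v : Rn | forall i, `[- r, r]%classic (v ord0 i)]).
  by apply: (@rV_compact R n (fun _ => `[- r, r]%classic)) => i; exact: segment_compact.
by apply/seteqP; split=> x H i; have := H i; rewrite /= !mxE.
Qed.

Lemma closed_cube (r : R) : closed (cube (n := n) r).
Proof. by apply: compact_closed; [exact: norm_hausdorff|exact: compact_cube]. Qed.

Lemma test_function_cube f r : smooth f -> (forall x, ~ cube r x -> f x = 0) -> test_function f.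
Proof.
move=> sf f0; split=> //; apply: (subclosed_compact _ (compact_cube (r := r))).
  exact: closed_closure.
rewrite ((closure_id _).1 (closed_cube (r := r))); apply: closure_subset => z /= fz.
by apply: contrapT => /f0 fz0; rewrite fz0 eqxx in fz.
Qed.

Lemma test_function_support f : test_function f ->
  exists r, 0 < r /\ forall x, ~ cube r x -> f x = 0.
Proof.
move=> [sf cf]; have /compact_bounded[M [_ HM]] := cf.
exists (Num.max 1 (M + 1)); split; first by rewrite lt_max ltr01.
move=> x nx; apply/eqP; apply: contrapT => /negP fx; apply: nx; apply/cubeP => i.
have := HM (Num.max 1 (M + 1)); rewrite lt_max ltrDl ltr01 orbT => /(_ isT x).
move=> /(_ (@subset_closure _ [set x | f x != 0] x fx)); apply: le_trans.
rewrite /Num.norm/= mx_normrE; exact: (le_bigmax _ (fun ij => `|x ij.1 ij.2|) (ord0, i)).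
Qed.

Lemma test_function_bounded f : test_function f -> exists2 M, 0 <= M & forall x, `|f x| <= M.
Proof.
move=> tf; have [r [r0 fr]] := test_function_support tf.
have cf : continuous f by apply: smooth_continuous; case: tf.
have /compact_bounded[M [_ HM]] := continuous_compact (continuous_subspaceT cf) (compact_cube (r := r)).
exists (Num.max 0 (M + 1)); first by rewrite le_max lexx.
move=> x; have [xr|/fr ->] := pselect (cube r x); last by rewrite normr0 le_max lexx.
have := HM (Num.max 0 (M + 1)); rewrite lt_max ltrDl ltr01 orbT => /(_ isT (f x)); apply.
by exists x.
Qed.

Lemma test_function_measurable f : test_function f -> measurable_fun [set: Rn] f.
Proof. by case=> sf _; exact: smooth_measurable. Qed.

Lemma test_function_pderiv i f : test_function f -> test_function (pderiv i f).
Proof.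
move=> tf; have [r [r0 fr]] := test_function_support tf.
apply: (@test_function_cube _ r); first by apply: smooth_pderiv; case: tf.
move=> x xr; rewrite /pderiv derive_line derive1E.
have o1 : (1 : R) != 0 by exact: oner_neq0.
rewrite (near_eq_derive (g := fun _ => 0 : R^o)) ?derive_cst//.
have ox : nbhs x (~` cube r) by apply: open_nbhs_nbhs; split => //; apply: closed_openC; exact: closed_cube.
have cl : (fun h : R => h *: delta_mx 0 i + x) h @[h --> (0:R)] --> x.
  have : continuous (fun h : R => h *: delta_mx 0 i + x : Rn).
    move=> h; apply: (@differentiable_continuous _ _ _ h (fun h : R => h *: delta_mx 0 i + x : Rn)).
    exact: differentiableD.
  by move=> /(_ (0 : R)); rewrite /continuous_at scale0r add0r.
by near=> h; apply: fr; near: h; exact: (cl _ ox).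
Unshelve. all: by end_near.
Qed.

Lemma test_functionM chi f : smooth chi -> test_function f -> test_function (fun x => chi x * f x).
Proof.
move=> sc tf; have [r [r0 fr]] := test_function_support tf.
apply: (@test_function_cube _ r); first by apply: smoothM => //; case: tf.
by move=> x xr; rewrite fr// mulr0.
Qed.

Lemma test_function_affine (l : R) y f : l != 0 -> test_function f ->
  test_function (fun x => f (l *: x + y)).
Proof.
move=> l0 tf; have [r [r0 fr]] := test_function_support tf.
pose M := \sum_i `|y 0 i|.
apply: (@test_function_cube _ (`|l|^-1 * (r + M))); first by apply: smooth_affine; case: tf.
move=> x xr; apply: fr => /cubeP H; apply: xr; apply/cubeP => i.
rewrite ler_pdivlMl ?normr_gt0// -normrM.
have -> : l * x 0 i = (l *: x + y) 0 i - y 0 i by rewrite !mxE addrK.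
apply: (le_trans (ler_normB _ _)); apply: lerD => //.
by rewrite /M (bigD1 i)//= lerDl sumr_ge0.
Qed.

Lemma test_function_cutoff : test_function (@cutoff R n).
Proof. by apply: (@test_function_cube _ 2); [exact: smooth_cutoff|exact: cutoff_eq0]. Qed.

Lemma indic_cube_intg (r : R) : mu.-integrable setT (EFin \o (\1_(cube r) : Rn -> R)).
Proof.
have mc := measurable_cube (n := n) r; apply: ge0_intg => //.
by rewrite integral_indic// setIT; exact: box_measure_lty.
Qed.

Lemma bounded_support_intg f (r M : R) : measurable_fun [set: Rn] f ->
  (forall x, ~ cube r x -> f x = 0) -> (forall x, `|f x| <= M) -> mu.-integrable setT (EFin \o f).
Proof.
move=> mf f0 fM; apply: (intg_le mf _ (intgZ M (indic_cube_intg r))).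
move=> x; rewrite indicE; have [xr|xr] := pselect (cube r x).
  by rewrite mem_set// mulr1.
by rewrite memNset// f0// normr0 mulr0.
Qed.

Lemma test_function_intg f : test_function f -> mu.-integrable setT (EFin \o f).
Proof.
move=> tf; have [r [r0 fr]] := test_function_support tf.
have [M M0 fM] := test_function_bounded tf.
exact: bounded_support_intg (test_function_measurable tf) fr fM.
Qed.

Lemma bounded_support_sqint f (r M : R) : measurable_fun [set: Rn] f ->
  (forall x, ~ cube r x -> f x = 0) -> (forall x, `|f x| <= M) -> sqint mu f.
Proof.
move=> mf f0 fM; split => //; apply: (@bounded_support_intg _ r (M ^+ 2)).
- exact: measurable_funX.
- by move=> x /f0 ->; rewrite expr0n.
- move=> x; rewrite normrX lerXn2r// nnegrE//.
  by rewrite (le_trans _ (fM x)).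
Qed.

Lemma test_function_sqint f : test_function f -> sqint mu f.
Proof.
move=> tf; have [r [r0 fr]] := test_function_support tf.
have [M M0 fM] := test_function_bounded tf.
exact: bounded_support_sqint (test_function_measurable tf) fr fM.
Qed.

(** Once [k] is large these are smooth approximations of the indicator of the
  box: each factor follows one face. *)
Definition box_bump (a b : Rn) k x : R :=
  \prod_(i < n) (bump (k%:R ^+ 2 * (x 0 i - a 0 i) + k%:R) * bump (k%:R ^+ 2 * (b 0 i - x 0 i) + k%:R)).

Lemma box_bump_cvg a b x : box_bump a b k x @[k --> \oo] --> (\1_(box a b) x : R).
Proof.
have -> : \1_(box a b) x = \prod_(i < n) ((0 <= x 0 i - a 0 i)%R%:R * (0 <= b 0 i - x 0 i)%R%:R) :> R.
  rewrite indicE; have [xb|xb] := pselect (box a b x).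
    rewrite mem_set// big1// => i _; have := xb i; rewrite in_itv/= => /andP[h1 h2].
    by rewrite !subr_ge0 h1 h2 mulr1.
  rewrite memNset//; have [i /negP] : exists i, ~ (x 0 i \in `[a 0 i, b 0 i]) by apply/existsNP.
  rewrite in_itv/= negb_and => H; apply/esym/eqP/prodf_eq0; exists i => //.
  by rewrite !subr_ge0 mulf_eq0 !pnatr_eq0 !eqb0.
by apply: rcvg_prod => i; apply: rcvgM; exact: bump_cvg.
Qed.

Lemma test_function_box_bump a b k : test_function (box_bump a b k.+1).
Proof.
pose r := \sum_i `|a 0 i| + \sum_i `|b 0 i| + 1.
apply: (@test_function_cube _ r).
  apply: smooth_prod => i; apply: smoothM.
    have := @smooth_bump R n (k.+1%:R ^+ 2) (- k.+1%:R ^+ 2 * a 0 i + k.+1%:R) i.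
    by congr smooth; apply/funext => x; congr bump; ring.
  have := @smooth_bump R n (- k.+1%:R ^+ 2) (k.+1%:R ^+ 2 * b 0 i + k.+1%:R) i.
  by congr smooth; apply/funext => x; congr bump; ring.
move=> x xr; have [i xi] : exists i, r < `|x 0 i|.
  apply: contrapT => H; apply: xr; apply/cubeP => i; rewrite leNgt; apply/negP => ri.
  by apply: H; exists i.
apply/eqP/prodf_eq0; exists i => //.
have ai : `|a 0 i| <= \sum_i `|a 0 i| by rewrite (bigD1 i)//= lerDl sumr_ge0.
have bi : `|b 0 i| <= \sum_i `|b 0 i| by rewrite (bigD1 i)//= lerDl sumr_ge0.
have H t : t <= - 1 -> k.+1%:R ^+ 2 * t + k.+1%:R <= 0 :> R.
  move=> t1; have k1 : (1 : R) <= k.+1%:R by rewrite ler1n.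
  by rewrite expr2; nra.
have [xp|xn] := leP 0 (x 0 i).
  rewrite (ger0_norm xp) in xi; rewrite mulf_eq0 (bump_le0 (H (b 0 i - x 0 i) _)) ?eqxx ?orbT//.
  have := ler_norm (b 0 i); have : 0 <= \sum_i `|a 0 i| by exact: sumr_ge0.
  by rewrite /r in xi; lra.
rewrite (ltr0_norm xn) in xi; rewrite mulf_eq0 (bump_le0 (H (x 0 i - a 0 i) _)) ?eqxx//.
have := ler_norm (- a 0 i); rewrite normrN; have : 0 <= \sum_i `|b 0 i| by exact: sumr_ge0.
by rewrite /r in xi; lra.
Qed.

Lemma box_bump_bound a b k x : `|box_bump a b k.+1 x| <= \1_(box (a - const_mx 1) (b + const_mx 1)) x.
Proof.
have B i : 0 <= bump (k.+1%:R ^+ 2 * (x 0 i - a 0 i) + k.+1%:R) * bump (k.+1%:R ^+ 2 * (b 0 i - x 0 i) + k.+1%:R) <= (1 : R).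
  by rewrite mulr_ge0 ?bump_ge0//= mulr_ile1 ?bump_ge0 ?bump_le1.
rewrite ger0_norm; last by apply: prodr_ge0 => i _; case/andP: (B i).
rewrite indicE; have [xb|xb] := pselect (box (a - const_mx 1) (b + const_mx 1) x).
  by rewrite mem_set//; apply: prodr_ile1 => i _; exact: B.
rewrite memNset// le_eqVlt; apply/orP; left; apply/prodf_eq0.
have [i /negP] : exists i, ~ (x 0 i \in `[(a - const_mx 1) 0 i, (b + const_mx 1) 0 i]) by apply/existsNP.
rewrite in_itv/= !mxE negb_and -!ltNge => xi; exists i => //.
have H t : t <= - 1 -> k.+1%:R ^+ 2 * t + k.+1%:R <= 0 :> R.
  move=> t1; have k1 : (1 : R) <= k.+1%:R by rewrite ler1n.
  by rewrite expr2; nra.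
rewrite mulf_eq0; case/orP: xi => xi; apply/orP; [left|right]; rewrite bump_le0// H//; lra.
Qed.

Lemma indic_box_sqint a b : sqint mu (\1_(box a b) : Rn -> R).
Proof.
have mb := measurable_box a b; split => //.
apply: ge0_intg => [|x|]; [exact: measurable_funX|exact: sqr_ge0|].
rewrite (eq_integral (fun x => (\1_(box a b) x)%:E)) ?integral_indic//.
  by rewrite setIT; exact: box_measure_lty.
by move=> x _; rewrite indicE; case: (_ \in _); rewrite ?expr1n ?expr0n.
Qed.

(** Test functions approximate the indicators of boxes, and the sets over
  which [g] integrates to zero form a lambda-system, so [g] integrates to zero
  over all bounded measurable sets. *)
Lemma orth_test_function_eq0 g : sqint mu g ->
  (forall eta, test_function eta -> \int[mu]_x (g x * eta x) = 0) -> g = cst 0 %[ae mu].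
Proof.
move=> g2 gt; have [mg _] := g2.
have gI (A : set Rn) K : measurable A -> mu.-integrable setT (EFin \o (fun x => g x * \1_(A `&` cube K) x)).
  move=> mA; have mAK : measurable (A `&` cube K) by apply: measurableI => //; exact: measurable_cube.
  apply: (intg_le _ _ (intg_norm (sqint_mul g2 (indic_box_sqint (const_mx (- K)) (const_mx K))))).
    by apply: measurable_funM => //; exact: measurable_indic.
  move=> x; rewrite !normrM ler_wpM2l// !indicE.
  have [[xA xK]|nx] := pselect ((A `&` cube K) x); first by rewrite !mem_set.
  by rewrite (memNset nx) normr0.
have gbox a b : \int[mu]_x (g x * \1_(box a b) x) = 0.
  have [_ c] : mu.-integrable setT (EFin \o (fun x => g x * \1_(box a b) x)) /\
      \int[mu]_x (g x * box_bump a b k.+1 x) @[k --> \oo] --> \int[mu]_x (g x * \1_(box a b) x).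
    apply: (J_dct (g := fun x => `|g x * \1_(box (a - const_mx 1) (b + const_mx 1)) x|)).
    - by move=> k; apply: measurable_funM => //; apply: test_function_measurable; exact: test_function_box_bump.
    - move=> x; apply: rcvgM; first exact: rcvg_cst.
      by have := @box_bump_cvg a b x; rewrite -(cvg_shiftS (fun k => box_bump a b k x)).
    - move=> k x; rewrite !normrM ler_wpM2l// (le_trans (box_bump_bound _ _ _ _))//.
      exact: ler_norm.
    - by apply: intg_norm; apply: sqint_mul => //; exact: indic_box_sqint.
  rewrite -(cvg_lim _ c)//.
  rewrite (_ : (fun k => _) = fun=> 0); first by rewrite lim_cst.
  by apply/funext => k; apply: gt; exact: test_function_box_bump.
have gA (A : set Rn) K : measurable A -> \int[mu]_x (g x * \1_(A `&` cube K) x) = 0.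
  move=> mA.
  pose H := [set A : set Rn | measurable A /\ forall K, \int[mu]_x (g x * \1_(A `&` cube K) x) = 0].
  suff : H A by move=> [_]; exact.
  have : <<s @boxes R n >> `<=` H.
    apply: (lambda_system_subset (G := @boxes R n)); [exact: boxes_setI| | |by []].
    - split => //.
      + split => // K'; rewrite setTI; exact: gbox.
      + move=> B C CB [mB HB] [mC HC]; split; first exact: measurableD.
        move=> K'; rewrite -(subrr 0) -{1}(HB K') -(HC K') -JB; [|exact: gI|exact: gI].
        apply: J_eq => x; rewrite -mulrBr !indicE; congr (_ * _).
        have [xK|xK] := pselect (cube K' x); last first.
          by rewrite !(@memNset _ _ x) ?subrr// => -[].
        have [xC|xC] := pselect (C x).
          have xB := CB _ xC; rewrite [x \in (B `\` C) `&` _]memNset; last by move=> [[]].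
          by rewrite !mem_set// subrr.
        rewrite [x \in C `&` _]memNset; last by move=> [].
        have [xB|xB] := pselect (B x); first by rewrite !mem_set// subr0.
        rewrite [x \in (B `\` C) `&` _]memNset; last by move=> [[]].
        by rewrite [x \in B `&` _]memNset ?subr0// => -[].
      + move=> F ndF HF; split; first by apply: bigcupT_measurable => k; case: (HF k).
        move=> K'; have [_ c] : mu.-integrable setT (EFin \o (fun x => g x * \1_((\bigcup_i F i) `&` cube K') x)) /\
            \int[mu]_x (g x * \1_(F k `&` cube K') x) @[k --> \oo] --> \int[mu]_x (g x * \1_((\bigcup_i F i) `&` cube K') x).
          apply: (J_dct (g := fun x => `|g x * \1_(setT `&` cube K') x|)).
          * by move=> k; apply: intg_measurable (gI _ _ _); case: (HF k).
          * move=> x; apply: rcvgM; first exact: rcvg_cst.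
            apply: cvg_near_cst; have [[[N _ xN] xK]|nx] := pselect (((\bigcup_i F i) `&` cube K') x).
              exists N => // k /= Nk; have h1 : (F k `&` cube K') x by split => //; move/subsetPset: (ndF _ _ Nk); apply.
              have h2 : ((\bigcup_i F i) `&` cube K') x by split => //; exists N.
              by rewrite !indicE !mem_set.
            apply: nearW => k; rewrite !indicE !memNset// => -[xF xK]; apply: nx; split => //.
            by exists k.
          * move=> k x; rewrite !normrM ler_wpM2l// !indicE setTI.
            have [[xA xK]|nx] := pselect ((F k `&` cube K') x); first by rewrite !mem_set.
            by rewrite (memNset nx) normr0.
          * by apply: intg_norm; exact: gI.
        rewrite -(cvg_lim _ c)// (_ : (fun k => _) = fun=> 0); first by rewrite lim_cst.
        by apply/funext => k; case: (HF k) => _; exact.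
    - move=> _ [a [b ->]]; split; first exact: measurable_box.
      move=> K'; have [c [d e]] : @boxes R n (box a b `&` cube K').
        by apply: boxes_setI; [exists a, b|exists (const_mx (- K')), (const_mx K')].
      by rewrite e gbox.
  by rewrite -measurable_boxes => /(_ _ mA).
have gc k : ae_eq mu (cube k%:R) (EFin \o g) (cst 0%E).
  have mc := measurable_cube (n := n) (k%:R : R).
  have gEI E : measurable E -> E `<=` cube k%:R -> (\int[mu]_(x in E) (EFin \o g) x = \int[mu]_x (g x * \1_(E `&` cube k%:R) x)%:E)%E.
    move=> mE Ek; rewrite integral_mkcond; apply: eq_integral => x _.
    rewrite /patch indicE (setIidl Ek); case: (x \in E) => /=; by rewrite ?mulr1 ?mulr0.
  apply: integral_ae_eq => //.
  - apply/(integrable_mkcond _ mc); apply: eq_integrable (gI setT k%:R measurableT) => // x _.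
    by rewrite /patch /= indicE setTI; case: (x \in _) => /=; rewrite ?mulr1 ?mulr0.
  - move=> E Ek mE; rewrite integral0 gEI// J_EFin; last exact: gI.
    by rewrite gA.
have : {ae mu, forall x, forall k : nat, cube k%:R x -> (EFin \o g) x = 0%E}.
  by apply/ae_foralln => k; exact: gc.
apply: filterS => x H _; have [k _ xk] : (\bigcup_k cube k%:R) x by rewrite bigcup_cube.
by have [] := H k xk.
Qed.

End test_functions.

(** * Weak convergence in [L^2] *)

Section weak_convergence.
Context d (T : measurableType d) (R : realType) (mu : {measure set T -> \bar R}).
Implicit Types (f u v w : T -> R) (c C : R).
Notation J f := (Rintegral mu setT f).
Notation N2 u := (J (fun x => u x ^+ 2)).

Lemma cvg_invS0 : (k.+1%:R^-1 : R) @[k --> \oo] --> (0 : R).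
Proof.
apply/cvgrPdist_le => e e0; exists (Num.bound e^-1) => // k /= kb.
rewrite sub0r normrN ger0_norm ?invr_ge0// invf_ple ?posrE//.
apply: (@le_trans _ _ (Num.bound e^-1)%:R); last by rewrite ler_nat (leq_trans kb).
by rewrite ltW// archi_boundP// invr_ge0 ltW.
Qed.

(** A minimizing sequence of [N2 f - 2 * l f] over [D] is Cauchy by the
  parallelogram identity, and the first variation vanishes at its limit. As
  [D] need not be closed, the limit comes with approximations from [D]. *)
Lemma riesz (D : set (T -> R)) (l : (T -> R) -> R) C : 0 <= C ->
  (forall f, D f -> sqint mu f) -> D (fun=> 0) ->
  (forall f g, D f -> D g -> D (fun x => f x + g x)) ->
  (forall c f, D f -> D (fun x => c * f x)) ->
  (forall f g, D f -> D g -> l (fun x => f x + g x) = l f + l g) ->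
  (forall c f, D f -> l (fun x => c * f x) = c * l f) ->
  (forall f, D f -> l f ^+ 2 <= C * N2 f) ->
  exists p, [/\ sqint mu p, forall f, D f -> J (fun x => p x * f x) = l f &
    exists2 eta : nat -> T -> R, forall k, D (eta k) &
      N2 (fun x => eta k x - p x) @[k --> \oo] --> 0].
Proof.
move=> C0 Ds D0 DD DZ lD lZ lC.
pose F f := N2 f - 2 * l f.
pose V := [set F f | f in D].
have Vlb : lbound V (- C).
  move=> _ [f Df <-]; rewrite /F; have := lC _ Df; have := J_sqr_ge0 mu f.
  move: (N2 f) (l f) => a b a0 H.
  suff : 2 * b <= C + a by lra.
  rewrite (le_trans (ler_norm _))// -[leRHS]ger0_norm ?addr_ge0// -ler_sqr ?nnegrE// !real_normK ?num_real//.
  have := sqr_ge0 (C - a); rewrite !expr2 in H *; lra.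
have hV : has_inf V by split; [exists (F (fun=> 0)), (fun=> 0)|exists (- C)].
pose m := inf V.
have mle f : D f -> m <= F f by move=> Df; apply: ge_inf; [exists (- C)|exists f].
have /choice[eta etaP] : forall k : nat, exists eta, D eta /\ F eta < m + k.+1%:R^-1.
  move=> k; have k0 : 0 < k.+1%:R^-1 :> R by rewrite invr_gt0.
  have [_ [f tf <-] H] := inf_adherent k0 hV.
  by exists f.
have etaD k : D (eta k) by case: (etaP k).
have eta2 k : sqint mu (eta k) by exact: Ds.
have par k k' : N2 (fun x => eta k x - eta k' x) <= 2 * k.+1%:R^-1 + 2 * k'.+1%:R^-1.
  have ek := eta2 k; have el := eta2 k'.
  have := mle _ (DZ 2^-1 _ (DD _ _ (etaD k) (etaD k'))).
  rewrite /F lZ ?lD//; last exact: DD.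
  rewrite J_sqrZ; last exact: sqintD.
  rewrite (_ : N2 (fun x => eta k x - eta k' x) =
    N2 (fun x => eta k x + (- 1) * eta k' x)); last by apply: J_eq => x; ring.
  rewrite !J_sqrD//; last exact: sqintZ.
  rewrite J_sqrZ// (_ : J (fun x => eta k x * (-1 * eta k' x)) =
     - J (fun x => eta k x * eta k' x)); last first.
    by rewrite -JN; [apply: J_eq => x; ring|exact: sqint_mul].
  have := (etaP k).2; have := (etaP k').2; rewrite /F.
  move: (N2 (eta k)) (N2 (eta k')) (J _) (l (eta k)) (l (eta k')) => a b c p q.
  move: (k.+1%:R^-1) (k'.+1%:R^-1) => s t; rewrite !expr2; lra.
have [e e0|p p2 cp] := sqint_complete eta2.
  have /cvgrPdist_le/(_ (e / 4)) [|N _ NP] := cvg_invS0; first by rewrite divr_gt0.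
  exists N => k k' /NP hk /NP hl; rewrite (le_trans (par k k'))//.
  move: hk hl; rewrite !sub0r !normrN !ger0_norm ?invr_ge0//.
  by move: (k.+1%:R^-1) (k'.+1%:R^-1) => s t; lra.
exists p; split => //; last by exists eta.
move=> f Df; have f2 := Ds _ Df.
have H k (t : R) : - k.+1%:R^-1 <= 2 * t * (J (fun x => eta k x * f x) - l f) + t ^+ 2 * N2 f.
  have := mle _ (DD _ _ (etaD k) (DZ t _ Df)); have := (etaP k).2; rewrite /F.
  rewrite (J_sqrD (eta2 k) (sqintZ t f2)) J_sqrZ// lD ?lZ//; last exact: DZ.
  rewrite (_ : J (fun x => eta k x * (t * f x)) = t * J (fun x => eta k x * f x)); last first.
    by rewrite -JZ; [apply: J_eq => x; ring|exact: sqint_mul].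
  by move: (N2 (eta k)) (N2 f) (J _) (l (eta k)) (l f) (k.+1%:R^-1) => a b c q r s; lra.
have c := ip_cvg eta2 p2 f2 cp.
have H2 t : 0 <= 2 * t * (J (fun x => p x * f x) - l f) + t ^+ 2 * N2 f.
  have c0 : - k.+1%:R^-1 @[k --> \oo] --> (0 : R) by rewrite -[X in _ --> X]oppr0; exact: (cvgN cvg_invS0).
  exact (rcvg_le c0 (rcvgD (rcvgZ (2 * t) (rcvgB c (rcvg_cst (l f)))) (rcvg_cst (t ^+ 2 * N2 f))) (fun k => H k t)).
move: H2; have := J_sqr_ge0 mu f; move: (N2 f) (J (fun x => p x * f x)) (l f) => a j b a0 H2.
apply/eqP; rewrite -subr_eq0; move: H2; move: (j - b) => c1 H2.
have := H2 (- c1 / (a + 1)); have a1 : 0 < a + 1 by lra.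
have -> : 2 * (- c1 / (a + 1)) * c1 + (- c1 / (a + 1)) ^+ 2 * a =
  - (c1 ^+ 2 * (a + 2)) / (a + 1) ^+ 2 by field; rewrite gt_eqF.
rewrite pmulr_lge0 ?invr_gt0 ?exprn_gt0// oppr_ge0 pmulr_lle0; last by lra.
by move=> c1_le0; rewrite -sqrf_eq0 eq_le c1_le0 sqr_ge0.
Qed.

Definition weakly_cvg (u_ : nat -> T -> R) u :=
  forall v, sqint mu v -> J (fun x => u_ k x * v x) @[k --> \oo] --> J (fun x => u x * v x).

(** The functions against which a bounded sequence converges form a subspace.
  A diagonal extraction puts the sequence itself into it, and Riesz represents
  the limit of the pairings. *)
Lemma weak_compactness (u_ : nat -> T -> R) C : (forall k, sqint mu (u_ k)) ->
  (forall k, N2 (u_ k) <= C) -> exists (sub : nat -> nat) u,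
  [/\ {homo sub : i j / (i < j)%N}, sqint mu u & weakly_cvg (u_ \o sub) u].
Proof.
move=> u2 uC.
have C0 : 0 <= C by exact: le_trans (J_sqr_ge0 mu (u_ 0%N)) (uC 0%N).
pose ip k v := J (fun x => u_ k x * v x).
have ipC k v : sqint mu v -> ip k v ^+ 2 <= C * N2 v.
  by move=> v2; rewrite (le_trans (cauchy_schwarz (u2 k) v2))// ler_wpM2r// J_sqr_ge0.
have ipb k l : `|ip k (u_ l)| <= C.
  rewrite -ler_sqr ?nnegrE// real_normK ?num_real// (le_trans (ipC _ _ (u2 l)))// expr2.
  by rewrite ler_wpM2l.
(* An ultrafilter picks a limit for each of the bounded pairings with a member
   of the sequence; the extraction realizes the first [j] of them up to the
   [j]-th error. *)
have [U [UU oU]] := @ultraFilterLemma nat \oo _.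
have UP : ProperFilter U by apply: ultra_proper.
have limU l : exists a : R, ip k (u_ l) @[k --> U] --> a.
  have cpt : compact (`[- C, C]%classic : set R) by exact: segment_compact.
  have UC : U (ip ^~ (u_ l) @^-1` `[- C, C]).
    by apply: filterE => k /=; rewrite in_itv/= -ler_norml.
  have [a [_ ca]] := cpt (ip ^~ (u_ l) @ U) _ UC; exists a => B aB.
  have [//|UB] := in_ultra_setVsetC (ip ^~ (u_ l) @^-1` B) UU.
  by have [z []] := ca (~` B) B UB aB.
have [L LP] := choice limU.
have [|sub subi subP] := @extract_subsequence (fun j k => forall l, (l <= j)%N -> `|L l - ip k (u_ l)| <= j.+1%:R^-1).
  move=> j N.
  have near_j : forall m, \forall k \near U, forall l, (l < m)%N -> `|L l - ip k (u_ l)| <= j.+1%:R^-1.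
    elim => [|m IH]; first by near=> k.
    have /cvgrPdist_le/(_ j.+1%:R^-1) Hm := LP m.
    near=> k; move=> l; rewrite ltnS leq_eqVlt => /orP[/eqP ->|].
      by near: k; apply: Hm; rewrite invr_gt0.
    by move: l; near: k.
  have UN : \forall k \near U, (N <= k)%N by apply: oU; exists N.
  have [k [kN kP]] := @filter_ex _ U _ _ (filterI UN (near_j j.+1)).
  by exists k.
exists sub.
pose D := [set v | sqint mu v /\ cvg (ip (sub j) v @[j --> \oo])].
pose l v := lim (ip (sub j) v @[j --> \oo]).
have Du k : D (u_ k).
  split => //; apply/cvg_ex; exists (L k); apply/cvgrPdist_le => e e0.
  have /cvgrPdist_le/(_ e e0) [N _ NP] := cvg_invS0.
  exists (maxn N k) => // j /=; rewrite geq_max => /andP[Nj kj].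
  have := NP j Nj; rewrite sub0r normrN ger0_norm ?invr_ge0// => /(le_trans _); apply.
  exact: subP.
have ipD k v w : sqint mu v -> sqint mu w -> ip k (fun x => v x + w x) = ip k v + ip k w.
  by move=> v2 w2; rewrite /ip -JD; [apply: J_eq => x; ring|exact: sqint_mul|exact: sqint_mul].
have ipZ k c v : sqint mu v -> ip k (fun x => c * v x) = c * ip k v.
  by move=> v2; rewrite /ip -JZ; [apply: J_eq => x; ring|exact: sqint_mul].
have lP v : D v -> ip (sub j) v @[j --> \oo] --> l v by case.
have cD v w : D v -> D w -> ip (sub j) (fun x => v x + w x) @[j --> \oo] --> l v + l w.
  move=> Dv Dw; rewrite (_ : (fun j => _) = fun j => ip (sub j) v + ip (sub j) w).
    exact (rcvgD (lP _ Dv) (lP _ Dw)).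
  by apply/funext => j; apply: ipD; [case: Dv|case: Dw].
have cZ c v : D v -> ip (sub j) (fun x => c * v x) @[j --> \oo] --> c * l v.
  move=> Dv; rewrite (_ : (fun j => _) = fun j => c * ip (sub j) v).
    exact (rcvgZ c (lP _ Dv)).
  by apply/funext => j; apply: ipZ; case: Dv.
have DD v w : D v -> D w -> D (fun x => v x + w x).
  move=> Dv Dw; split; first by apply: sqintD; [case: Dv|case: Dw].
  by apply/cvg_ex; exists (l v + l w); exact: cD.
have DZ c v : D v -> D (fun x => c * v x).
  move=> Dv; split; first by apply: sqintZ; case: Dv.
  by apply/cvg_ex; exists (c * l v); exact: cZ.
have lD v w : D v -> D w -> l (fun x => v x + w x) = l v + l w.
  by move=> Dv Dw; apply: cvg_lim => //; exact: cD.
have lZ c v : D v -> l (fun x => c * v x) = c * l v.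
  by move=> Dv; apply: cvg_lim => //; exact: cZ.
have D0 : D (fun=> 0).
  by have := DZ 0 _ (Du 0%N); congr D; apply/funext => x; rewrite mul0r.
have lC v : D v -> l v ^+ 2 <= C * N2 v.
  move=> Dv; have [v2 _] := Dv.
  have c2 : ip (sub j) v ^+ 2 @[j --> \oo] --> l v ^+ 2 by apply: rcvgX; exact: lP.
  exact (rcvg_le_cst c2 (fun j => ipC (sub j) _ v2)).
have Ds v : D v -> sqint mu v by case.
(* The sequence lies in [D], so its pairing with [v] only sees the projection
   of [v] on the closure of [D], where bounded pairings still converge. *)
have Dall v : sqint mu v -> D v.
  move=> v2; split => //.
  have [|||q [q2 qP [eta etaD qlim]]] := riesz (D := D) (l := fun f => J (fun x => v x * f x)) (C := N2 v) (J_sqr_ge0 mu v) Ds D0 DD DZ.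
  - by move=> f g [f2 _] [g2 _]; rewrite -JD; [apply: J_eq => x; ring|exact: sqint_mul|exact: sqint_mul].
  - by move=> c f [f2 _]; rewrite -JZ; [apply: J_eq => x; ring|exact: sqint_mul].
  - by move=> f [f2 _]; exact: cauchy_schwarz.
  have ipq k : ip k v = ip k q.
    rewrite /ip -(J_eq mu (f := fun x => v x * u_ k x)); last by move=> x; ring.
    by rewrite -qP; [apply: J_eq => x; ring|exact: Du].
  rewrite (_ : (fun j => _) = fun j => ip (sub j) q); last by apply/funext => j.
  apply/cauchy_cvgP/cauchy_exP => e e0.
  have : C * N2 (fun x => eta m x - q x) @[m --> \oo] --> C * 0 by exact (rcvgZ C qlim).
  rewrite mulr0 => /cvgrPdist_lt/(_ ((e / 2) ^+ 2)) [|m _ /(_ m (leqnn m)) /= Hm].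
    by rewrite exprn_gt0// divr_gt0.
  exists (l (eta m)); have /cvgrPdist_lt/(_ (e / 2)) Hl := lP _ (etaD m).
  have [|N _ NP] := Hl; first by rewrite divr_gt0.
  exists N => // j /NP /= Hj; rewrite /ball/=.
  rewrite (_ : l (eta m) - ip (sub j) q = l (eta m) - ip (sub j) (eta m) + (ip (sub j) (eta m) - ip (sub j) q)); last by ring.
  rewrite (le_lt_trans (ler_normD _ _))// [ltRHS]splitr ltrD//.
  apply: norm_lt_sqr; first by rewrite divr_gt0.
  have e2 := Ds _ (etaD m).
  rewrite (_ : ip (sub j) (eta m) - ip (sub j) q = ip (sub j) (fun x => eta m x - q x)); last first.
    by rewrite /ip -JB; [apply: J_eq => x; ring|exact: sqint_mul|exact: sqint_mul].
  apply: le_lt_trans (ipC _ _ (sqintB e2 q2)) _.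
  by move: Hm; rewrite sub0r normrN; apply: le_lt_trans; exact: ler_norm.
have [p [p2 pP _]] := riesz C0 Ds D0 DD DZ lD lZ lC.
exists p; split => // v v2; rewrite pP; last exact: Dall.
exact: lP (Dall _ v2).
Unshelve. all: by end_near.
Qed.

End weak_convergence.

Lemma weakly_cvg_sub0 (R : realType) d (T : measurableType d) (mu : {measure set T -> \bar R})
    (u_ : nat -> T -> R) u : (forall k, sqint mu (u_ k)) -> sqint mu u -> weakly_cvg mu u_ u ->
  weakly_cvg mu (fun k x => u_ k x - u x) (fun=> 0).
Proof.
move=> u_2 u2 cu v v2.
pose proof (rcvgB (cu v v2) (rcvg_cst (\int[mu]_x (u x * v x)))) as H; move: H.
rewrite subrr (J_eq mu (f := fun x => 0 * v x) (g := fun=> 0)); last by move=> x; rewrite mul0r.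
rewrite J0; apply: rcvg_eq => k; rewrite (J_eq mu (f := fun x => (u_ k x - u x) * v x)
  (g := fun x => u_ k x * v x - u x * v x)); last by move=> x; ring.
by rewrite JB//; exact: sqint_mul.
Qed.

(** * Weak gradients *)

Section sobolev_theory.
Context (R : realType) (n : nat).
Notation Rn := 'rV[R]_n.
Notation mu := (lebesgue_rV R n).
Notation J f := (Rintegral mu setT f).
Notation N2 u := (\int[mu]_x (u x ^+ 2)).
Implicit Types (u v w eta : Rn -> R) (g h : 'I_n -> Rn -> R) (x y : Rn).

Lemma test_functionD f1 f2 : test_function f1 -> test_function f2 -> test_function (fun x : Rn => f1 x + f2 x : R).
Proof.
move=> tf tg; have [r [r0 fr]] := test_function_support tf.
have [s [s0 gs]] := test_function_support tg.
apply: (@test_function_cube _ _ _ (Num.max r s)); first by apply: smoothD; [case: tf|case: tg].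
move=> x xrs; rewrite fr ?gs ?addr0// => /cubeP H; apply: xrs; apply/cubeP => i;
  by rewrite le_max H ?orbT.
Qed.

Lemma test_functionZ c u : test_function u -> test_function (fun x : Rn => c * u x).
Proof. by move=> tu; apply: (test_functionM (chi := fun=> c)) => //; exact: smooth_cst. Qed.

Lemma test_function0 : test_function (fun _ : Rn => 0 : R).
Proof. by apply: (@test_function_cube _ _ _ 1) => //; exact: smooth_cst. Qed.

(** The projection of [v] on the closure of the test functions has the same
  pairings with test functions as [v]. *)
Lemma test_function_dense v : sqint mu v -> exists2 eta : nat -> Rn -> R,
  forall k, test_function (eta k) & N2 (fun x => eta k x - v x) @[k --> \oo] --> 0.
Proof.
move=> v2.
have [||||||f tf|p [p2 orth [eta te cp]]] := @riesz _ _ _ mu [set f | test_function f] (fun f => J (fun x => v x * f x)) (N2 v) (J_sqr_ge0 mu v).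
- by move=> f; exact: test_function_sqint.
- exact: test_function0.
- by move=> f1 f2; exact: test_functionD.
- by move=> c f; exact: test_functionZ.
- move=> f1 f2 t1 t2 /=; have s1 := test_function_sqint t1; have s2 := test_function_sqint t2.
  by rewrite -JD; [apply: J_eq => x; ring|exact: sqint_mul|exact: sqint_mul].
- move=> c f tf /=; have f2 := test_function_sqint tf.
  by rewrite -JZ; [apply: J_eq => x; ring|exact: sqint_mul].
- by apply: cauchy_schwarz => //; exact: test_function_sqint.
exists eta => //.
have pv : p = v %[ae mu].
  have : (fun x => p x - v x) = cst 0 %[ae mu].
    apply: orth_test_function_eq0; first exact: sqintB.
    move=> f tf; have f2 := test_function_sqint tf.
    transitivity (J (fun x => p x * f x) - J (fun x => v x * f x)).
      by rewrite -JB; [apply: J_eq => x; ring|exact: sqint_mul|exact: sqint_mul].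
    by rewrite orth// subrr.
  by apply: filterS => x /= H xT; apply/eqP; rewrite -subr_eq0 H.
move: cp; apply: cvg_trans; apply: near_eq_cvg; apply: nearW => k.
have e2 := test_function_sqint (te k); apply: J_ae.
- by have [m' _] := sqintB e2 p2; apply: measurable_funX m'.
- by have [m' _] := sqintB e2 v2; apply: measurable_funX m'.
- by apply: filterS pv => x /= H xT; rewrite H.
Qed.

(** The gradient is an argument, in order to compute with whichever
  representative a construction provides. *)
Definition weak_gradient u g := sqint mu u /\ forall i, sqint mu (g i) /\
  forall eta, test_function eta -> J (fun x => u x * pderiv i eta x) = - J (fun x => g i x * eta x).

Lemma is_weak_pderivP i u (d : Rn -> R) : is_weak_pderiv i u d <-> sqint mu d /\
  forall eta, test_function eta -> J (fun x => u x * pderiv i eta x) = - J (fun x => d x * eta x).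
Proof. by split=> -[] H1 H2; split => //; apply/sqintP. Qed.

Lemma weak_gradient_weak_pderiv u : H1 u -> weak_gradient u (fun i => weak_pderiv i u).
Proof.
move=> [/sqintP u2 du]; split => // i; apply/is_weak_pderivP.
by have [d dP] := du i; exact: (@getI _ [set d | is_weak_pderiv i u d] d dP).
Qed.

Lemma weak_gradient_H1 u g : weak_gradient u g -> H1 u.
Proof.
by move=> [u2 ug]; split; [exact/sqintP|move=> i; exists (g i); exact/is_weak_pderivP].
Qed.

Lemma weak_gradient_unique u g h : weak_gradient u g -> weak_gradient u h ->
  forall i, g i = h i %[ae mu].
Proof.
move=> [u2 ug] [_ uh] i; have [g2 gP] := ug i; have [h2 hP] := uh i.
suff : (fun x => g i x - h i x) = cst 0 %[ae mu].
  by apply: filterS => x /= H xT; apply/eqP; rewrite -subr_eq0 H.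
apply: orth_test_function_eq0; first exact: sqintB.
move=> eta te; have e2 := test_function_sqint te.
transitivity (J (fun x => g i x * eta x) - J (fun x => h i x * eta x)).
  by rewrite -JB; [apply: J_eq => x; ring|exact: sqint_mul|exact: sqint_mul].
by apply/eqP; rewrite subr_eq0 -eqr_opp -gP// -hP.
Qed.

Lemma weak_gradient_ae u v g : measurable_fun [set: Rn] v -> u = v %[ae mu] ->
  weak_gradient u g -> weak_gradient v g.
Proof.
move=> mv uv [u2 ug]; have v2 := sqint_ae mv uv u2; split => // i; have [g2 gP] := ug i.
split => // eta te; rewrite -gP//; have me := test_function_measurable (test_function_pderiv i te).
apply: J_ae; [exact: measurable_funM|by apply: measurable_funM => //; case: u2|].
by apply: filterS uv => x /= H xT; rewrite H.
Qed.

Lemma weak_gradientD u v g h : weak_gradient u g -> weak_gradient v h ->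
  weak_gradient (fun x => u x + v x) (fun i x => g i x + h i x).
Proof.
move=> [u2 ug] [v2 vh]; split; first exact: sqintD.
move=> i; have [g2 gP] := ug i; have [h2 hP] := vh i; split; first exact: sqintD.
move=> eta te; have e2 := test_function_sqint te.
have d2 := test_function_sqint (test_function_pderiv i te).
transitivity (J (fun x => u x * pderiv i eta x) + J (fun x => v x * pderiv i eta x)).
  by rewrite -JD; [apply: J_eq => x; ring|exact: sqint_mul|exact: sqint_mul].
rewrite gP// hP// -opprD -JD; [|exact: sqint_mul|exact: sqint_mul].
by congr (- _); apply: J_eq => x; ring.
Qed.

Lemma weak_gradientZ c u g : weak_gradient u g ->
  weak_gradient (fun x => c * u x) (fun i x => c * g i x).
Proof.
move=> [u2 ug]; split; first exact: sqintZ.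
move=> i; have [g2 gP] := ug i; split; first exact: sqintZ.
move=> eta te; have e2 := test_function_sqint te.
have d2 := test_function_sqint (test_function_pderiv i te).
transitivity (c * J (fun x => u x * pderiv i eta x)).
  by rewrite -JZ; [apply: J_eq => x; ring|exact: sqint_mul].
rewrite gP// mulrN -JZ; [|exact: sqint_mul].
by congr (- _); apply: J_eq => x; ring.
Qed.

Lemma weak_gradientB u v g h : weak_gradient u g -> weak_gradient v h ->
  weak_gradient (fun x => u x - v x) (fun i x => g i x - h i x).
Proof.
move=> ug vh; have := weak_gradientD ug (weak_gradientZ (-1) vh).
congr weak_gradient; first by apply/funext => x; ring.
by apply/funext => i; apply/funext => x; ring.
Qed.

Lemma sqint_affine (l : R) y u : l != 0 -> sqint mu u -> sqint mu (fun x => u (l *: x + y)).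
Proof.
move=> l0 [mu_ u2]; split; first exact: measurable_affine_comp.
exact: (intg_affine y l0 u2).
Qed.

Lemma weak_gradient_affine (l : R) y u g : l != 0 -> weak_gradient u g ->
  weak_gradient (fun x => u (l *: x + y)) (fun i x => l * g i (l *: x + y)).
Proof.
move=> l0 [u2 ug]; split; first exact: sqint_affine.
move=> i; have [g2 gP] := ug i; split; first by apply: sqintZ; exact: sqint_affine.
move=> eta te; pose z x := eta (l^-1 *: x + (- (l^-1) *: y)).
have tz : test_function z by apply: test_function_affine => //; rewrite invr_neq0.
have ze : eta = fun x => z (l *: x + y).
  by apply/funext => x; rewrite /z scalerDr scalerA mulVf// scale1r scaleNr addrK.
have e2 := test_function_sqint tz.
have d2 := test_function_sqint (test_function_pderiv i tz).
rewrite ze (pderiv_affine i l y (proj1 tz)).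
transitivity (J (fun x => (fun x => l * (u x * pderiv i z x)) (l *: x + y))).
  by apply: J_eq => x; ring.
have i1 : mu.-integrable setT (EFin \o (fun x => l * (u x * pderiv i z x))).
  by apply: intgZ; exact: sqint_mul.
have i2 : mu.-integrable setT (EFin \o (fun x => l * (g i x * z x))).
  by apply: intgZ; exact: sqint_mul.
rewrite (J_affine y l0 i1) JZ; last exact: sqint_mul.
rewrite gP// mulrN -JZ; last exact: sqint_mul.
rewrite mulrN -(J_affine y l0 i2); congr (- _); apply: J_eq => x; ring.
Qed.

Lemma weak_gradient_translate y u g : weak_gradient u g ->
  weak_gradient (fun x => u (x + y)) (fun i x => g i (x + y)).
Proof.
move=> /(weak_gradient_affine y (oner_neq0 R)); congr weak_gradient.
  by apply/funext => x; rewrite scale1r.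
by apply/funext => i; apply/funext => x; rewrite scale1r mul1r.
Qed.

Lemma sqint_bounded_mul (chi u : Rn -> R) M : measurable_fun [set: Rn] chi ->
  (forall x, `|chi x| <= M) -> sqint mu u -> sqint mu (fun x => chi x * u x).
Proof.
move=> mc cM u2; have [mu_ _] := u2; apply: (sqint_le _ _ (sqintZ M u2)).
  exact: measurable_funM.
by move=> x; rewrite !normrM ler_wpM2r// (le_trans (cM x))// ler_norm.
Qed.

Lemma weak_gradient_cutoff (chi : Rn -> R) M u g : smooth chi -> (forall x, `|chi x| <= M) ->
  (forall i x, `|pderiv i chi x| <= M) -> weak_gradient u g ->
  weak_gradient (fun x => chi x * u x) (fun i x => chi x * g i x + pderiv i chi x * u x).
Proof.
move=> sc cM dM [u2 ug]; have mc := smooth_measurable sc.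
split; first exact: (sqint_bounded_mul mc cM).
move=> i; have [g2 gP] := ug i; have md := smooth_measurable (smooth_pderiv i sc).
have cg := sqint_bounded_mul mc cM g2; have du := sqint_bounded_mul md (dM i) u2.
split; first exact: sqintD.
move=> eta te; have tce := test_functionM sc te.
have e2 := test_function_sqint te; have ce2 := test_function_sqint tce.
have d2 := test_function_sqint (test_function_pderiv i tce).
have := gP _ tce; rewrite (pderivM i sc (proj1 te)).
transitivity (J (fun x => u x * pderiv i (fun x => chi x * eta x) x) - J (fun x => pderiv i chi x * u x * eta x)).
  rewrite -JB; [|exact: sqint_mul|exact: sqint_mul].
  by rewrite (pderivM i sc (proj1 te)); apply: J_eq => x; ring.
rewrite gP// -opprD -JD; [|exact: sqint_mul|exact: sqint_mul].
by congr (- _); apply: J_eq => x; ring.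
Qed.

Lemma is_derive_backwards i f y t : smooth f -> is_derive t (1 : R)
  (fun h : R => f (y - h *: delta_mx 0 i) : R^o) (- pderiv i f (y - t *: delta_mx 0 i)).
Proof.
move=> sf; set v := delta_mx 0 i; pose F (h : R) := f (h *: v + (y - t *: v)) : R^o.
have dF : is_derive (t - t) (1 : R) F (pderiv i f (y - t *: v)).
  rewrite subrr; apply: DeriveDef.
    by apply: (derivable1P (f : Rn -> R^o) (y - t *: v) v).1; exact: smooth_derivable.
  by rewrite /pderiv derive_line derive1E.
have H := @is_derive1_comp _ F (cst t - id : R -> R) t (pderiv i f (y - t *: v)) (0 - 1) dF (is_deriveB (is_derive_cst t t 1) (is_derive_id t 1)).
rewrite (_ : (fun h : R => _) = F \o (cst t - id)); last first.
  by apply/funext => h; rewrite /F /= fctE /=; congr f; rewrite scalerBl; apply/rowP => j; rewrite !mxE; ring.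
by move: H; rewrite sub0r mulrN1 fctE.
Qed.

(** The pairing of [u (x + t e_i)] with a fixed test function has derivative
  the pairing of the translate of [g i], so the mean value theorem applies. *)
Lemma translation_pairing i (t : R) u g eta : 0 <= t -> weak_gradient u g -> test_function eta ->
  J (fun x => (u (x + t *: delta_mx 0 i) - u x) * eta x) ^+ 2 <= t ^+ 2 * N2 (g i) * N2 eta.
Proof.
move=> t0 [u2 ug] te; have [g2 gP] := ug i; set e := delta_mx 0 i.
have teta s : test_function (fun x => eta (x - s *: e)).
  have := test_function_affine (- (s *: e)) (oner_neq0 R) te.
  by congr test_function; apply/funext => x; rewrite scale1r.
have seta s := test_function_sqint (teta s).
have dE s x : pderiv i (fun x => eta (x - s *: e)) x = pderiv i eta (x - s *: e).
  have /(congr1 (@^~ x)) := pderiv_affine i 1 (- (s *: e)) (proj1 te); rewrite mul1r scale1r => <-.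
  by congr (pderiv i _ x); apply/funext => z; rewrite scale1r.
pose f (s : R) x := u x * eta (x - s *: e).
pose ph s := J (f s).
have df s x : is_derive s (1 : R) (f ^~ x) (u x * - pderiv i eta (x - s *: e)).
  have := is_derive_backwards i x s (proj1 te); rewrite -/e => Hd.
  exact: (is_deriveZ (f := fun h : R => eta (x - h *: e)) (u x)).
have [M M0 MP] := test_function_bounded (test_function_pderiv i te).
have [r [r0 rP]] := test_function_support (test_function_pderiv i te).
pose r' := r + t + 1.
pose G x := M * (`|u x| * \1_(cube (n := n) r') x).
have G0 x : 0 <= G x by rewrite !mulr_ge0// indicE.
have iG : mu.-integrable setT (EFin \o G).
  apply: intgZ; apply: sqint_mul; last exact: indic_box_sqint.
  have [mu_ u2'] := u2; split; first exact: measurableT_comp.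
  by apply: intg_eq u2' => x; rewrite real_normK// num_real.
have Gb s x : s \in `](-1), (t + 1)[ -> `|u x * - pderiv i eta (x - s *: e)| <= G x.
  rewrite in_itv/= => /andP[s1 s2]; rewrite normrM normrN mulrC /G.
  have [xr|/cubeP xr] := pselect (cube r' x).
    by rewrite indicE mem_set// mulr1 ler_wpM2r.
  rewrite rP ?normr0 ?mul0r//; first by rewrite !mulr_ge0// indicE.
  move=> /cubeP H; apply: xr => j; rewrite -(subrK (s *: e) x) mxE.
  have h1 := H j; have h2 : `|(s *: e) 0 j| <= t + 1.
    rewrite !mxE normrM (@le_trans _ _ (`|s| * 1))//; last by rewrite mulr1 ler_norml; lra.
    by rewrite ler_wpM2l// eqxx /=; case: (_ == _); rewrite ?normr1 ?normr0.
  by apply: le_trans (ler_normD _ _) _; rewrite /r' -addrA; apply: lerD.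
have it s : mu.-integrable setT (EFin \o f s) by exact: sqint_mul.
have pf1 s x : partial1of2 f s x = u x * - pderiv i eta (x - s *: e).
  by rewrite partial1of2E; apply: derive_val; exact: df.
have dph (s : R) : s \in `](-1), (t + 1)[ -> is_derive s (1 : R) (ph : R -> R^o) (J (fun x => g i x * eta (x - s *: e))).
  move=> sI.
  have A1 : forall z : R, `](-1), (t + 1)[%classic z -> mu.-integrable setT (EFin \o f z) by [].
  have A2 : forall (z : R) x, `](-1), (t + 1)[%classic z -> setT x -> derivable (f ^~ x) z 1.
    by move=> z x _ _; have [] := df z x.
  have A3 : forall (z : R) x, `](-1), (t + 1)[%classic z -> setT x -> `|partial1of2 f z x| <= G x.
    by move=> z x zI _; rewrite pf1; exact: Gb.
  apply: DeriveDef; first exact: (derivable_under_integral measurableT sI A1 A2 G0 iG A3).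
  rewrite -derive1E (differentiation_under_integral measurableT sI A1 A2 G0 iG A3).
  transitivity (J (fun x => - (u x * pderiv i (fun x => eta (x - s *: e)) x))).
    by apply: J_eq => x; rewrite pf1 dE mulrN.
  rewrite JN; last by apply: sqint_mul => //; exact: test_function_sqint (test_function_pderiv i (teta s)).
  by rewrite gP ?opprK.
have sub01 (s : R) : s \in `[0, t] -> s \in `](-1), (t + 1)[.
  by rewrite !in_itv/= => /andP[? ?]; apply/andP; split; lra.
have M1 (s : R) : s \in `]0, t[ -> is_derive s (1 : R) (ph : R -> R^o) (J (fun x => g i x * eta (x - s *: e))).
  by move=> st; apply: dph; apply: sub01; apply: subset_itv_oo_cc st.
have M2 : {within `[0, t], continuous ph}.
  by apply: derivable_within_continuous => s st; have [] := dph s (sub01 s st).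
have [c ct E] := MVT_segment t0 M1 M2.
rewrite subr0 in E.
rewrite (_ : J _ = ph t - ph 0); last first.
  rewrite /ph /f -(J_translate (t *: e) (it t)) -JB; last first.
  - exact: it.
  - exact: intg_translate (it t).
  by apply: J_eq => x; rewrite /f addrK scale0r subr0; ring.
rewrite E exprMn mulrC -mulrA ler_wpM2l ?sqr_ge0//.
apply: le_trans (cauchy_schwarz g2 (seta c)) _.
rewrite -[X in _ <= _ * X](J_translate (- (c *: e)))//.
by have [] := test_function_sqint te.
Qed.

Lemma sqint_translate y u : sqint mu u -> sqint mu (fun x => u (x + y)).
Proof.
by move=> u2; have := sqint_affine y (oner_neq0 R) u2; congr sqint; apply/funext => x; rewrite scale1r.
Qed.

Lemma N2_translate y u : sqint mu u -> N2 (fun x => u (x + y)) = N2 u.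
Proof. by move=> [_ u2]; rewrite -[RHS](J_translate y u2). Qed.

(** The difference is its own best dual element: the bound on its pairings is
  applied to test functions approximating it. *)
Lemma translation_coord i (t : R) u g : weak_gradient u g ->
  N2 (fun x => u (x + t *: delta_mx 0 i) - u x) <= t ^+ 2 * N2 (g i).
Proof.
wlog t0 : t / 0 <= t => [H|] ug.
  have [|t0] := leP 0 t; first by move=> t0; exact: H.
  have := H (- t) _ ug; rewrite sqrrN oppr_ge0 => /(_ (ltW t0)); apply: le_trans.
  have u2 := ug.1; rewrite le_eqVlt; apply/orP; left; apply/eqP.
  have s2 := sqintB (sqint_translate (t *: delta_mx 0 i) u2) u2.
  rewrite -(N2_translate (- t *: delta_mx 0 i) s2); apply: J_eq => x.
  by rewrite scaleNr subrK -[LHS]sqrrN opprB.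
have u2 := ug.1; have s2 := sqintB (sqint_translate (t *: delta_mx 0 i) u2) u2.
have [eta te ce] := test_function_dense s2.
have e2 k := test_function_sqint (te k).
set D := fun x => u (x + _) - u x in s2 ce *.
have c1 : J (fun x => eta k x * D x) ^+ 2 @[k --> \oo] --> J (fun x => D x * D x) ^+ 2.
  by apply: rcvgX; exact: ip_cvg.
pose proof (rcvgZ (t ^+ 2 * N2 (g i)) (J_sqr_cvg e2 s2 ce)) as c2.
have {c1 c2} : N2 D ^+ 2 <= t ^+ 2 * N2 (g i) * N2 D.
  rewrite (_ : N2 D = J (fun x => D x * D x)) in c2 *; last by apply: J_eq => x.
  refine (rcvg_le c1 c2 _) => k; rewrite (_ : J _ = J (fun x => D x * eta k x)); last by apply: J_eq => x; ring.
  exact: translation_pairing.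
have := J_sqr_ge0 mu D; rewrite le_eqVlt => /orP[/eqP <- _|D0].
  by rewrite mulr_ge0// ?sqr_ge0// J_sqr_ge0.
by rewrite expr2 ler_pM2r.
Qed.

(** The translation is carried out one coordinate at a time, and the
  inequality [(a + b) ^ 2 <= 2 a ^ 2 + 2 b ^ 2] costs a factor two at each
  step. *)
Lemma translation_bound u g y : weak_gradient u g ->
  N2 (fun x => u (x + y) - u x) <= 2 ^+ n * \sum_i (y 0 i ^+ 2 * N2 (g i)).
Proof.
move=> ug; have u2 := ug.1.
have K (s : seq 'I_n) : N2 (fun x => u (x + \sum_(i <- s) y 0 i *: delta_mx 0 i) - u x) <=
    2 ^+ size s * \sum_(i <- s) (y 0 i ^+ 2 * N2 (g i)).
  elim: s => [|i s IH].
    rewrite !big_nil mulr0 (_ : (fun x => _) = fun=> 0) ?J0//.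
    by apply/funext => x; rewrite addr0 subrr expr0n.
  rewrite !big_cons /= exprS -mulrA mulrDr.
  set a := y 0 i *: _; set h := \sum_(j <- s) _ in IH *.
  have s1 := sqintB (sqint_translate h u2) u2.
  have s2 := sqintB (sqint_translate a u2) u2.
  rewrite (_ : (fun x => _) = fun x => (((fun z => u (z + h) - u z) (x + a)) + (u (x + a) - u x)) ^+ 2); last first.
    by apply/funext => x /=; rewrite (addrA x a h); ring.
  apply: le_trans (J_sqrD_le (sqint_translate a s1) s2) _.
  rewrite (N2_translate a s1); have := translation_coord i (y 0 i) ug; rewrite -/a => H.
  rewrite mulrDr addrC; apply: lerD; last by rewrite ler_wpM2l.
  rewrite ler_wpM2l//; apply: le_trans H _; rewrite ler_peMl ?exprn_ege1// ?ler1n//.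
  by rewrite mulr_ge0 ?sqr_ge0 ?J_sqr_ge0.
have := K (index_enum 'I_n); rewrite {2}/index_enum -enumT size_enum_ord.
by rewrite -row_sum_delta.
Qed.

(** Test functions are dense, and boundedness makes the error of the
  approximation uniform along the sequence. *)
Lemma weakly_cvg_test (w_ : nat -> Rn -> R) w C : (forall k, sqint mu (w_ k)) -> sqint mu w ->
  (forall k, N2 (w_ k) <= C) ->
  (forall eta, test_function eta -> J (fun x => w_ k x * eta x) @[k --> \oo] --> J (fun x => w x * eta x)) ->
  weakly_cvg mu w_ w.
Proof.
move=> w_2 w2 wC H v v2; pose B := 2 * C + 2 * N2 w.
have B0 : 0 <= B by rewrite addr_ge0 ?mulr_ge0 ?J_sqr_ge0// (le_trans _ (wC 0%N))// J_sqr_ge0.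
have [eta te ce] := test_function_dense v2.
apply/cvgrPdist_lt => e e0.
have : B * N2 (fun x => eta m x - v x) @[m --> \oo] --> B * 0 by exact (rcvgZ B ce).
rewrite mulr0 => /cvgrPdist_lt/(_ ((e / 2) ^+ 2)) [|m _ /(_ m (leqnn m)) /= Hm].
  by rewrite exprn_gt0// divr_gt0.
have e2 := test_function_sqint (te m).
have [|N _ NP] := (cvgrPdist_lt _ _).1 (H _ (te m)) (e / 2); first by rewrite divr_gt0.
exists N => // k /NP /= Hk.
have d2 := sqintB e2 v2; have w2' := sqintB (w_2 k) w2.
have -> : J (fun x => w x * v x) - J (fun x => w_ k x * v x) =
  J (fun x => w x * eta m x) - J (fun x => w_ k x * eta m x) +
  J (fun x => (w_ k x - w x) * (eta m x - v x)).
  rewrite -!JB -?JD; try (by exact: sqint_mul); try (by apply: intgB; exact: sqint_mul).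
  by apply: J_eq => x; ring.
rewrite (le_lt_trans (ler_normD _ _))// [ltRHS]splitr ltrD//.
apply: norm_lt_sqr; first by rewrite divr_gt0.
apply: le_lt_trans (cauchy_schwarz w2' d2) _.
move: Hm; rewrite sub0r normrN; apply: le_lt_trans; apply: le_trans (ler_norm _).
rewrite ler_wpM2r ?J_sqr_ge0//; apply: le_trans (J_sqrB_le (w_2 k) w2) _.
by rewrite lerD2r ler_wpM2l.
Qed.

(** Integration by parts makes the pairings of the gradients with test
  functions converge; the limit is bounded, so Riesz represents it by the
  gradient of [u]. *)
Lemma weakly_cvg_gradient (u_ : nat -> Rn -> R) (g_ : nat -> 'I_n -> Rn -> R) u C :
  (forall k, weak_gradient (u_ k) (g_ k)) -> (forall k i, N2 (g_ k i) <= C) -> sqint mu u ->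
  weakly_cvg mu u_ u -> exists g, weak_gradient u g /\ forall i, weakly_cvg mu (g_ ^~ i) (g i).
Proof.
move=> ug gC u2 cu.
have C0 (i : 'I_n) : 0 <= C by rewrite (le_trans _ (gC 0%N i))// J_sqr_ge0.
have td2 i f : test_function f -> sqint mu (pderiv i f).
  by move=> tf; apply: test_function_sqint; exact: test_function_pderiv.
have cg i f : test_function f -> J (fun x => g_ k i x * f x) @[k --> \oo] --> - J (fun x => u x * pderiv i f x).
  move=> tf; rewrite (_ : (fun k => _) = fun k => - J (fun x => u_ k x * pderiv i f x)).
    by apply: cvgN; apply: cu; exact: td2.
  by apply/funext => k; have [_ /(_ i)[_ ->//]] := ug k; rewrite opprK.
have H i : exists p, sqint mu p /\ forall eta, test_function eta ->
    J (fun x => p x * eta x) = - J (fun x => u x * pderiv i eta x).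
  have [|||||||p [p2 pP _]] := @riesz _ _ _ mu [set f | test_function f] (fun f => - J (fun x => u x * pderiv i f x)) C (C0 i).
  - by move=> f; exact: test_function_sqint.
  - exact: test_function0.
  - by move=> f1 f2; exact: test_functionD.
  - by move=> c f; exact: test_functionZ.
  - move=> f1 f2 t1 t2 /=; have s1 := td2 i _ t1; have s2 := td2 i _ t2.
    rewrite (pderivD i (proj1 t1) (proj1 t2)) -opprD -JD; [|exact: sqint_mul|exact: sqint_mul].
    by congr (- _); apply: J_eq => x; ring.
  - move=> c f tf /=; have f2 := td2 i _ tf.
    rewrite (pderivZ i c (proj1 tf)) mulrN -JZ; last exact: sqint_mul.
    by congr (- _); apply: J_eq => x; ring.
  - move=> f tf; have f2 := test_function_sqint tf.
    have c2 : J (fun x => g_ k i x * f x) ^+ 2 @[k --> \oo] --> (- J (fun x => u x * pderiv i f x)) ^+ 2.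
      by apply: rcvgX; exact: cg.
    apply: (rcvg_le_cst c2) => k; have gk := ((ug k).2 i).1.
    by apply: le_trans (cauchy_schwarz gk f2) _; rewrite ler_wpM2r// J_sqr_ge0.
  by exists p.
have [g gP] := choice H; exists g; split.
  split => // i; have [g2 gp] := gP i; split => // eta te; by rewrite gp// opprK.
move=> i; have [g2 gp] := gP i; apply: weakly_cvg_test => //.
- by move=> k; exact: ((ug k).2 i).1.
- by move=> eta te; rewrite gp//; exact: cg.
Qed.

End sobolev_theory.

(** * Local compactness *)

Section local_compactness.
Context (R : realType) (n : nat).
Notation Rn := 'rV[R]_n.
Notation mu := (lebesgue_rV R n).
Notation J f := (Rintegral mu setT f).
Notation N2 u := (\int[mu]_x (u x ^+ 2)).
Implicit Types (d C : R) (u w chi : Rn -> R) (x h : Rn).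

Let vol d := J (\1_(cube (n := n) d)).

Lemma indic_cube_gt0 d : 0 < d -> 0 < J (\1_(cube (n := n) d)).
Proof.
move=> d0; have H := @lebesgue_rV_box R n (const_mx (- d)) (const_mx d).
rewrite /Rintegral integral_indic//; last exact: measurable_cube.
rewrite setIT H; last by move=> i; rewrite !mxE ge0_cp// ltW.
by rewrite /= prodr_gt0// => i _; rewrite !mxE opprK addr_gt0.
Qed.

Let vol_gt0 d : 0 < d -> 0 < vol d.
Proof. exact: indic_cube_gt0. Qed.

Let cube_sqint d : sqint mu (\1_(cube (n := n) d) : Rn -> R).
Proof. exact: indic_box_sqint. Qed.

Let N2_cube d : N2 (\1_(cube (n := n) d)) = vol d.
Proof. by apply: J_eq => x; rewrite indicE; case: (_ \in _); rewrite ?expr1n ?expr0n. Qed.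

Let measurable_shift u : measurable_fun [set: Rn] u ->
  measurable_fun [set: Rn * Rn] (fun z => u (z.1 + z.2)).
Proof.
move=> m_; apply: (measurableT_comp m_).
have := measurable_row_affine 1 (@measurable_fst _ _ Rn Rn) (@measurable_snd _ _ Rn Rn).
by congr measurable_fun; apply/funext => z; rewrite scale1r.
Qed.

Let shift_sqint u x : sqint mu u -> sqint mu (fun h => u (x + h)).
Proof.
by move=> u2; have := sqint_translate x u2; congr sqint; apply/funext => h; rewrite addrC.
Qed.

Let N2_shift u x : sqint mu u -> N2 (fun h => u (x + h)) = N2 u.
Proof. by move=> u2; rewrite -(N2_translate x u2); apply: J_eq => h; rewrite addrC. Qed.

Let average d u x := (vol d)^-1 * J (fun h => u (x + h) * \1_(cube d) h).

Let average_bounded d u x : 0 < d -> sqint mu u -> average d u x ^+ 2 <= (vol d)^-1 * N2 u.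
Proof.
move=> d0 u2; have v0 := vol_gt0 d0; have := cauchy_schwarz (shift_sqint x u2) (cube_sqint d).
rewrite N2_shift// N2_cube /average exprMn => H.
rewrite (le_trans (ler_wpM2l _ H)) ?sqr_ge0// expr2 -mulrA (mulrA _ (N2 u)) (mulrC _ (N2 u)) -mulrA.
by rewrite mulVf ?gt_eqF// mulr1 mulrC.
Qed.

Let shift_measurable u : sqint mu u -> forall d,
  measurable_fun [set: Rn * Rn] (fun z => u (z.1 + z.2) * \1_(cube (n := n) d) z.2).
Proof.
move=> u2 d; apply: measurable_funM; first exact: measurable_shift u2.1.
exact: measurableT_comp (cube_sqint d).1 measurable_snd.
Qed.

Let average_sqint d u chi : 0 < d -> sqint mu u -> sqint mu chi ->
  sqint mu (fun x => chi x * average d u x).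
Proof.
move=> d0 u2 c2; pose K z := chi z.1 * (u (z.1 + z.2) * \1_(cube (n := n) d) z.2).
have v0 := vol_gt0 d0.
have mK : measurable_fun [set: Rn * Rn] K.
  apply: measurable_funM; first exact: measurableT_comp c2.1 measurable_fst.
  exact: shift_measurable.
have s := lebesgue_rV_sigma_finite R n.
pose B := N2 chi + N2 u.
have KE h : (fun x => K (x, h)) = fun x => \1_(cube d) h * (chi x * u (x + h)).
  by apply/funext => x; rewrite /K /=; ring.
have i1 h := sqint_mul c2 (sqint_translate h u2).
have Ki h : mu.-integrable setT (EFin \o (fun x => K (x, h))) by rewrite KE; apply: intgZ; exact: i1.
have KB h : J (fun x => `|K (x, h)|) <= B * \1_(cube d) h.
  have -> : (fun x => `|K (x, h)|) = fun x => \1_(cube d) h * `|chi x * u (x + h)|.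
    by apply/funext => x; rewrite (congr1 (@^~ x) (KE h)) normrM ger0_norm// indicE.
  rewrite JZ; last exact: intg_norm (i1 h).
  rewrite mulrC ler_wpM2r ?indicE//.
  rewrite /B -(N2_translate h u2) -JD; [|by case: c2|by case: (sqint_translate h u2)].
  apply: J_le; first exact: intg_norm (i1 h).
    by apply: intgD; [case: c2|case: (sqint_translate h u2)].
  move=> x; rewrite ler_norml; have := sqr_ge0 (chi x - u (x + h)); have := sqr_ge0 (chi x + u (x + h)).
  have := sqr_ge0 (chi x); have := sqr_ge0 (u (x + h)).
  by move: (chi x) (u _) => a b; rewrite !expr2; move=> *; apply/andP; split; lra.
have [H _ _] := fubini_slices s s mK Ki KB (intgZ B (indic_cube_intg n d)).
have ma : measurable_fun [set: Rn] (fun x => chi x * average d u x).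
  have := measurable_funM (measurable_cst (vol d)^-1) (intg_measurable H).
  congr measurable_fun; apply/funext => x /=.
  rewrite /K /average /= JZ; first by ring.
  by apply: sqint_mul; [exact: shift_sqint|exact: cube_sqint].
pose C := (vol d)^-1 * N2 u; have C0 : 0 <= C by rewrite mulr_ge0 ?invr_ge0 ?J_sqr_ge0// ltW.
apply: (sqint_le ma _ (sqintZ (Num.sqrt C) c2)) => x.
rewrite normrM [leRHS]normrM mulrC ler_wpM2r// [leRHS]ger0_norm ?sqrtr_ge0// -[leLHS]sqrtr_sqr.
by apply: ler_wsqrtr; exact: average_bounded.
Qed.

(** Averaging over a cube of side [2 d] moves a function by at most a multiple
  of [d] times its gradient, by the translation estimate and Tonelli. *)
Let average_error d u (g : 'I_n -> Rn -> R) C : 0 < d -> weak_gradient u g -> (forall i, N2 (g i) <= C) ->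
  exists F : Rn -> R, [/\ mu.-integrable setT (EFin \o F), forall x, (u x - average d u x) ^+ 2 <= F x &
    J F <= 2 ^+ n * (n%:R * (d ^+ 2 * C))].
Proof.
move=> d0 ug gC; have u2 := ug.1; have v0 := vol_gt0 d0.
pose D x h := (u (x + h) - u x) * \1_(cube (n := n) d) h.
have D2 x : sqint mu (D x).
  have -> : D x = fun h => u (x + h) * \1_(cube d) h + (- u x) * \1_(cube d) h by apply/funext => h; rewrite /D; ring.
  apply: sqintD; last by apply: sqintZ; exact: cube_sqint.
  apply: (sqint_le _ _ (shift_sqint x u2)).
    by apply: measurable_funM; [exact: (shift_sqint x u2).1|exact: (cube_sqint d).1].
  by move=> h; rewrite indicE normrM; case: (_ \in _); rewrite ?normr1 ?normr0 ?mulr1 ?mulr0.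
pose K (z : Rn * Rn) := D z.1 z.2 ^+ 2.
have mK : measurable_fun [set: Rn * Rn] K.
  apply: measurable_funX; apply: measurable_funM.
    apply: measurable_funB; first exact: measurable_shift u2.1.
    exact: measurableT_comp u2.1 measurable_fst.
  exact: measurableT_comp (cube_sqint d).1 measurable_snd.
have s := lebesgue_rV_sigma_finite R n.
pose B := 2 ^+ n * (n%:R * (d ^+ 2 * C)).
have slice h : J (fun x => K (x, h)) <= B * \1_(cube d) h.
  rewrite /K /D /= indicE; have [hd|hd] := pselect (cube d h); last first.
    by rewrite memNset// mulr0 (_ : (fun x => _) = fun=> 0) ?J0//; apply/funext => x; rewrite mulr0 expr0n.
  rewrite mem_set// mulr1 (_ : (fun x => _) = fun x => (u (x + h) - u x) ^+ 2); last first.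
    by apply/funext => x; rewrite mulr1.
  apply: le_trans (translation_bound h ug) _; rewrite ler_wpM2l// ?exprn_ge0//.
  apply: le_trans (ler_sum _ (G := fun=> d ^+ 2 * C) _) _; last by rewrite sumr_const card_ord mulr_natl.
  move=> i _; apply: ler_pM; rewrite ?sqr_ge0 ?J_sqr_ge0//.
  by apply: sqr_le_norm; have /cubeP := hd; apply.
have islice h : mu.-integrable setT (EFin \o (fun x => K (x, h))).
  rewrite (_ : (fun x => K _) = fun x => \1_(cube d) h ^+ 2 * (u (x + h) - u x) ^+ 2); last first.
    by apply/funext => x; rewrite /K /D /=; ring.
  by apply: intgZ; case: (sqintB (sqint_translate h u2) u2).
have slice' h : J (fun x => `|K (x, h)|) <= B * \1_(cube d) h.
  rewrite (_ : (fun x => _) = fun x => K (x, h)); first exact: slice.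
  by apply/funext => x; rewrite ger0_norm// sqr_ge0.
have [H H' E] := fubini_slices s s mK islice slice' (intgZ B (indic_cube_intg n d)).
exists (fun x => (vol d)^-1 * J (fun h => K (x, h))); split.
- exact: intgZ.
- move=> x.
  have -> : u x - average d u x = - ((vol d)^-1 * J (fun h => D x h * \1_(cube d) h)).
    have -> : J (fun h => D x h * \1_(cube d) h) = J (fun h => u (x + h) * \1_(cube d) h) - u x * vol d.
      rewrite /vol -JZ -?JB.
      - by apply: J_eq => h; rewrite /D indicE; case: (_ \in _); rewrite /= ?mulr1 ?mulr0 ?subr0.
      - by apply: sqint_mul; [exact: shift_sqint|exact: cube_sqint].
      - by apply: intgZ; exact: indic_cube_intg.
      - exact: indic_cube_intg.
    by rewrite /average; field; rewrite gt_eqF.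
  have arith (a b v : R) : 0 < v -> a ^+ 2 <= b * v -> (- (v^-1 * a)) ^+ 2 <= v^-1 * b.
    move=> vp ab; rewrite sqrrN exprMn (_ : v^-1 * b = v^-1 ^+ 2 * (b * v)); last by field; rewrite gt_eqF.
    by rewrite ler_wpM2l ?sqr_ge0.
  have cs := cauchy_schwarz (D2 x) (cube_sqint d).
  by apply: (arith _ _ _ v0); rewrite -(N2_cube d); exact: cs.
have JK := JZ (vol d)^-1 H; rewrite E in JK.
rewrite [leLHS]JK (ler_pdivrMl _ _ v0) [leRHS]mulrC -/B.
have J1 := JZ B (@indic_cube_intg R n d); rewrite -[leRHS]J1.
exact: (J_le H' (intgZ B (indic_cube_intg n d)) slice).
Qed.

(** Averages at a fixed scale converge boundedly to zero, and the averaging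
  error is uniformly small with the scale. *)
Lemma local_compactness (w_ : nat -> Rn -> R) (g_ : nat -> 'I_n -> Rn -> R) C chi :
  (forall k, weak_gradient (w_ k) (g_ k)) -> (forall k, N2 (w_ k) <= C) ->
  (forall k i, N2 (g_ k i) <= C) -> weakly_cvg mu w_ (fun=> 0) ->
  sqint mu chi -> (forall x, `|chi x| <= 1) ->
  N2 (fun x => chi x * w_ k x) @[k --> \oo] --> 0.
Proof.
move=> wg wC gC w0 c2 c1; have w2 k := (wg k).1.
have C0 : 0 <= C by rewrite (le_trans _ (wC 0%N))// J_sqr_ge0.
have avg d : 0 < d -> N2 (fun x => chi x * average d (w_ k) x) @[k --> \oo] --> 0.
  move=> d0; have v0 := vol_gt0 d0.
  have [||||_] := @J_dct _ _ _ mu (fun k x => (chi x * average d (w_ k) x) ^+ 2) (fun=> 0)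
    (fun x => ((vol d)^-1 * C) * chi x ^+ 2); last by rewrite J0.
  - by move=> k; apply: measurable_funX; exact: (average_sqint d0 (w2 k) c2).1.
  - move=> x; rewrite -[X in _ --> X](mul0r (0 : R)); under eq_fun do rewrite expr2.
    have H : chi x * average d (w_ k) x @[k --> \oo] --> (0 : R).
      rewrite -[X in _ --> X](mulr0 (chi x * (vol d)^-1)).
      rewrite (_ : (fun k => _) = fun k => (chi x * (vol d)^-1) * J (fun z => w_ k z * \1_(cube d) (z - x))); last first.
        apply/funext => k; rewrite /average mulrA; congr (_ * _).
        have i1 : mu.-integrable setT (EFin \o (fun z => w_ k z * \1_(cube d) (z - x))).
          by apply: sqint_mul => //; exact: (sqint_translate (- x) (cube_sqint d)).
        by rewrite -(J_translate x i1); apply: J_eq => z; rewrite addrK addrC.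
      apply: rcvgZ; have := w0 _ (sqint_translate (- x) (cube_sqint d)).
      by rewrite (_ : J (fun x0 => 0 * _) = 0)// -[RHS](J0 mu); apply: J_eq => z; rewrite mul0r.
    exact: rcvgM.
  - move=> k x; rewrite ger0_norm ?sqr_ge0// exprMn mulrC ler_wpM2r ?sqr_ge0//.
    by apply: le_trans (average_bounded x d0 (w2 k)) _; rewrite ler_wpM2l// invr_ge0 ltW.
  - by apply: intgZ; case: c2.
apply/cvgrPdist_lt => e e0.
pose B := 2 ^+ n * (n%:R * C) + 1; have B0 : 0 < B by rewrite ltr_wpDl// !mulr_ge0// ?exprn_ge0.
(* At this scale the averaging error contributes less than [e / 2]. *)
pose d := Num.sqrt (e / (4 * B)).
have d0 : 0 < d by rewrite sqrtr_gt0 divr_gt0// mulr_gt0.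
have dB : 2 * (2 ^+ n * (n%:R * (d ^+ 2 * C))) < e / 2.
  rewrite sqr_sqrtr; last by rewrite divr_ge0 ?ltW// mulr_gt0.
  rewrite (_ : 2 * _ = (B - 1) / B * (e / 2)); last by rewrite /B; field; rewrite gt_eqF.
  by rewrite gtr_pMl ?divr_gt0// ltr_pdivrMr// mul1r ltrBlDr ltrDl.
have /cvgrPdist_lt/(_ (e / 4)) := avg d d0; case; first by rewrite divr_gt0.
move=> N _ NP; exists N => // k /NP /=; rewrite !sub0r !normrN !ger0_norm ?J_sqr_ge0// => Hk.
have [F [iF FP JF]] := average_error d0 (wg k) (gC k).
have a2 := average_sqint d0 (w2 k) c2.
apply: (@le_lt_trans _ _ (2 * J F + 2 * N2 (fun x => chi x * average d (w_ k) x))); last first.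
  have arith (a b c e' : R) : 2 * c < e' / 2 -> b < e' / 4 -> a <= c -> 2 * a + 2 * b < e' by lra.
  exact: arith dB Hk JF.
rewrite -!JZ//; last by case: a2.
rewrite -JD; [|exact: intgZ|by apply: intgZ; case: a2].
have cw := sqint_bounded_mul c2.1 c1 (w2 k).
apply: J_le; first by case: cw.
  by apply: intgD; [exact: intgZ|apply: intgZ; case: a2].
move=> x; have := FP x; have := c1 x; rewrite ler_norml => /andP[]; move: (chi x) (w_ k x) (average _ _ x) (F x) => a b c f a1 a1' H.
have a21 : a ^+ 2 <= 1 by rewrite -[a ^+ 2]real_normK ?num_real// exprn_ile1// ler_norml; apply/andP.
have H2 : a ^+ 2 * (b - c) ^+ 2 <= f by rewrite (le_trans _ H)// ler_piMl// sqr_ge0.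
have := sqr_ge0 (a * (b - c) - a * c).
by move: H2; rewrite !expr2; lra.
Qed.

End local_compactness.

(** * A summability kernel and its transform *)

Section exponential_kernel.
Context (R : realType).
Notation lam := (@lebesgue_measure R).
Implicit Types (x z t : R).

(** On the positive half line this is an antiderivative of
  [exp (- x) * (1 + cos (x z))] that vanishes at infinity. *)
Let F z x : R := expR (- x) * ((z * sin (x * z) - cos (x * z)) / (1 + z ^+ 2) - 1).

Let den z : 1 + z ^+ 2 != 0 :> R.
Proof. by rewrite gt_eqF// ltr_wpDr ?sqr_ge0. Qed.

Let dF z x : is_derive x (1 : R) (F z) (expR (- x) * (1 + cos (x * z))).
Proof.
rewrite /F; apply: is_derive_eq.
rewrite /GRing.scale /=; have := den z; move: (sin _) (cos _) (expR _) => s c e d.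
by field.
Qed.

Let F_cvg z : F z x @[x --> +oo%R] --> (0 : R).
Proof.
have bnd x : `|(z * sin (x * z) - cos (x * z)) / (1 + z ^+ 2) - 1| <= `|z| + 2.
  rewrite (le_trans (ler_normB _ _))// normr1.
  have d1 : 1 <= 1 + z ^+ 2 by rewrite lerDl sqr_ge0.
  rewrite normrM normfV [`|1 + _|]ger0_norm; last by lra.
  have -> : `|z| + 2 = (`|z| + 1) + 1 by ring.
  rewrite lerD2r ler_pdivrMr; last by lra.
  rewrite (le_trans (ler_normB _ _))// (@le_trans _ _ (`|z| + 1))//.
    by rewrite lerD ?cos_max// normrM ler_piMr// sin_max.
  by rewrite ler_peMr// addr_ge0.
have e0 : expR (- x) * (`|z| + 2) @[x --> +oo%R] --> (0 : R).
  rewrite -[X in _ --> X](mul0r (`|z| + 2)); apply: rcvgM; last exact: rcvg_cst.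
  by exact: cvgr_expR.
have e0N : - (expR (- x) * (`|z| + 2)) @[x --> +oo%R] --> (0 : R).
  by rewrite -[X in _ --> X]oppr0; exact: cvgN.
apply: (squeeze_cvgr _ e0N e0); apply: nearW => x.
by rewrite -ler_norml normrM ger0_norm ?expR_ge0// ler_wpM2l ?expR_ge0.
Qed.

(** A summability kernel whose cosine transform is the elementary positive
  function [cauchy_density]. *)
Definition exp_kernel t : R := expR (- `|t|).

Definition cauchy_density z : R := 2 / (1 + z ^+ 2).

(** Adding one to the cosine makes the integrand nonnegative, as the
  fundamental theorem of calculus on a half line requires. *)
Let hf z x := exp_kernel x * (1 + cos (x * z)).

Let hf_ge0 z x : 0 <= hf z x.
Proof. by rewrite mulr_ge0 ?expR_ge0// -lerBlDl sub0r cos_geN1. Qed.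

Lemma exp_kernel_continuous : continuous exp_kernel.
Proof.
move=> x; apply: (cvg_comp (fun x : R => - `|x|) (@expR R)); last exact: continuous_expR.
by apply: cvgN; exact: norm_continuous.
Qed.

Let hf_continuous z : continuous (hf z).
Proof.
move=> x; apply: rcvgM; first exact: exp_kernel_continuous.
apply: rcvgD; first exact: rcvg_cst.
apply: (cvg_comp (fun x : R => x * z) (@cos R)); last exact: continuous_cos.
by apply: rcvgM; [exact: cvg_id|exact: rcvg_cst].
Qed.

Let hf_integral z : (\int[lam]_x (hf z x)%:E = (2 + cauchy_density z)%:E)%E.
Proof.
rewrite (ge0_symfun_integralT (hf_ge0 z) (@hf_continuous z)); last first.
  by move=> x /=; rewrite /hf /exp_kernel normrN mulNr cosN.
rewrite (_ : [set x | _] = `[0, +oo[%classic); last first.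
  by apply/seteqP; split => x/=; rewrite in_itv/= andbT.
rewrite (_ : (\int[lam]_(x in `[0%R, +oo[) (hf z x)%:E)%E = (0%R%:E - (F z 0)%:E)%E).
  rewrite -EFinB -EFinM; congr EFin.
  rewrite /F mul0r sin0 cos0 oppr0 expR0 mulr0 /cauchy_density.
  by have := den z => d; field.
have E x : 0 <= x -> hf z x = expR (- x) * (1 + cos (x * z)).
  by move=> x0; rewrite /hf /exp_kernel ger0_norm.
apply: ge0_continuous_FTC2y.
- by move=> x _; exact: hf_ge0.
- by apply: continuous_in_subspaceT => x _; exact: hf_continuous.
- exact: F_cvg.
- by move=> x _; have [] := dF z x.
- have : continuous (F z) by move=> x; apply: differentiable_continuous; apply/derivable1_diffP; have [] := dF z x.
  by move=> /(_ 0) H; apply: cvg_at_right_filter.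
- move=> x; rewrite in_itv/= andbT => x0.
  by rewrite derive1E E ?ltW//; apply: derive_val; exact: dF.
Qed.

Lemma exp_kernel_intg : lam.-integrable setT (EFin \o exp_kernel).
Proof.
have m : measurable_fun setT exp_kernel by apply: continuous_measurable_fun; exact: exp_kernel_continuous.
apply: (@intg_le _ _ _ lam _ (hf 0)) => //.
  by move=> x; rewrite /hf mulr0 cos0 ger0_norm ?expR_ge0// ler_peMr ?expR_ge0//; lra.
apply: ge0_intg; [|exact: hf_ge0|by rewrite hf_integral ltry].
by apply: continuous_measurable_fun; exact: hf_continuous.
Qed.

Lemma exp_kernel_bounded_intg (k : R -> R) : measurable_fun setT k -> (forall x, `|k x| <= 1) ->
  lam.-integrable setT (EFin \o (fun x => exp_kernel x * k x)).
Proof.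
move=> mk k1; apply: (intg_le _ _ exp_kernel_intg).
  by apply: measurable_funM => //; exact: intg_measurable exp_kernel_intg.
by move=> x; rewrite normrM ger0_norm ?expR_ge0// ler_piMr ?expR_ge0.
Qed.

Lemma measurable_cos_scale z : measurable_fun setT (fun x : R => cos (x * z)).
Proof.
by apply: measurableT_comp; [apply: continuous_measurable_fun; exact: continuous_cos|exact: measurable_funM].
Qed.

Lemma measurable_sin_scale z : measurable_fun setT (fun x : R => sin (x * z)).
Proof.
by apply: measurableT_comp; [apply: continuous_measurable_fun; exact: continuous_sin|exact: measurable_funM].
Qed.

Lemma exp_kernel_cos z : Rintegral lam setT (fun x => exp_kernel x * cos (x * z)) = cauchy_density z.
Proof.
have H z' : Rintegral lam setT (hf z') = 2 + cauchy_density z' by rewrite /Rintegral hf_integral.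
have ic z' := exp_kernel_bounded_intg (measurable_cos_scale z') (fun x => cos_max (x * z')).
have HE z' : Rintegral lam setT exp_kernel + Rintegral lam setT (fun x => exp_kernel x * cos (x * z')) = 2 + cauchy_density z'.
  by rewrite -H -JD//; [apply: J_eq => x; rewrite /hf; ring|exact: exp_kernel_intg].
have := HE 0; rewrite (_ : Rintegral lam setT (fun x => _ * cos _) = Rintegral lam setT exp_kernel).
  have -> : cauchy_density 0 = 2 by rewrite /cauchy_density expr0n/= addr0 divr1.
  move=> H0; have := HE z; move: H0; move: (Rintegral _ _ _) (Rintegral _ _ _) (cauchy_density z) => p q r; lra.
by apply: J_eq => x; rewrite mulr0 cos0 mulr1.
Qed.

Let rV_cons0 (x : 'rV[R]_0) t : rV_cons (x, t) 0 ord0 = t.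
Proof. by rewrite mxE unlift_none. Qed.

Let J_rV0 (f : 'rV[R]_0 -> R) : Rintegral (lebesgue_rV R 0) setT f = f 0.
Proof.
rewrite /Rintegral /= integral_dirac//; last first.
  apply/measurable_EFinP; rewrite (_ : f = cst (f 0))//.
  by apply/funext => x; congr f; apply/rowP; case.
by rewrite diracT mul1e.
Qed.

(** The integrand is odd; [odd_J0] is applied to it as a function on the space
  of dimension one. *)
Lemma exp_kernel_sin z : Rintegral lam setT (fun x => exp_kernel x * sin (x * z)) = 0.
Proof.
set f := fun x => _ * sin _.
have fi : lam.-integrable setT (EFin \o f).
  by apply: exp_kernel_bounded_intg; [exact: measurable_sin_scale|move=> x; exact: sin_max].
pose g (x : 'rV[R]_1) := f (x 0 0).
have mg : measurable_fun setT g.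
  by apply: measurableT_comp; [exact: intg_measurable fi|exact: measurable_coor].
have gi : (lebesgue_rV R 1).-integrable setT (EFin \o g).
  apply/integrableP; split; first exact/measurable_EFinP.
  rewrite (ge0_integral_rV_cons (f := fun x : 'rV[R]_1 => `|(g x)%:E|%E))//; last first.
    by apply/measurable_EFinP; exact: measurableT_comp.
  rewrite (eq_integral (fun _ => (\int[lam]_t `|(f t)%:E|)%E)); last first.
    by move=> x _; apply: eq_integral => t _; rewrite /g rV_cons0.
  by rewrite /= integral_dirac// diracT mul1e; have /integrableP[] := fi.
have := J_rV_cons gi; rewrite J_rV0 (J_eq lam (g := f)); last by move=> t; rewrite /g rV_cons0.
move=> <- //.
  by apply: odd_J0 => // x; rewrite /g /f mxE /exp_kernel normrN mulNr sinN mulrN.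
by move=> x; apply: intg_eq fi => t; rewrite /g rV_cons0.
Qed.

Lemma cauchy_density_ge0 z : 0 <= cauchy_density z.
Proof. by rewrite divr_ge0// addr_ge0// sqr_ge0. Qed.

Lemma cauchy_density_continuous : continuous cauchy_density.
Proof. by move=> x; apply: rcvgM; [exact: rcvg_cst|exact: continuous_oneDsqrV]. Qed.

Lemma cauchy_density_integral : (\int[lam]_z (cauchy_density z)%:E = (2 * pi)%:E)%E.
Proof.
rewrite (ge0_symfun_integralT cauchy_density_ge0 cauchy_density_continuous); last first.
  by move=> x /=; rewrite /cauchy_density sqrrN.
rewrite (_ : [set x | _] = `[0, +oo[%classic); last first.
  by apply/seteqP; split => x/=; rewrite in_itv/= andbT.
rewrite (_ : (\int[lam]_(x in `[0%R, +oo[) _)%E = pi%:E); first by rewrite -EFinM.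
under eq_integral do rewrite EFinM.
rewrite ge0_integralZl//.
- by rewrite integral0y_oneDsqr -EFinM; congr EFin; field.
- apply: measurable_funTS; apply/measurable_EFinP; apply: continuous_measurable_fun.
  exact: continuous_oneDsqrV.
- by move=> x _; rewrite lee_fin invr_ge0 ltW// (lt_le_trans _ (oneDsqr_ge1 x)).
Qed.

End exponential_kernel.

Section kernel_transform.
Context (R : realType).
Notation lam := (@lebesgue_measure R).
Implicit Types (n : nat).

Definition exp_kernel_rV n (x : 'rV[R]_n) : R := \prod_(i < n) exp_kernel (x 0 i).

Definition cauchy_density_rV n (z : 'rV[R]_n) : R := \prod_(i < n) cauchy_density (z 0 i).

Lemma exp_kernel_rV_gt0 n (x : 'rV[R]_n) : 0 < exp_kernel_rV x.
Proof. by apply: prodr_gt0 => i _; exact: expR_gt0. Qed.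

Lemma exp_kernel_rV_ge0 n (x : 'rV[R]_n) : 0 <= exp_kernel_rV x.
Proof. exact: ltW (exp_kernel_rV_gt0 x). Qed.

Lemma exp_kernel_rV_le1 n (x : 'rV[R]_n) : exp_kernel_rV x <= 1.
Proof.
by apply: prodr_ile1 => i _; rewrite /exp_kernel expR_ge0 -expR0 ler_expR oppr_le0 normr_ge0.
Qed.

Lemma exp_kernel_rV_measurable n : measurable_fun setT (@exp_kernel_rV n).
Proof.
apply: measurable_prod => i _.
apply: measurableT_comp; last exact: measurable_coor.
exact: intg_measurable (exp_kernel_intg R).
Qed.

Lemma exp_kernel_rV_intg n : (lebesgue_rV R n).-integrable setT (EFin \o @exp_kernel_rV n).
Proof.
apply: ge0_intg; first exact: exp_kernel_rV_measurable.
  exact: exp_kernel_rV_ge0.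
have m := intg_measurable (exp_kernel_intg R).
rewrite (ge0_integral_prod (f := fun=> @exp_kernel R))//; last by move=> i t; exact: expR_ge0.
by rewrite (eq_bigr (fun=> (Rintegral lam setT (@exp_kernel R))%:E)) ?prodEFin ?ltry// => i _; rewrite J_EFin//; exact: exp_kernel_intg.
Qed.

Lemma cauchy_density_rV_ge0 n (z : 'rV[R]_n) : 0 <= cauchy_density_rV z.
Proof. by apply: prodr_ge0 => i _; exact: cauchy_density_ge0. Qed.

Lemma cauchy_density_rV_measurable n : measurable_fun setT (@cauchy_density_rV n).
Proof.
apply: measurable_prod => i _.
apply: measurableT_comp; last exact: measurable_coor.
by apply: continuous_measurable_fun; exact: cauchy_density_continuous.
Qed.

Lemma cauchy_density_rV_integral n :
  (\int[lebesgue_rV R n]_z (cauchy_density_rV z)%:E = ((2 * pi) ^+ n)%:E)%E.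
Proof.
rewrite (ge0_integral_prod (f := fun=> @cauchy_density R))//.
- rewrite (eq_bigr (fun=> (2 * pi)%:E)) ?prodEFin ?prodr_const ?card_ord// => i _.
  by rewrite cauchy_density_integral.
- by move=> i; apply: continuous_measurable_fun; exact: cauchy_density_continuous.
- by move=> i t; exact: cauchy_density_ge0.
Qed.

Lemma cauchy_density_rV_intg n : (lebesgue_rV R n).-integrable setT (EFin \o @cauchy_density_rV n).
Proof.
apply: ge0_intg; first exact: cauchy_density_rV_measurable.
  exact: cauchy_density_rV_ge0.
by rewrite cauchy_density_rV_integral ltry.
Qed.

Lemma measurable_cos_dotv n (z : 'rV[R]_n) : measurable_fun setT (fun x => cos (dotv z x)).
Proof.
apply: measurableT_comp; first by apply: continuous_measurable_fun; exact: continuous_cos.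
by apply: measurable_dotv.
Qed.

Lemma exp_kernel_rV_cos n (z : 'rV[R]_n) :
  \int[lebesgue_rV R n]_x (exp_kernel_rV x * cos (dotv z x)) = cauchy_density_rV z.
Proof.
elim: n z => [|n IH] z.
  rewrite (J_eq (lebesgue_rV R 0) (g := fun=> 1)); last first.
    by move=> x; rewrite /exp_kernel_rV /dotv !big_ord0 cos0 mulr1.
  rewrite /cauchy_density_rV big_ord0 /Rintegral /= integral_dirac// diracT mul1e//.
have ki m (y : 'rV[R]_m) : (lebesgue_rV R m).-integrable setT (EFin \o (fun x => exp_kernel_rV x * cos (dotv y x))).
  apply: (intg_le _ _ (exp_kernel_rV_intg m)).
    by apply: measurable_funM; [exact: exp_kernel_rV_measurable|exact: measurable_cos_dotv].
  by move=> x; rewrite normrM ger0_norm ?exp_kernel_rV_ge0// ler_piMr ?cos_max ?exp_kernel_rV_ge0.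
pose z' : 'rV[R]_n := \row_i z 0 (lift ord0 i); pose z0 := z 0 ord0.
have dE (x : 'rV[R]_n) t : dotv z (rV_cons (x, t)) = t * z0 + dotv z' x.
  rewrite /dotv big_ord_recl mxE unlift_none mulrC; congr (_ + _).
  by apply: eq_bigr => i _; rewrite !mxE liftK.
have kE (x : 'rV[R]_n) t : exp_kernel_rV (rV_cons (x, t)) = exp_kernel t * exp_kernel_rV x.
  rewrite /exp_kernel_rV big_ord_recl mxE unlift_none; congr (_ * _).
  by apply: eq_bigr => i _; rewrite !mxE liftK.
have ic := exp_kernel_bounded_intg (measurable_cos_scale z0) (fun x => cos_max (x * z0)).
have is_ := exp_kernel_bounded_intg (measurable_sin_scale z0) (fun x => sin_max (x * z0)).
have E (x : 'rV[R]_n) t : exp_kernel_rV (rV_cons (x, t)) * cos (dotv z (rV_cons (x, t))) =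
   (exp_kernel_rV x * cos (dotv z' x)) * (exp_kernel t * cos (t * z0)) -
   (exp_kernel_rV x * sin (dotv z' x)) * (exp_kernel t * sin (t * z0)).
  by rewrite kE dE cosD; ring.
rewrite J_rV_cons//; last first.
  by move=> x; rewrite (funext (E x)); apply: intgB; exact: intgZ.
rewrite (J_eq _ (g := fun x => cauchy_density z0 * (exp_kernel_rV x * cos (dotv z' x)))).
  rewrite JZ// IH /cauchy_density_rV big_ord_recl; congr (_ * _).
  by apply: eq_bigr => i _; rewrite mxE.
move=> x /=; rewrite (funext (E x)) JB; [|exact: intgZ|exact: intgZ].
by rewrite !JZ// exp_kernel_cos exp_kernel_sin mulr0 subr0 mulrC.
Qed.

End kernel_transform.

(** * The cosine and sine transforms *)

Section fourier.
Context (R : realType) (n : nat).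
Notation Rn := 'rV[R]_n.
Notation mu := (lebesgue_rV R n).
Notation J f := (Rintegral mu setT f).
Notation N2 u := (\int[mu]_x (u x ^+ 2)).
Notation intg f := (mu.-integrable [set: Rn] (EFin \o f)).
Implicit Types (s : bool) (f g h u v w eta : Rn -> R) (x y z xi : Rn) (d : R).

Let fin := lebesgue_rV_sigma_finite R n.

(** The cosine and sine transforms are treated together; the parity of
  [trig s] is [s]. *)
Definition trig s : R -> R := if s then sin else cos.

Lemma trig_bounded s (t : R) : `|trig s t| <= 1.
Proof. by case: s; [exact: sin_max|exact: cos_max]. Qed.

Lemma trigN s (t : R) : trig s (- t) = (-1) ^+ s * trig s t.
Proof. by case: s; rewrite /= ?sinN ?cosN ?expr1 ?expr0 ?mulN1r ?mul1r. Qed.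

Lemma trig_continuous s : continuous (trig s).
Proof. by case: s; [exact: continuous_sin|exact: continuous_cos]. Qed.

Lemma dotvC x y : dotv x y = dotv y x.
Proof. by apply: eq_bigr => i _; rewrite mulrC. Qed.

Lemma dotvN x y : dotv x (- y) = - dotv x y.
Proof. by rewrite /dotv -sumrN; apply: eq_bigr => i _; rewrite mxE mulrN. Qed.

Lemma dotvB x y z : dotv (x - y) z = dotv x z - dotv y z.
Proof. by rewrite /dotv -sumrB; apply: eq_bigr => i _; rewrite !mxE mulrBl. Qed.

Lemma dotvZ d x y : dotv x (d *: y) = dotv (d *: x) y.
Proof. by apply: eq_bigr => i _; rewrite !mxE; ring. Qed.

Lemma trig_dotvB x y xi : trig false (dotv x xi) * trig false (dotv y xi) +
  trig true (dotv x xi) * trig true (dotv y xi) = cos (dotv (x - y) xi).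
Proof. by rewrite /= dotvB cosB. Qed.

Lemma measurable_trig s dT (T : measurableType dT) (f g : T -> Rn) :
  measurable_fun setT f -> measurable_fun setT g ->
  measurable_fun setT (fun t => trig s (dotv (f t) (g t))).
Proof.
move=> mf mg; apply: measurableT_comp; last exact: measurable_dotv.
by apply: continuous_measurable_fun; exact: trig_continuous.
Qed.

Definition transform s f xi := J (fun x => f x * trig s (dotv x xi)).

Lemma trig_intg s f xi : intg f -> intg (fun x => f x * trig s (dotv x xi)).
Proof.
move=> fi; apply: (intg_le _ _ (intg_norm fi)) => [|x].
  by apply: measurable_funM; [exact: intg_measurable fi|exact: measurable_trig].
by rewrite normrM ler_piMr// trig_bounded.
Qed.

Let kernel_facts s f g : intg f -> intg g ->
  [/\ intg (fun x => f x * transform s g x), intg (fun y => g y * transform s f y) &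
   J (fun x => f x * transform s g x) = J (fun y => g y * transform s f y)].
Proof.
move=> fi gi.
have m : measurable_fun [set: Rn * Rn] (fun z : Rn * Rn => trig s (dotv z.1 z.2)).
  exact: measurable_trig measurable_fst measurable_snd.
have [A B C] := fubini_bounded_kernel fin fin fi gi m (fun z : Rn * Rn => trig_bounded s (dotv z.1 z.2)).
have E x : transform s g x = J (fun y => g y * trig s (dotv x y)).
  by apply: J_eq => y; rewrite dotvC.
split.
- by apply: intg_eq A => x; rewrite E.
- exact: B.
- transitivity (J (fun x => f x * J (fun y => g y * trig s (dotv x y)))); last exact: C.
  by apply: J_eq => x; rewrite E.
Qed.

Lemma transform_swap s f g : intg f -> intg g ->
  J (fun x => f x * transform s g x) = J (fun y => g y * transform s f y).
Proof. by move=> fi gi; have [] := kernel_facts s fi gi. Qed.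

Lemma transform_measurable s f : intg f -> measurable_fun setT (transform s f).
Proof.
move=> fi; have [H _ _] := kernel_facts s (exp_kernel_rV_intg R n) fi.
have mK := @exp_kernel_rV_measurable R n.
rewrite (_ : transform s f = fun x => (exp_kernel_rV x)^-1 * (exp_kernel_rV x * transform s f x)).
  apply: measurable_funM; last exact: intg_measurable H.
  rewrite (_ : (fun x => _) = fun x => \prod_(i < n) expR `|x 0 i|); last first.
    by apply/funext => x; rewrite /exp_kernel_rV -prodfV; apply: eq_bigr => i _; rewrite /exp_kernel expRN invrK.
  apply: measurable_prod => i _.
  apply: measurableT_comp; first exact: measurable_expR.
  by apply: measurableT_comp => //; exact: measurable_coor.
by apply/funext => x; rewrite mulrA mulVf ?mul1r// gt_eqF// exp_kernel_rV_gt0.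
Qed.

Lemma transform_bounded s f xi : intg f -> `|transform s f xi| <= J (fun x => `|f x|).
Proof.
move=> fi; apply: le_trans (J_norm (trig_intg s xi fi)) _.
apply: J_le; [exact: intg_norm (trig_intg s xi fi)|exact: intg_norm|].
by move=> x; rewrite normrM ler_piMr// trig_bounded.
Qed.

Lemma transformB s f g xi : intg f -> intg g ->
  transform s (fun x => f x - g x) xi = transform s f xi - transform s g xi.
Proof.
move=> fi gi; rewrite /transform -JB; [|exact: trig_intg|exact: trig_intg].
by apply: J_eq => x; ring.
Qed.

Lemma transformD s f g xi : intg f -> intg g ->
  transform s (fun x => f x + g x) xi = transform s f xi + transform s g xi.
Proof.
move=> fi gi; rewrite /transform -JD; [|exact: trig_intg|exact: trig_intg].
by apply: J_eq => x; ring.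
Qed.

Lemma transformZ s c f xi : intg f -> transform s (fun x => c * f x) xi = c * transform s f xi.
Proof.
move=> fi; rewrite /transform -JZ; last exact: trig_intg.
by apply: J_eq => x; ring.
Qed.

Lemma transformN s f xi : intg f -> transform s f (- xi) = (-1) ^+ s * transform s f xi.
Proof.
move=> fi; rewrite /transform -JZ; last exact: trig_intg.
by apply: J_eq => x; rewrite dotvN trigN; ring.
Qed.

Notation kap := (@exp_kernel_rV R n).
Notation K := (@cauchy_density_rV R n).
Notation c := ((2 * pi : R) ^+ n).

Let kap_scale_intg d : 0 < d -> intg (fun xi => kap (d *: xi)).
Proof.
move=> d0; have := intg_affine 0 (lt0r_neq0 d0) (exp_kernel_rV_intg R n).
by apply: intg_eq => x; rewrite addr0.
Qed.

Let kap_mul_intg d f M : 0 < d -> measurable_fun setT f -> (forall xi, `|f xi| <= M) ->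
  intg (fun xi => kap (d *: xi) * f xi).
Proof.
move=> d0 mf fM; apply: (intg_le _ _ (intgZ M (kap_scale_intg d0))) => [|x].
  by apply: measurable_funM => //; exact: intg_measurable (kap_scale_intg d0).
by rewrite normrM ger0_norm ?exp_kernel_rV_ge0// [leRHS]mulrC ler_wpM2l ?exp_kernel_rV_ge0.
Qed.

Let kap_transform d z : 0 < d ->
  J (fun xi => kap (d *: xi) * cos (dotv z xi)) = d ^- n * K (d^-1 *: z).
Proof.
move=> d0; have dn := lt0r_neq0 d0; pose F xi := kap xi * cos (dotv (d^-1 *: z) xi).
have Fi : intg F.
  apply: (intg_le _ _ (exp_kernel_rV_intg R n)).
    by apply: measurable_funM; [exact: exp_kernel_rV_measurable|exact: measurable_cos_dotv].
  by move=> x; rewrite normrM ger0_norm ?exp_kernel_rV_ge0// ler_piMr ?cos_max ?exp_kernel_rV_ge0.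
rewrite -(exp_kernel_rV_cos (d^-1 *: z)) -[d in LHS](ger0_norm (ltW d0)).
have := J_affine 0 dn Fi; rewrite ger0_norm ?ltW// => <-; apply: J_eq => xi.
by rewrite /F addr0 dotvZ scalerA mulfV// scale1r.
Qed.

(** Parseval's identity, regularized by the kernel [kap (d *: xi)] whose own
  transform is the approximate identity [d ^- n * K (d^-1 *: z)]. *)
Let parseval_kernel f g d : 0 < d -> intg f -> intg g ->
  J (fun xi => kap (d *: xi) * (transform false f xi * transform false g xi +
                               transform true f xi * transform true g xi)) =
  J (fun x => f x * J (fun y => g y * (d ^- n * K (d^-1 *: (x - y))))).
Proof.
move=> d0 fi gi.
pose h s xi := kap (d *: xi) * transform s g xi.
have hi s : intg (h s).
  by apply: (kap_mul_intg d0 (transform_measurable s gi)) => xi; exact: transform_bounded.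
pose q s x xi := kap (d *: xi) * trig s (dotv xi x).
have qi s x : intg (q s x).
  apply: (kap_mul_intg d0 (M := 1)); first exact: measurable_trig.
  by move=> xi; exact: trig_bounded.
have th s x : transform s (h s) x = J (fun y => g y * transform s (q s x) y).
  by rewrite -(transform_swap s (qi s x) gi); apply: J_eq => xi; rewrite /q /h; ring.
have tq x y : transform false (q false x) y + transform true (q true x) y = d ^- n * K (d^-1 *: (x - y)).
  rewrite -(kap_transform _ d0) /transform -JD; [|exact: trig_intg|exact: trig_intg].
  by apply: J_eq => xi; rewrite -trig_dotvB /q !(dotvC _ xi); ring.
have fhi s : intg (fun xi => h s xi * transform s f xi) by have [] := kernel_facts s (hi s) fi.
have fti s : intg (fun x => f x * transform s (h s) x) by have [] := kernel_facts s fi (hi s).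
rewrite (J_eq _ (g := fun xi => h false xi * transform false f xi + h true xi * transform true f xi)); last first.
  by move=> xi; rewrite /h; ring.
rewrite JD// !(transform_swap _ (hi _) fi) -JD//; apply: J_eq => x.
rewrite -mulrDr !th; congr (_ * _).
have gti s : intg (fun y => g y * transform s (q s x) y) by have [] := kernel_facts s gi (qi s x).
by rewrite -JD//; apply: J_eq => y; rewrite -mulrDr tq.
Qed.

Let K_le z : K z <= 2 ^+ n.
Proof.
rewrite /cauchy_density_rV -[n in 2 ^+ n]card_ord -prodr_const.
apply: ler_prod => i _; rewrite cauchy_density_ge0 /cauchy_density.
by rewrite ler_pdivrMr ?ler_peMr// ?lerDl ?sqr_ge0// ltr_wpDr// sqr_ge0.
Qed.

Let kernel_subst g d x : 0 < d -> intg g ->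
  J (fun y => g y * (d ^- n * K (d^-1 *: (x - y)))) = J (fun z => K z * g (x - d *: z)).
Proof.
move=> d0 gi; pose F y := K (d^-1 *: (x - y)) * g y.
have Fi : intg F.
  apply: (intg_le _ _ (intgZ (2 ^+ n) (intg_norm gi))).
    apply: measurable_funM; last exact: intg_measurable gi.
    have := measurable_affine_comp (- d^-1) (d^-1 *: x) (@cauchy_density_rV_measurable R n).
    by congr measurable_fun; apply/funext => y; congr K; rewrite scalerBr scaleNr addrC.
  by move=> y; rewrite normrM ger0_norm ?cauchy_density_rV_ge0// ler_wpM2r.
have dN : - d != 0 by rewrite oppr_eq0 gt_eqF.
have := J_affine x dN Fi; rewrite normrN ger0_norm ?ltW// => H.
transitivity (J (fun y => d ^- n * F y)); first by apply: J_eq => y; rewrite /F; ring.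
rewrite JZ// -H; apply: J_eq => z; rewrite /F (_ : - d *: z + x = x - d *: z); last first.
  by rewrite scaleNr addrC.
by rewrite subKr scalerA mulVf ?scale1r// gt_eqF.
Qed.

Let J_K : J K = c.
Proof. by rewrite /Rintegral cauchy_density_rV_integral. Qed.

Let shift_back g d x : 0 < d -> intg g -> intg (fun z => g (x - d *: z)).
Proof.
move=> d0 gi; have dN : - d != 0 by rewrite oppr_eq0 gt_eqF.
by apply: intg_eq (intg_affine x dN gi) => z; rewrite scaleNr addrC.
Qed.

(** Substituting [y = x - d z] and exchanging the integrals turns the kernel
  of scale [d] into the fixed weight [K] on the shifts [d z]. *)
Let parseval_correlation f g d : 0 < d -> intg f -> sqint mu f -> intg g -> sqint mu g ->
  intg (fun z => K z * J (fun x => f x * g (x - d *: z))) /\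
  J (fun xi => kap (d *: xi) * (transform false f xi * transform false g xi +
                               transform true f xi * transform true g xi)) =
  J (fun z => K z * J (fun x => f x * g (x - d *: z))).
Proof.
move=> d0 fi f2 gi g2; rewrite (parseval_kernel d0 fi gi).
pose F (p : Rn * Rn) := f p.1 * (K p.2 * g (p.1 - d *: p.2)).
have Kg x : intg (fun z => K z * g (x - d *: z)).
  apply: (intg_le _ _ (intgZ (2 ^+ n) (intg_norm (shift_back x d0 gi)))).
    apply: measurable_funM; first exact: cauchy_density_rV_measurable.
    exact: intg_measurable (shift_back x d0 gi).
  by move=> z; rewrite normrM ger0_norm ?cauchy_density_rV_ge0// ler_wpM2r.
have g2z z : sqint mu (fun x => g (x - d *: z)) by exact: (sqint_translate (- (d *: z)) g2).
have mF : measurable_fun [set: Rn * Rn] F.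
  apply: measurable_funM; first exact: measurableT_comp f2.1 measurable_fst.
  apply: measurable_funM.
    by apply: measurableT_comp; [exact: cauchy_density_rV_measurable|exact: measurable_snd].
  apply: (measurableT_comp g2.1).
  have := measurable_row_affine (- d) (@measurable_snd _ _ Rn Rn) (@measurable_fst _ _ Rn Rn).
  by congr measurable_fun; apply/funext => p; rewrite scaleNr addrC.
have FE z : (fun x => F (x, z)) = fun x => K z * (f x * g (x - d *: z)).
  by apply/funext => x; rewrite /F /=; ring.
have fg z := sqint_mul f2 (g2z z).
have Fz z : intg (fun x => F (x, z)) by rewrite FE; exact: intgZ (fg z).
have FB z : J (fun x => `|F (x, z)|) <= (N2 f + N2 g) * K z.
  rewrite (_ : (fun x => _) = fun x => K z * `|f x * g (x - d *: z)|); last first.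
    by apply/funext => x; rewrite (congr1 (@^~ x) (FE z)) normrM ger0_norm// cauchy_density_rV_ge0.
  rewrite JZ; last exact: intg_norm (fg z).
  rewrite mulrC ler_wpM2r ?cauchy_density_rV_ge0//.
  rewrite -(N2_translate (- (d *: z)) g2) -JD; [|by case: f2|by case: (g2z z)].
  apply: J_le; first exact: intg_norm (fg z).
    by apply: intgD; [case: f2|case: (g2z z)].
  move=> x; rewrite ler_norml; move: (f x) (g _) => a b.
  have := sqr_ge0 (a - b); have := sqr_ge0 (a + b); have := sqr_ge0 a; have := sqr_ge0 b.
  by rewrite !expr2; move=> *; apply/andP; split; lra.
have [_ H E] := fubini_slices fin fin mF Fz FB (intgZ _ (cauchy_density_rV_intg R n)).
have KE z : J (fun x => F (x, z)) = K z * J (fun x => f x * g (x - d *: z)).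
  by rewrite FE JZ.
split; first by apply: intg_eq H.
rewrite -(J_eq _ KE) -E; apply: J_eq => x; rewrite (kernel_subst x d0 gi) -JZ//.
Qed.

Let cor_le f d z : sqint mu f -> J (fun x => f x * f (x - d *: z)) <= N2 f.
Proof.
move=> f2; have s2 := sqint_translate (- (d *: z)) f2.
have := cauchy_schwarz f2 s2; rewrite (N2_translate (- (d *: z)) f2) -expr2.
move=> H; apply: le_trans (ler_norm _) _.
by rewrite -[leRHS]ger0_norm ?J_sqr_ge0// -ler_sqr ?nnegrE// !real_normK ?num_real.
Qed.

Let dk (k : nat) : R := k.+1%:R^-1.

Let dk_gt0 k : 0 < dk k. Proof. by rewrite invr_gt0. Qed.

Let kap_cvg xi : kap (dk k *: xi) @[k --> \oo] --> (1 : R).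
Proof.
have -> : 1 = \prod_(i < n) @exp_kernel R 0.
  by rewrite big1// => i _; rewrite /exp_kernel normr0 oppr0 expR0.
apply: rcvg_prod => i.
rewrite (_ : (fun k => _) = fun k => exp_kernel (dk k * xi 0 i)); last by apply/funext => k; rewrite mxE.
have H : dk k * xi 0 i @[k --> \oo] --> (0 : R).
  by rewrite -[X in _ --> X](mul0r (xi 0 i)); apply: rcvgM; [exact: cvg_invS0|exact: rcvg_cst].
exact: (cvg_comp _ _ H (@exp_kernel_continuous R 0)).
Qed.

Let transform2_meas s f : intg f -> measurable_fun setT (fun xi => transform s f xi ^+ 2).
Proof. by move=> fi; apply: measurable_funX; exact: transform_measurable. Qed.

(** By Cauchy--Schwarz the correlations of [f] with itself are at most its
  square norm, and the kernel is removed by Fatou's lemma. *)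
Let bessel_sum f : intg f -> sqint mu f ->
  intg (fun xi => transform false f xi ^+ 2 + transform true f xi ^+ 2) /\
  J (fun xi => transform false f xi ^+ 2 + transform true f xi ^+ 2) <= c * N2 f.
Proof.
move=> fi f2; pose B := J (fun x => `|f x|); have B0 : 0 <= B by exact: J_ge0.
apply: (J_fatou (F := fun k xi => kap (dk k *: xi) * (transform false f xi ^+ 2 + transform true f xi ^+ 2))).
- move=> k; apply: (kap_mul_intg (dk_gt0 k) (M := B ^+ 2 + B ^+ 2)).
    by apply: measurable_funD; exact: transform2_meas.
  move=> xi; rewrite ger0_norm ?addr_ge0 ?sqr_ge0//.
  by apply: lerD; apply: sqr_le_norm; exact: transform_bounded.
- by move=> k xi; rewrite mulr_ge0 ?exp_kernel_rV_ge0// addr_ge0 ?sqr_ge0.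
- move=> xi; rewrite -[X in _ --> X]mul1r; apply: rcvgM; [exact: kap_cvg|exact: rcvg_cst].
move=> k; have [H E] := parseval_correlation (dk_gt0 k) fi f2 fi f2.
rewrite (J_eq _ (g := fun xi => kap (dk k *: xi) * (transform false f xi * transform false f xi +
                               transform true f xi * transform true f xi))); last first.
  by move=> xi; rewrite !expr2.
rewrite E -J_K mulrC -JZ; last exact: cauchy_density_rV_intg.
apply: J_le => //; first by apply: intgZ; exact: cauchy_density_rV_intg.
by move=> z; rewrite mulrC ler_wpM2r ?cauchy_density_rV_ge0//; exact: cor_le.
Qed.

Lemma transform_sqint s f : intg f -> sqint mu f -> sqint mu (transform s f).
Proof.
move=> fi f2; have [H _] := bessel_sum fi f2; split; first exact: transform_measurable.
apply: (intg_le _ _ H); first exact: transform2_meas.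
by move=> xi; rewrite ger0_norm ?sqr_ge0//; case: s; rewrite ?lerDl ?lerDr sqr_ge0.
Qed.

Lemma bessel s f : intg f -> sqint mu f -> N2 (transform s f) <= c * N2 f.
Proof.
move=> fi f2; have [H] := bessel_sum fi f2; apply: le_trans.
have [_ H2] := transform_sqint s fi f2.
by apply: J_le => // xi; case: s {H2}; rewrite ?lerDl ?lerDr sqr_ge0.
Qed.

(** The correlations with a test function are continuous at shift zero, so
  letting the scale of the kernel tend to zero removes it on both sides. *)
Lemma parseval_transform f eta : intg f -> sqint mu f -> test_function eta ->
  J (fun xi => transform false f xi * transform false eta xi) +
  J (fun xi => transform true f xi * transform true eta xi) = c * J (fun x => f x * eta x).
Proof.
move=> fi f2 te; have ei := test_function_intg te; have e2 := test_function_sqint te.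
have [M M0 MP] := test_function_bounded te.
have tf s := transform_sqint s fi f2; have tte s := transform_sqint s ei e2.
pose P xi := transform false f xi * transform false eta xi + transform true f xi * transform true eta xi.
have Pi : intg P by apply: intgD; exact: sqint_mul.
have [||||_ c1] := @J_dct _ _ _ mu (fun k xi => kap (dk k *: xi) * P xi) P (fun xi => `|P xi|).
- move=> k; apply: measurable_funM; last exact: intg_measurable Pi.
  exact: intg_measurable (kap_scale_intg (dk_gt0 k)).
- move=> xi; rewrite -[X in _ --> X]mul1r; apply: rcvgM; [exact: kap_cvg|exact: rcvg_cst].
- by move=> k xi; rewrite normrM ger0_norm ?exp_kernel_rV_ge0// ler_piMl ?exp_kernel_rV_le1.
- exact: intg_norm.
pose A k z := J (fun x => f x * eta (x - dk k *: z)).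
have [||||_ c2] := @J_dct _ _ _ mu (fun k z => K z * A k z) (fun z => J (fun x => f x * eta x) * K z)
    (fun z => M * J (fun x => `|f x|) * K z).
- by move=> k; have [H _] := parseval_correlation (dk_gt0 k) fi f2 ei e2; exact: intg_measurable H.
- move=> z; rewrite [X in _ --> X]mulrC; apply: rcvgM; first exact: rcvg_cst.
  have [||||//] := @J_dct _ _ _ mu (fun k x => f x * eta (x - dk k *: z)) (fun x => f x * eta x) (fun x => M * `|f x|).
  + move=> k; apply: measurable_funM; first exact: f2.1.
    exact: (sqint_translate (- (dk k *: z)) e2).1.
  + move=> x; apply: rcvgM; first exact: rcvg_cst.
    have H : x - dk k *: z @[k --> \oo] --> x.
      rewrite [X in _ --> X](_ : x = x - 0 *: z); last by rewrite scale0r subr0.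
      by apply: cvgB; [exact: cvg_cst|apply: cvgZr_tmp; exact: cvg_invS0].
    exact: (cvg_comp _ _ H (@smooth_continuous _ _ _ (proj1 te) x)).
  + by move=> k x; rewrite normrM mulrC ler_wpM2r.
  + by apply: intgZ; exact: intg_norm.
- move=> k z; rewrite normrM ger0_norm ?cauchy_density_rV_ge0// mulrC ler_wpM2r ?cauchy_density_rV_ge0//.
  rewrite -JZ; last exact: intg_norm.
  have i1 : intg (fun x => f x * eta (x - dk k *: z)).
    apply: sqint_mul => //; exact: (sqint_translate (- (dk k *: z)) e2).
  apply: le_trans (J_norm i1) _; apply: J_le; [exact: intg_norm|by apply: intgZ; exact: intg_norm|].
  by move=> x; rewrite normrM mulrC ler_wpM2r.
- by apply: intgZ; exact: cauchy_density_rV_intg.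
rewrite -JD; [|exact: sqint_mul|exact: sqint_mul].
rewrite -J_K mulrC -JZ; last exact: cauchy_density_rV_intg.
apply: (rcvg_unique c1); apply: rcvg_eq c2 => k.
by have [_ ->] := parseval_correlation (dk_gt0 k) fi f2 ei e2.
Qed.

(** * Extension of the transforms to [L^2] *)

Let ball (N : nat) : set Rn := [set x | enorm x <= N%:R].

Let ballE N : ball N = (fun x => dotv x x) @^-1` `]-oo, N%:R ^+ 2]%classic.
Proof.
have sq x : 0 <= dotv x x by apply: sumr_ge0 => i _; rewrite -expr2 sqr_ge0.
apply/seteqP; split => x /=; rewrite in_itv/= /ball/= /enorm => H.
  by rewrite -(sqr_sqrtr (sq x)); apply: sqr_le_norm; rewrite ger0_norm ?sqrtr_ge0.
by rewrite -[N%:R]ger0_norm// -sqrtr_sqr ler_wsqrtr.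
Qed.

Lemma coord_le_enorm x i : `|x 0 i| <= enorm x.
Proof.
rewrite /enorm -sqrtr_sqr ler_wsqrtr// /dotv (bigD1 i)//= -expr2 lerDl.
by apply: sumr_ge0 => j _; rewrite -expr2 sqr_ge0.
Qed.

Lemma enormN x : enorm (- x) = enorm x.
Proof. by rewrite /enorm; congr Num.sqrt; apply: eq_bigr => i _; rewrite mxE mulrNN. Qed.

Let measurable_ball N : measurable (ball N).
Proof.
rewrite ballE -[X in measurable X]setTI.
have m : measurable_fun setT (fun x : Rn => dotv x x) by exact: measurable_dotv.
by apply: m.
Qed.

Definition truncate N u x := u x * \1_(ball N) x.

Let truncate_le N u x : `|truncate N u x| <= `|u x|.
Proof. by rewrite /truncate indicE; case: (_ \in _); rewrite ?mulr1 ?mulr0 ?normr0. Qed.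

Let indic_ball_sqint N : sqint mu (\1_(ball N) : Rn -> R).
Proof.
apply: (bounded_support_sqint (r := N%:R) (M := 1)); first by apply: measurable_indic; exact: measurable_ball.
  move=> x xN; rewrite indicE memNset// => xb; apply: xN; apply/cubeP => i.
  exact: le_trans (coord_le_enorm x i) xb.
by move=> x; rewrite ger0_norm ?indicE//; case: (_ \in _).
Qed.

Let truncate_sqint N u : sqint mu u -> sqint mu (truncate N u).
Proof.
move=> u2; apply: (sqint_le _ _ u2); last by move=> x; exact: truncate_le.
by apply: measurable_funM; [case: u2|case: (indic_ball_sqint N)].
Qed.

Let truncate_intg N u : sqint mu u -> intg (truncate N u).
Proof. by move=> u2; exact: sqint_mul (indic_ball_sqint N). Qed.

Let truncate_cvg u : sqint mu u -> N2 (fun x => truncate N u x - u x) @[N --> \oo] --> 0.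
Proof.
move=> u2; have [||||_] := @J_dct _ _ _ mu (fun N x => (truncate N u x - u x) ^+ 2) (fun=> 0) (fun x => u x ^+ 2).
- by move=> N; apply: measurable_funX; case: (sqintB (truncate_sqint N u2) u2).
- move=> x; apply: cvg_near_cst; exists (Num.bound (enorm x)) => // N /= HN.
  rewrite /truncate indicE mem_set; first by rewrite mulr1 subrr expr0n.
  rewrite /ball/=; apply: le_trans (ltW (archi_boundP (sqrtr_ge0 _))) _.
  by rewrite ler_nat.
- move=> N x; rewrite ger0_norm ?sqr_ge0// /truncate indicE; case: (_ \in _).
    by rewrite mulr1 subrr expr0n sqr_ge0.
  by rewrite mulr0 sub0r sqrrN.
- by case: u2.
by rewrite J0.
Qed.

Definition fourier s u v := sqint mu v /\
  N2 (fun xi => transform s (truncate N u) xi - v xi) @[N --> \oo] --> 0.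

Let tt_sqint s u N : sqint mu u -> sqint mu (transform s (truncate N u)).
Proof. by move=> u2; apply: transform_sqint; [exact: truncate_intg|exact: truncate_sqint]. Qed.

Lemma is_L2_transformP s u v : sqint mu u -> is_L2_transform (trig s) u v <-> fourier s u v.
Proof.
move=> u2; rewrite /is_L2_transform /L2 /fourier.
have tE N xi : \int[mu]_(x in [set x | enorm x <= N%:R]) (u x * trig s (dotv x xi)) = transform s (truncate N u) xi.
  rewrite Rintegral_mkcond; apply: J_eq => x.
  have [H|H] := pselect (enorm x <= N%:R).
    by rewrite /patch ifT ?inE// /truncate indicE mem_set ?mulr1.
  rewrite /patch ifF; first by rewrite /truncate indicE memNset// mulr0 mul0r.
  by apply/negbTE; rewrite notin_setE.
have E : sqint mu v -> (fun N : nat => (\int[mu]_xi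
     ((\int[mu]_(x in [set x | enorm x <= N%:R]) (u x * trig s (dotv x xi)) - v xi) ^+ 2)%:E)%E) =
   (fun N => (N2 (fun xi => transform s (truncate N u) xi - v xi))%:E).
  move=> v2; apply/funext => N; rewrite -J_EFin; last by case: (sqintB (tt_sqint s N u2) v2).
  by apply: eq_integral => xi _; rewrite tE.
split=> [[/sqintP v2 H]|[v2 H]]; split => //.
- by move: H; rewrite E// => /fine_cvgP[].
- exact/sqintP.
- by rewrite E//; apply: cvg_EFin => //; exact: nearW.
Qed.

Let bessel_truncate s u u' : sqint mu u -> sqint mu u' -> intg u -> intg u' ->
  N2 (fun xi => transform s u xi - transform s u' xi) <= c * N2 (fun x => u x - u' x).
Proof.
move=> u2 u2' ui ui'; have E : N2 (fun xi => transform s u xi - transform s u' xi) = N2 (transform s (fun x => u x - u' x)).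
  by apply: J_eq => xi; rewrite transformB.
rewrite E; exact: (bessel s (intgB ui ui') (sqintB u2 u2')).
Qed.

Let c_gt0 : 0 < c.
Proof. by rewrite exprn_gt0// mulr_gt0// pi_gt0. Qed.

(** By Bessel's inequality the transforms of the truncations form a Cauchy
  sequence. *)
Lemma fourier_exists s u : sqint mu u -> exists v, fourier s u v.
Proof.
move=> u2.
have [|e e0|v v2 cv] := @sqint_complete _ _ _ mu (fun N => transform s (truncate N u)).
- by move=> N; exact: tt_sqint.
- have : 4 * c * N2 (fun x => truncate N u x - u x) @[N --> \oo] --> 4 * c * 0.
    exact (rcvgZ _ (truncate_cvg u2)).
  rewrite mulr0 => /cvgrPdist_lt/(_ e e0)[N _ NP]; exists N => k l kN lN.
  have A m : (N <= m)%N -> 4 * c * N2 (fun x => truncate m u x - u x) < e.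
    by move=> /NP /=; rewrite sub0r normrN; apply: le_lt_trans; exact: ler_norm.
  have tk2 := truncate_sqint k u2; have tl2 := truncate_sqint l u2.
  apply: le_trans (bessel_truncate s tk2 tl2 (truncate_intg k u2) (truncate_intg l u2)) _.
  have E : N2 (fun x => truncate k u x - truncate l u x) = N2 (fun x => (truncate k u x - u x) - (truncate l u x - u x)).
    by apply: J_eq => x; congr (_ ^+ 2); ring.
  rewrite E.
  have := J_sqrB_le (sqintB tk2 u2) (sqintB tl2 u2) => /(ler_wpM2l (ltW c_gt0)) H.
  apply: le_trans H _; have := A k kN; have := A l lN.
  move: (N2 (fun x => truncate k u x - u x)) (N2 (fun x => truncate l u x - u x)) => a b.
  by rewrite mulrDr; nra.
by exists v.
Qed.

Lemma fourier_transform s u : intg u -> sqint mu u -> fourier s u (transform s u).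
Proof.
move=> ui u2; split; first exact: transform_sqint.
have : c * N2 (fun x => truncate N u x - u x) @[N --> \oo] --> c * 0 by exact (rcvgZ _ (truncate_cvg u2)).
rewrite mulr0; apply: rcvg_squeeze0 => N; rewrite J_sqr_ge0/=.
by apply: bessel_truncate => //; [exact: truncate_sqint|exact: truncate_intg].
Qed.

Lemma fourier_unique s u v v' : sqint mu u -> fourier s u v -> fourier s u v' -> v = v' %[ae mu].
Proof.
move=> u2 [v2 cv] [v2' cv']; apply: sqint_lim_unique cv cv' => // N; exact: tt_sqint.
Qed.

Lemma fourier_eq s u v u' v' : u =1 u' -> v =1 v' -> fourier s u v -> fourier s u' v'.
Proof. by move=> /funext -> /funext ->. Qed.

Lemma fourier_ae s u v v' : sqint mu u -> measurable_fun setT v' -> v = v' %[ae mu] -> fourier s u v -> fourier s u v'.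
Proof.
move=> u2 mv' vv' [v2 cv]; have v2' := sqint_ae mv' vv' v2; split => //.
apply: rcvg_eq cv => N; apply: J_ae.
- by apply: measurable_funX; case: (sqintB (tt_sqint s N u2) v2).
- by apply: measurable_funX; case: (sqintB (tt_sqint s N u2) v2').
- by apply: filterS vv' => x /= H xT; rewrite H.
Qed.

Lemma fourier_comb s a u v u' v' : sqint mu u -> sqint mu u' -> fourier s u v -> fourier s u' v' ->
  fourier s (fun x => u x + a * u' x) (fun x => v x + a * v' x).
Proof.
move=> u2 u2' [v2 cv] [v2' cv']; split; first by apply: sqintD => //; exact: sqintZ.
have : 2 * N2 (fun xi => transform s (truncate N u) xi - v xi) +
  2 * (a ^+ 2 * N2 (fun xi => transform s (truncate N u') xi - v' xi)) @[N --> \oo] --> (2 * 0 + 2 * (a ^+ 2 * 0)).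
  apply: rcvgD; first by apply: rcvgZ.
  by apply: rcvgZ; apply: rcvgZ.
rewrite !mulr0 addr0; apply: rcvg_squeeze0 => N; rewrite J_sqr_ge0/=.
have d2 := sqintB (tt_sqint s N u2) v2; have d2' := sqintB (tt_sqint s N u2') v2'.
rewrite -(J_sqrZ a d2'); apply: le_trans (J_sqrD_le d2 (sqintZ a d2')).
apply: J_le.
- have := sqintD d2 (sqintZ a d2'); case => _; apply: intg_eq => xi; congr (_ ^+ 2).
  rewrite (_ : truncate N (fun x => u x + a * u' x) = fun x => truncate N u x + a * truncate N u' x).
    by rewrite transformD ?transformZ//; [ring|exact: truncate_intg|exact: truncate_intg|apply: intgZ; exact: truncate_intg].
  by apply/funext => x; rewrite /truncate; ring.
- by case: (sqintD d2 (sqintZ a d2')).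
move=> xi; rewrite (_ : truncate N (fun x => u x + a * u' x) = fun x => truncate N u x + a * truncate N u' x).
  rewrite transformD ?transformZ//; [|exact: truncate_intg|exact: truncate_intg|apply: intgZ; exact: truncate_intg].
  by rewrite le_eqVlt; apply/orP; left; apply/eqP; ring.
by apply/funext => x; rewrite /truncate; ring.
Qed.

Let test_fourier s eta : test_function eta -> sqint mu (transform s eta).
Proof. by move=> te; apply: transform_sqint; [exact: test_function_intg|exact: test_function_sqint]. Qed.

Lemma fourier_adjoint s u v eta : sqint mu u -> fourier s u v -> test_function eta ->
  J (fun x => v x * eta x) = J (fun x => u x * transform s eta x).
Proof.
move=> u2 [v2 cv] te; have ei := test_function_intg te; have e2 := test_function_sqint te.
have c1 := ip_cvg (fun N => tt_sqint s N u2) v2 e2 cv.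
have c2 := ip_cvg (fun N => truncate_sqint N u2) u2 (test_fourier s te) (truncate_cvg u2).
apply: (rcvg_unique c1); apply: rcvg_eq c2 => N.
by rewrite (transform_swap s (truncate_intg N u2) ei); apply: J_eq => x; rewrite mulrC.
Qed.

Lemma fourier_parseval s u v v' eta : sqint mu u -> fourier s u v -> fourier (~~ s) u v' -> test_function eta ->
  J (fun xi => v xi * transform s eta xi) + J (fun xi => v' xi * transform (~~ s) eta xi) =
  c * J (fun x => u x * eta x).
Proof.
move=> u2; wlog -> : s v v' / s = false.
  move=> H; case: s; last exact: H.
  by move=> f1 f2 te; rewrite addrC; apply: H.
move=> [v2 cv] [v2' cv'] te; have e2 := test_function_sqint te.
have c1 := ip_cvg (fun N => tt_sqint false N u2) v2 (test_fourier false te) cv.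
have c2 := ip_cvg (fun N => tt_sqint true N u2) v2' (test_fourier true te) cv'.
have c3 := ip_cvg (fun N => truncate_sqint N u2) u2 e2 (truncate_cvg u2).
apply: (rcvg_unique (rcvgD c1 c2)).
have c4 : c * J (fun x => truncate N u x * eta x) @[N --> \oo] --> c * J (fun x => u x * eta x) by exact: rcvgZ.
apply: rcvg_eq c4 => N; by rewrite parseval_transform//; [exact: truncate_intg|exact: truncate_sqint].
Qed.

(** Duality with test functions turns Parseval's identity into the lower bound
  that makes the pair of transforms injective. *)
Lemma fourier_lower u v v' : sqint mu u -> fourier false u v -> fourier true u v' ->
  c * N2 u <= 2 * N2 v + 2 * N2 v'.
Proof.
move=> u2 fv fv'; have [eta te ce] := test_function_dense u2; have e2 k := test_function_sqint (te k).
have := J_sqr_ge0 mu u; rewrite le_eqVlt => /orP[/eqP <-|n0].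
  by rewrite mulr0 addr_ge0// mulr_ge0// J_sqr_ge0.
have c1 : (c * J (fun x => eta k x * u x)) ^+ 2 @[k --> \oo] --> (c * J (fun x => u x * u x)) ^+ 2.
  by apply: rcvgX; apply: rcvgZ; exact: ip_cvg.
have c2 : (2 * N2 v + 2 * N2 v') * (c * N2 (eta k)) @[k --> \oo] --> (2 * N2 v + 2 * N2 v') * (c * N2 u).
  by apply: rcvgZ; apply: rcvgZ; exact: J_sqr_cvg.
have : (c * J (fun x => u x * u x)) ^+ 2 <= (2 * N2 v + 2 * N2 v') * (c * N2 u).
  apply: (rcvg_le c1 c2) => k.
  rewrite (_ : J _ = J (fun x => u x * eta k x)); last by apply: J_eq => x; rewrite mulrC.
  rewrite -(fourier_parseval u2 fv fv' (te k)).
  have h1 := cauchy_schwarz fv.1 (test_fourier false (te k)).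
  have h2 := cauchy_schwarz fv'.1 (test_fourier true (te k)).
  have b1 := bessel false (test_function_intg (te k)) (e2 k).
  have b2 := bessel true (test_function_intg (te k)) (e2 k).
  have := ler_wpM2l (J_sqr_ge0 mu v) b1; have := ler_wpM2l (J_sqr_ge0 mu v') b2.
  move: h1 h2; move: (J (fun xi => v xi * _)) (J (fun xi => v' xi * _)) => a b.
  move: (N2 v) (N2 v') (c * N2 (eta k)) (N2 (transform _ _)) (N2 (transform _ _)) => p q m r t h1 h2 h3 h4.
  have := sqr_ge0 (a - b); rewrite !expr2 in h1 h2 *; rewrite mulrDl; nra.
have E : J (fun x => u x * u x) = N2 u by apply: J_eq => x; rewrite expr2.
by rewrite E expr2 ler_pM2r// mulr_gt0.
Qed.

(** * Parity and inversion *)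

(** The truncated integrands are odd, because [trig s] has the parity that [u]
  lacks. *)
Lemma fourier_parity0 s u v : sqint mu u -> (forall x, u (- x) = - ((-1) ^+ s * u x)) ->
  fourier s u v -> v = cst 0 %[ae mu].
Proof.
move=> u2 up [v2 cv]; apply: (J_sqr_eq0 v2).
apply: (rcvg_unique (cvg_cst (N2 v) : (fun=> N2 v) N @[N --> \oo] --> N2 v)).
apply: rcvg_eq cv => N; apply: J_eq => xi.
rewrite [transform _ _ _]odd_J0 ?sub0r ?sqrrN//; first exact: trig_intg (truncate_intg N u2).
move=> x; rewrite /truncate up dotvC dotvN trigN dotvC.
rewrite (_ : \1_(ball N) (- x) = \1_(ball N) x :> R); last first.
  by rewrite !indicE; congr (nat_of_bool _)%:R; rewrite /ball; apply/idP/idP; rewrite !inE /= enormN.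
by case: (s); rewrite ?expr1 ?expr0; ring.
Qed.

Lemma fourier_orth s u v w : sqint mu u -> sqint mu w -> (forall x, w (- x) = - ((-1) ^+ s * w x)) ->
  fourier s u v -> J (fun x => v x * w x) = 0.
Proof.
move=> u2 w2 wp [v2 cv].
have c1 := ip_cvg (fun N => tt_sqint s N u2) v2 w2 cv.
apply: (rcvg_unique c1); apply: rcvg_eq (cvg_cst 0 : (fun=> 0 : R) N @[N --> \oo] --> (0 : R)) => N.
symmetry; apply: odd_J0; first by apply: sqint_mul => //; exact: tt_sqint.
move=> x; rewrite wp transformN; last exact: truncate_intg.
by case: (s); rewrite ?expr1 ?expr0; ring.
Qed.

(** By duality with test functions: of the two terms, the one of the wrong
  parity is orthogonal to the transform of the test function, and Parseval's
  identity evaluates the other. *)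
Lemma fourier_inversion (A V : bool -> Rn -> R) : (forall s, sqint mu (A s)) ->
  (forall s x, A s (- x) = (-1) ^+ s * A s x) -> (forall s, fourier s (A s) (V s)) ->
  forall s, fourier s (fun x => c^-1 * (V false x + V true x)) (A s).
Proof.
move=> A2 Ap AV s; have V2 t : sqint mu (V t) by case: (AV t).
set g := fun x => _; have g2 : sqint mu g by apply: sqintZ; exact: sqintD.
have [w gw] := fourier_exists s g2; have w2 := gw.1.
apply: (fourier_ae g2 (A2 s).1 _ gw).
have : (fun x => w x - A s x) = cst 0 %[ae mu].
  apply: orth_test_function_eq0; first exact: sqintB.
  move=> eta te; have e2 := test_function_sqint te; have te2 t := test_fourier t te.
  transitivity (J (fun x => w x * eta x) - J (fun x => A s x * eta x)).
    by rewrite -JB; [apply: J_eq => x; ring|exact: sqint_mul|exact: sqint_mul].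
  apply/eqP; rewrite subr_eq0 (fourier_adjoint g2 gw te); apply/eqP.
  have O : J (fun x => V (~~ s) x * transform s eta x) = 0.
    apply: (fourier_orth (A2 (~~ s)) (te2 s)) (AV _) => x.
    by rewrite transformN; [case: (s); rewrite ?expr1 ?expr0; ring|exact: test_function_intg].
  have [b fb] := fourier_exists (~~ s) (A2 s).
  have b0 : b = cst 0 %[ae mu].
    apply: (fourier_parity0 (A2 s) _ fb) => x.
    by rewrite Ap; case: (s); rewrite ?expr1 ?expr0; ring.
  have B : J (fun x => b x * transform (~~ s) eta x) = 0.
    rewrite (J_ae (g := fun=> 0)) ?J0//; first by apply: measurable_funM; [case: fb; case|case: (te2 (~~ s))].
    by apply: filterS b0 => x /= H xT; rewrite H// mul0r.
  have := fourier_parseval (A2 s) (AV s) fb te; rewrite B addr0 => P.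
  transitivity (c^-1 * (J (fun x => V s x * transform s eta x) + J (fun x => V (~~ s) x * transform s eta x))).
    rewrite -JD -?JZ; [|by apply: intgD; exact: sqint_mul|exact: sqint_mul|exact: sqint_mul].
    by apply: J_eq => x; rewrite /g; case: (s) => /=; ring.
  by rewrite O addr0 P mulrA mulVf ?mul1r// gt_eqF.
by apply: filterS => x /= H xT; apply/eqP; rewrite -subr_eq0 H.
Qed.

End fourier.

(** * Fourier multipliers and negative powers of the Laplacian *)

Section multipliers.
Context (R : realType) (n : nat).
Notation Rn := 'rV[R]_n.
Notation mu := (lebesgue_rV R n).
Notation J f := (Rintegral mu setT f).
Notation N2 u := (\int[mu]_x (u x ^+ 2)).
Notation intg f := (mu.-integrable [set: Rn] (EFin \o f)).
Notation c := ((2 * pi : R) ^+ n).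
Implicit Types (s : bool) (f g h u v w eta sigma : Rn -> R) (x y z xi : Rn) (d b : R).

Let c_gt0 : 0 < c.
Proof. by rewrite exprn_gt0// mulr_gt0// pi_gt0. Qed.

Lemma is_fourier_multiplierP sigma u g : sqint mu u -> is_fourier_multiplier sigma u g <->
  sqint mu g /\ forall s, exists v, fourier s u v /\ fourier s g (fun xi => sigma xi * v xi).
Proof.
move=> u2; split=> [[/sqintP g2 H]|[g2 H]].
  split => // s; have [|v [uv gv]] := H (trig s); first by case: s; [right|left].
  by exists v; split; apply/is_L2_transformP.
split; first exact/sqintP.
have Hs s : exists v, is_L2_transform (trig s) u v /\ is_L2_transform (trig s) g (fun xi => sigma xi * v xi).
  by have [v [uv gv]] := H s; exists v; split; apply/is_L2_transformP.
by move=> k [->|->]; [exact: (Hs false)|exact: (Hs true)].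
Qed.

(** Both transforms of the difference vanish, so the difference does by
  [fourier_lower]. *)
Lemma multiplier_unique sigma u g g' : sqint mu u ->
  is_fourier_multiplier sigma u g -> is_fourier_multiplier sigma u g' -> g = g' %[ae mu].
Proof.
move=> u2 /is_fourier_multiplierP-/(_ u2)[g2 H] /is_fourier_multiplierP-/(_ u2)[g2' H'].
have g2d : sqint mu (fun x => g x + (- 1) * g' x) by apply: sqintD => //; exact: sqintZ.
have d0 s : exists2 w, fourier s (fun x => g x + (- 1) * g' x) w & w = cst 0 %[ae mu].
  have [v [uv gv]] := H s; have [v' [uv' gv']] := H' s.
  exists (fun xi => sigma xi * v xi + (- 1) * (sigma xi * v' xi)); first exact: fourier_comb.
  have := fourier_unique u2 uv uv'; apply: filterS => xi /= E xiT.
  by rewrite E//; ring.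
have [w fw w0] := d0 false; have [w' fw' w0'] := d0 true.
have N0 (f : Rn -> R) : sqint mu f -> f = cst 0 %[ae mu] -> N2 f = 0.
  move=> z2 zz; rewrite (J_ae (g := fun=> 0)) ?J0//; first by apply: measurable_funX; case: z2.
  by apply: filterS zz => x /= E xT; rewrite E// expr0n.
have := fourier_lower g2d fw fw'; rewrite (N0 _ fw.1 w0) (N0 _ fw'.1 w0') !mulr0 addr0.
rewrite pmulr_rle0// => H0.
have : N2 (fun x => g x + (- 1) * g' x) = 0 by apply/eqP; rewrite eq_le H0 J_sqr_ge0.
move=> /(J_sqr_eq0 g2d); apply: filterS => x /= E xT.
by have := E xT; lra.
Qed.

Lemma multiplierZ sigma (a : R) u g : sqint mu u ->
  is_fourier_multiplier sigma u g -> is_fourier_multiplier sigma (fun x => a * u x) (fun x => a * g x).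
Proof.
move=> u2 /is_fourier_multiplierP-/(_ u2)[g2 H]; apply/is_fourier_multiplierP; first exact: sqintZ.
split; first exact: sqintZ.
have Z s f v : sqint mu f -> fourier s f v -> fourier s (fun x => a * f x) (fun x => a * v x).
  move=> f2 fv; apply: fourier_eq (fourier_comb (a - 1) f2 f2 fv fv) => x; ring.
move=> s; have [v [uv gv]] := H s; exists (fun x => a * v x); split; first exact: Z.
by apply: fourier_eq (Z _ _ _ g2 gv) => // x; ring.
Qed.

(** The transforms of an integrable function are bounded, so they may be
  multiplied by a symbol that is square integrable near the origin and bounded
  elsewhere; [fourier_inversion] provides a function with the resulting
  transforms. *)
Lemma multiplier_exists sigma (S : R) u : measurable_fun setT sigma ->
  (forall xi, sigma (- xi) = sigma xi) -> (forall xi, ~ cube 1 xi -> `|sigma xi| <= 1) ->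
  intg (fun xi => \1_(cube 1) xi * sigma xi ^+ 2) ->
  J (fun xi => \1_(cube 1) xi * sigma xi ^+ 2) <= S ->
  intg u -> sqint mu u -> exists2 g, is_fourier_multiplier sigma u g &
  c * N2 g <= 4 * (S * J (fun x => `|u x|) ^+ 2 + c * N2 u).
Proof.
move=> ms sN s1 si sS ui u2; pose B := J (fun x => `|u x|); have B0 : 0 <= B by exact: J_ge0.
pose A s xi := sigma xi * transform s u xi.
have T2 s := transform_sqint s ui u2.
have dom s xi : A s xi ^+ 2 <= B ^+ 2 * (\1_(cube 1) xi * sigma xi ^+ 2) + transform s u xi ^+ 2.
  rewrite /A exprMn indicE; have [xc|xc] := pselect (cube 1 xi).
    rewrite mem_set// mul1r -[leLHS]addr0 lerD ?sqr_ge0// mulrC ler_wpM2r ?sqr_ge0//.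
    by apply: sqr_le_norm; exact: transform_bounded.
  rewrite memNset// mul0r mulr0 add0r ler_piMl ?sqr_ge0// -(expr1n _ 2).
  by apply: sqr_le_norm; exact: s1.
have di s : intg (fun xi => B ^+ 2 * (\1_(cube 1) xi * sigma xi ^+ 2) + transform s u xi ^+ 2).
  by apply: intgD; [exact: intgZ|case: (T2 s)].
have A2 s : sqint mu (A s).
  split; first by apply: measurable_funM => //; case: (T2 s).
  apply: (intg_le _ _ (di s)).
    by apply: measurable_funX; apply: measurable_funM => //; case: (T2 s).
  by move=> xi; rewrite ger0_norm ?sqr_ge0.
have AN s : N2 (A s) <= S * B ^+ 2 + c * N2 u.
  apply: (@le_trans _ _ (J (fun xi => B ^+ 2 * (\1_(cube 1) xi * sigma xi ^+ 2) + transform s u xi ^+ 2))).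
    by apply: J_le => //; case: (A2 s).
  rewrite JD; [|exact: intgZ|by case: (T2 s)].
  rewrite JZ// mulrC lerD//; last exact: bessel.
  by rewrite ler_wpM2r ?sqr_ge0.
have Ap s x : A s (- x) = (-1) ^+ s * A s x by rewrite /A sN transformN//; ring.
have /choice[V VP] : forall s, exists v, fourier s (A s) v by move=> s; exact: fourier_exists.
pose g x := c^-1 * (V false x + V true x).
have g2 : sqint mu g by apply: sqintZ; apply: sqintD; [case: (VP false)|case: (VP true)].
have gA := fourier_inversion A2 Ap VP.
exists g.
  apply/is_fourier_multiplierP => //; split => // s; exists (transform s u).
  by split; [exact: fourier_transform|exact: gA].
have := fourier_lower g2 (gA false) (gA true); have := AN false; have := AN true.
by move: (N2 (A false)) (N2 (A true)) (c * N2 g) (S * B ^+ 2 + _) => p q r t; lra.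
Qed.

Let sym b xi : R := enorm xi `^ (- (2 * (b / 2))).

Let symE b xi : sym b xi = enorm xi `^ (- b).
Proof. by rewrite /sym; congr (_ `^ - _); field. Qed.

Let pow1R (r : R) : 1 `^ r = 1.
Proof. by rewrite powR1. Qed.

Let enorm_measurable : measurable_fun setT (@enorm R n).
Proof.
rewrite (_ : @enorm R n = fun x => (dotv x x) `^ 2^-1); last first.
  by apply/funext => x; rewrite powR12_sqrt// sumr_ge0// => i _; rewrite -expr2 sqr_ge0.
by apply: (measurableT_comp (measurable_powR 2^-1)); exact: measurable_dotv.
Qed.

Let sym_measurable b : measurable_fun setT (sym b).
Proof. exact: (measurableT_comp (measurable_powR _) enorm_measurable). Qed.

Let enormZ d xi : 0 <= d -> enorm (d *: xi) = d * enorm xi.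
Proof.
move=> d0; rewrite /enorm -[in RHS](ger0_norm d0) -sqrtr_sqr -sqrtrM ?sqr_ge0//.
by congr Num.sqrt; rewrite /dotv mulr_sumr; apply: eq_bigr => i _; rewrite !mxE; ring.
Qed.

Let enorm_le_cube r xi : ~ cube r xi -> r <= enorm xi.
Proof.
move=> xr; have [//|er] := lerP r (enorm xi); exfalso; apply: xr; apply/cubeP => i.
by apply: le_trans (coord_le_enorm xi i) (ltW er).
Qed.

(** The cube is cut into dyadic shells. Halving the radius multiplies the
  integral by [2 `^ (2 * b - n)], which is less than one, so the integrals
  over the shells are dominated by a geometric series. *)
Let sym_near0 b : 0 < b -> b < n%:R / 2 ->
  intg (fun xi => \1_(cube 1) xi * sym b xi ^+ 2).
Proof.
move=> b0 bn; pose q := (2 `^ b) ^+ 2 * 2 ^- n : R.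
have q0 : 0 <= q by rewrite mulr_ge0 ?sqr_ge0// invr_ge0 exprn_ge0.
have q1 : q < 1.
  rewrite ltr_pdivrMr ?exprn_gt0// mul1r -!powR_mulrn ?powR_ge0// -powRrM.
  have -> : n%:R = b * 2 + (n%:R - b * 2) :> R by ring.
  rewrite powRD ?pnatr_eq0 ?implybT// ltr_pMr ?powR_gt0//.
  have d0 : 0 < n%:R - b * 2 by lra.
  by rewrite -[ltLHS](pow1R (n%:R - b * 2)) gt0_ltr_powR ?nnegrE// ltr1n.
pose shell N xi := \1_(cube 1 `\` cube (2 ^- N)) xi * sym b xi ^+ 2 : R.
have mshell N : measurable_fun setT (shell N).
  apply: measurable_funM; last exact: measurable_funX.
  by apply: measurable_indic; apply: measurableD; exact: measurable_cube.
have scale2 xi : sym b xi ^+ 2 = (2 `^ b) ^+ 2 * sym b (2 *: xi + 0) ^+ 2.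
  rewrite addr0 -exprMn; congr (_ ^+ 2); rewrite !symE enormZ// powRM ?sqrtr_ge0//.
  by rewrite mulrA -powRD ?subrr ?powRr0 ?mul1r// pnatr_eq0 implybT.
have cube2 r xi : cube r (2 *: xi + 0) <-> cube (r / 2) xi.
  rewrite addr0; split => /cubeP H; apply/cubeP => i; have := H i; rewrite mxE normrM ger0_norm//; lra.
have cube_mono r r' : r <= r' -> forall xi, cube r xi -> cube r' xi.
  by move=> rr xi /cubeP H; apply/cubeP => i; exact: le_trans (H i) rr.
have pow_le1 N : 2 ^- N <= 1 :> R by rewrite invf_le1 ?exprn_gt0// exprn_ege1// ler1n.
have powS N : 2 ^- N.+1 = 2 ^- N / 2 :> R by rewrite exprS invfM mulrC.
have pow1 : 2 ^- 1 = 1 / 2 :> R by rewrite expr1 mul1r.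
have shellS N xi : shell N.+1 xi = shell 1%N xi + (2 `^ b) ^+ 2 * shell N (2 *: xi + 0).
  transitivity ((\1_(cube 1 `\` cube (2 ^- 1)) xi + \1_(cube 1 `\` cube (2 ^- N)) (2 *: xi + 0)) * sym b xi ^+ 2 : R); last first.
    by rewrite /shell [sym b xi ^+ 2]scale2; ring.
  rewrite /shell; congr (_ * _); rewrite !indicE -natrD; congr (_%:R).
  have [x2|x2] := pselect (cube (1 / 2) xi).
    have x1 : cube 1 xi by apply: cube_mono x2; lra.
    rewrite pow1 [in X in (X + _)%N]memNset ?add0n; last by case.
    congr (nat_of_bool _); apply/idP/idP; rewrite !inE => -[_ Hn]; split.
    - exact/cube2.
    - by move=> H; apply: Hn; rewrite powS; exact/cube2.
    - exact: x1.
    - by move=> H; apply: Hn; apply/cube2; rewrite -powS.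
  rewrite [in X in (_ + X)%N]memNset ?addn0; last by case=> /cube2.
  congr (nat_of_bool _); apply/idP/idP; rewrite !inE => -[x1 Hn]; split.
  - exact: x1.
  - by rewrite pow1.
  - exact: x1.
  - by move=> H; apply: x2; apply: cube_mono H; rewrite powS ler_pM2r// invr_gt0.
have i1 : intg (shell 1%N).
  apply: (bounded_support_intg (r := 1) (M := (2 `^ b) ^+ 2)) => //.
    by move=> x xc; rewrite /shell indicE memNset ?mul0r// => -[].
  move=> x; rewrite /shell indicE; have [xs|xs] := pselect ((cube 1 `\` cube (2 ^- 1)) x); last first.
    by rewrite memNset// mul0r normr0 sqr_ge0.
  rewrite mem_set// mul1r ger0_norm ?sqr_ge0//; apply: sqr_le_norm; rewrite ger0_norm ?powR_ge0// symE.
  have [_ /enorm_le_cube] := xs; rewrite expr1 => ex.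
  have e0 : 0 < enorm x by lra.
  rewrite powRN -[leLHS]mul1r ler_pdivrMr ?powR_gt0// -powRM// ?(ltW e0)//.
  have e1 : 1 <= 2 * enorm x by lra.
  by rewrite -[leLHS](pow1R b); apply: ge0_ler_powR; rewrite ?nnegrE ?(ltW b0) ?mulr_ge0 ?(ltW e0).
have iN N : intg (shell N) /\ J (shell N) <= J (shell 1%N) / (1 - q).
  have J1 : 0 <= J (shell 1%N) by apply: J_ge0 => x; rewrite /shell mulr_ge0 ?sqr_ge0// indicE.
  elim: N => [|N [iN JN]].
    have -> : shell 0%N = fun=> 0.
      apply/funext => x; rewrite /shell indicE memNset ?mul0r// expr0 invr1.
      by case.
    by split; [exact: intg0|rewrite J0 divr_ge0// subr_ge0 ltW].
  have n2 : (2 : R) != 0 by rewrite pnatr_eq0.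
  have ia := intg_affine 0 n2 iN; rewrite (funext (shellS N)).
  split; first by apply: intgD; [exact: i1|exact: intgZ].
  rewrite JD; [|exact: i1|exact: intgZ].
  rewrite (JZ _ ia) (J_affine 0 n2 iN) mulrA [`|2|]ger0_norm// -/q.
  have -> : J (shell 1%N) / (1 - q) = J (shell 1%N) + q * (J (shell 1%N) / (1 - q)).
    by field; rewrite subr_eq0 gt_eqF.
  by rewrite lerD2l ler_wpM2l.
have [||||//] := @J_fatou _ _ _ mu shell (fun xi => \1_(cube 1) xi * sym b xi ^+ 2) (J (shell 1%N) / (1 - q)).
- by move=> N; have [] := iN N.
- by move=> N x; rewrite /shell mulr_ge0 ?sqr_ge0// indicE.
- move=> x; apply: cvg_near_cst; have [x0|/eqP/rowP xn0] := eqVneq x 0.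
    apply: nearW => N; rewrite /shell symE /enorm x0 /dotv big1 ?sqrtr0 ?powR0 ?expr0n ?mulr0 ?oppr_eq0 ?gt_eqF//.
    by move=> i _; rewrite !mxE mul0r.
  have [i xi0] : exists i, x 0 i != 0.
    by apply: contrapT => H; apply: xn0 => i; rewrite mxE; apply/eqP/negP => /negP xi; apply: H; exists i.
  exists (Num.bound `|x 0 i|^-1) => // N /= HN; rewrite /shell; congr (_ * _); rewrite !indicE.
  congr (nat_of_bool _)%:R; apply/idP/idP; rewrite !inE; first by case.
  move=> xc; split; first exact: xc.
  move=> /cubeP/(_ i).
  apply/negP; rewrite -ltNge invf_plt ?posrE ?exprn_gt0 ?normr_gt0//.
  apply: lt_le_trans (archi_boundP _) _; first by rewrite invr_ge0.
  by rewrite -natrX ler_nat (leq_trans HN)// ltnW// ltn_expl.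
- by move=> N; have [] := iN N.
Qed.

(** The constant only depends on the exponent, so the bound is uniform under
  translations of [u]. *)
Lemma Lop_exists b : 0 < b -> b < n%:R / 2 -> exists2 C, 0 <= C &
  forall u, intg u -> sqint mu u -> exists2 g, is_Lop (b / 2) u g &
    N2 g <= C * (J (fun x => `|u x|) ^+ 2 + N2 u).
Proof.
move=> b0 bn; pose S := J (fun xi => \1_(cube 1) xi * sym b xi ^+ 2).
have S0 : 0 <= S by apply: J_ge0 => x; rewrite mulr_ge0 ?sqr_ge0// indicE.
exists (4 * (S + c) / c); first by rewrite mulr_ge0 ?invr_ge0 ?(ltW c_gt0)// mulr_ge0// addr_ge0// ltW.
move=> u ui u2; have [||g gP gN] := @multiplier_exists (sym b) S u (sym_measurable b) _ _ (sym_near0 b0 bn) (lexx _) ui u2.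
- by move=> xi; rewrite /sym enormN.
- move=> xi /enorm_le_cube xi1; rewrite symE powRN ger0_norm ?invr_ge0 ?powR_ge0//.
  have e0 : 0 < enorm xi by lra.
  rewrite invf_le1 ?powR_gt0// -(pow1R b).
  by rewrite ge0_ler_powR ?nnegrE ?(ltW b0) ?(ltW e0).
exists g; first exact: gP.
rewrite mulrAC ler_pdivlMr// mulrC; apply: le_trans gN _; rewrite -mulrA ler_wpM2l//.
have := J_sqr_ge0 mu u; have := sqr_ge0 (J (fun x => `|u x|)).
move: c_gt0; move: c (J (fun x => `|u x|) ^+ 2) (N2 u) => d p q d0 p0 q0.
rewrite (_ : (S + d) * (p + q) = S * p + d * q + (S * q + d * p)); last by ring.
by rewrite lerDl addr_ge0// mulr_ge0// ltW.
Qed.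

End multipliers.

(** * Fourth powers *)

Section quartic.
Context (R : realType) (n : nat).
Notation Rn := 'rV[R]_n.
Notation mu := (lebesgue_rV R n).
Notation J f := (Rintegral mu setT f).
Notation N2 u := (\int[mu]_x (u x ^+ 2)).
Notation intg f := (mu.-integrable [set: Rn] (EFin \o f)).
Implicit Types (u v w : Rn -> R).

(** Fourth powers are squares of squares, so that the theory of square
  integrable functions applies to them. *)
Definition quart u := measurable_fun setT u /\ sqint mu (fun x => u x ^+ 2).

Definition N4 u := N2 (fun x => u x ^+ 2).

Let pow4E u x : `|u x| `^ 4 = (u x ^+ 2) ^+ 2.
Proof. by rewrite (powR_mulrn 4)// -exprM -normrX ger0_norm// (exprM (u x) 2 2) sqr_ge0. Qed.

Let LnormE u : ('N[mu]_4%:E [EFin \o u] = (\int[mu]_x ((u x ^+ 2) ^+ 2)%:E) `^ 4^-1)%E.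
Proof.
rewrite unlock; congr (_ `^ _)%E; apply: eq_integral => x _ /=.
by rewrite pow4E.
Qed.

Lemma quartP u : u \in Lfun mu 4%:E <-> quart u.
Proof.
split=> [u4|[mu_ [_ ui]]].
  have m : measurable_fun setT u by have /sub_Lfun_mfun := u4; rewrite inE.
  split => //; split; first exact: measurable_funX.
  apply: ge0_intg; [by do 2 apply: measurable_funX|by move=> x; exact: sqr_ge0|].
  have := u4; rewrite inE => /andP[_]; rewrite inE/= /finite_norm LnormE.
  by apply: lty_poweRy; rewrite invr_eq0.
rewrite inE; apply/andP; split; rewrite inE//= /finite_norm LnormE.
by apply: poweR_lty; rewrite (J_EFin ui) ltry.
Qed.

Lemma L4norm_quart u : quart u -> (L4norm u ^+ 2) ^+ 2 = N4 u.
Proof.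
move=> [_ [_ ui]]; rewrite /L4norm LnormE fine_poweR (J_EFin ui) /=.
rewrite -exprM -powR_mulrn ?powR_ge0// -powRrM mulVf// powRr1//; exact: J_sqr_ge0.
Qed.

Lemma L4norm_not_quart u : measurable_fun setT u -> ~ quart u -> L4norm u = 0.
Proof.
move=> mu_ nq; rewrite /L4norm LnormE fine_poweR.
have -> : (\int[mu]_x ((u x ^+ 2) ^+ 2)%:E = +oo)%E.
  apply/eqP; rewrite eq_le leey/= leNgt; apply/negP => lt; apply: nq; split => //.
  split; first exact: measurable_funX.
  by apply: ge0_intg => //; [do 2 apply: measurable_funX|move=> x; exact: sqr_ge0].
by rewrite powR0// invr_eq0.
Qed.

Lemma N4_ge0 u : 0 <= N4 u.
Proof. exact: J_sqr_ge0. Qed.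

Lemma N4_eq0 u : quart u -> N4 u = 0 -> u = cst 0 %[ae mu].
Proof.
move=> [_ u2] /(J_sqr_eq0 u2); apply: filterS => x /= H xT.
by apply/eqP; rewrite -sqrf_eq0; apply/eqP; exact: H.
Qed.

Lemma N4_gt0_nonzero u : measurable_fun setT u -> 0 < N4 u -> nonzero u.
Proof.
move=> mu_ N0 u0; move: N0.
rewrite /N4 (J_ae (g := fun=> 0) _ _ _) ?J0 ?ltxx//; first by do 2 apply: measurable_funX.
by apply: filterS u0 => x /= H xT; rewrite H// !expr0n.
Qed.

Lemma quart_le u v : measurable_fun setT u -> (forall x, `|u x| <= `|v x|) -> quart v -> quart u.
Proof.
move=> mu_ uv [mv v2]; split => //; apply: (sqint_le _ _ v2); first exact: measurable_funX.
by move=> x; rewrite !normrX lerXn2r ?nnegrE.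
Qed.

Lemma quart_ae u v : measurable_fun setT v -> u = v %[ae mu] -> quart u -> quart v.
Proof.
move=> mv uv [mu_ u2]; split => //; apply: sqint_ae u2; first exact: measurable_funX.
by apply: filterS uv => x /= H xT; rewrite H.
Qed.

Lemma N4_ae u v : measurable_fun setT u -> measurable_fun setT v -> u = v %[ae mu] -> N4 u = N4 v.
Proof.
move=> mu_ mv uv; apply: J_ae; [by do 2 apply: measurable_funX|by do 2 apply: measurable_funX|].
by apply: filterS uv => x /= H xT; rewrite H.
Qed.

Lemma quartZ (a : R) u : quart u -> quart (fun x => a * u x).
Proof.
move=> [mu_ u2]; split; first exact: measurable_funM.
have := sqintZ (a ^+ 2) u2; congr sqint; apply/funext => x; by rewrite exprMn.
Qed.

Lemma N4Z (a : R) u : quart u -> N4 (fun x => a * u x) = (a ^+ 2) ^+ 2 * N4 u.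
Proof. by move=> [_ u2]; rewrite /N4 -J_sqrZ//; apply: J_eq => x; ring. Qed.

Lemma quart_mul u v : quart u -> quart v -> sqint mu (fun x => u x * v x).
Proof.
move=> [mu_ u2] [mv v2]; split; first exact: measurable_funM.
by apply: intg_eq (sqint_mul u2 v2) => x; rewrite exprMn.
Qed.

Lemma quart_mul_le u v : quart u -> quart v -> N2 (fun x => u x * v x) ^+ 2 <= N4 u * N4 v.
Proof.
move=> [mu_ u2] [mv v2]; apply: le_trans (cauchy_schwarz u2 v2).
by rewrite (J_eq mu (g := fun x => u x ^+ 2 * v x ^+ 2))// => x; rewrite exprMn.
Qed.

Lemma cube_intg u v : quart u -> quart v -> intg (fun x => u x ^+ 3 * v x).
Proof.
move=> u4 v4; apply: intg_eq (sqint_mul u4.2 (quart_mul u4 v4)) => x; ring.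
Qed.

Lemma quartD u v : quart u -> quart v -> quart (fun x => u x + v x).
Proof.
move=> u4 v4; split; first by apply: measurable_funD; [case: u4|case: v4].
have := sqintD u4.2 (sqintD (sqintZ 2 (quart_mul u4 v4)) v4.2).
by congr sqint; apply/funext => x; ring.
Qed.

Lemma quartB u v : quart u -> quart v -> quart (fun x => u x - v x).
Proof.
move=> u4 v4; have := quartD u4 (quartZ (-1) v4).
by congr quart; apply/funext => x; ring.
Qed.

Lemma quart_affine (l : R) y u : l != 0 -> quart u -> quart (fun x => u (l *: x + y)).
Proof.
move=> l0 [mu_ u2]; split; first exact: measurable_affine_comp.
exact: (sqint_affine y l0 u2).
Qed.

Lemma N4_affine (l : R) y u : l != 0 -> quart u -> N4 (fun x => u (l *: x + y)) = `|l| ^- n * N4 u.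
Proof. by move=> l0 [_ [_ u2]]; rewrite /N4 -(J_affine y l0 u2). Qed.

Lemma quart_translate y u : quart u -> quart (fun x => u (x + y)).
Proof.
move=> u4; have := quart_affine y (oner_neq0 R) u4.
by congr quart; apply/funext => x; rewrite scale1r.
Qed.

(** The difference of cubes is the product of the difference and a quadratic
  factor, to which Cauchy--Schwarz is applied twice. *)
Lemma cube_diff_le u v w : quart u -> quart v -> quart w ->
  (J (fun x => (u x ^+ 3 - v x ^+ 3) * w x) ^+ 2) ^+ 2 <=
  (16 * (N4 u + N4 v)) ^+ 2 * (N4 (fun x => u x - v x) * N4 w).
Proof.
move=> u4 v4 w4; have d4 := quartB u4 v4.
pose q x := u x ^+ 2 + (u x * v x + v x ^+ 2).
have q2 : sqint mu q by apply: sqintD; [case: u4|apply: sqintD; [exact: quart_mul|case: v4]].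
have dw2 := quart_mul d4 w4.
rewrite (J_eq mu (g := fun x => q x * ((u x - v x) * w x))); last by move=> x; rewrite /q; ring.
apply: (@le_trans _ _ ((N2 q * N2 (fun x => (u x - v x) * w x)) ^+ 2)).
  have := cauchy_schwarz q2 dw2 => H.
  by apply: sqr_le_norm; rewrite ger0_norm ?sqr_ge0.
rewrite exprMn ler_pM ?sqr_ge0//; last exact: quart_mul_le.
apply: sqr_le_norm; rewrite ger0_norm ?J_sqr_ge0//.
have i1 := u4.2.2; have i2 := v4.2.2.
rewrite /N4 -JD// -JZ; last exact: intgD.
apply: J_le; [by case: q2|by apply: intgZ; exact: intgD|].
move=> x; rewrite /q; move: (u x) (v x) => a b.
have h1 := sqr_ge0 (a - b); have h2 := sqr_ge0 (a + b).
have ab : (a ^+ 2 + (a * b + b ^+ 2)) ^+ 2 <= (2 * (a ^+ 2 + b ^+ 2)) ^+ 2.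
  apply: sqr_le_norm; rewrite ger0_norm; rewrite !expr2 in h1 h2 *; lra.
apply: le_trans ab _; have := sqr_ge0 (a ^+ 2 - b ^+ 2); have := sqr_ge0 (a ^+ 2); have := sqr_ge0 (b ^+ 2).
by move: (a ^+ 2) (b ^+ 2) => p r; rewrite !expr2; lra.
Qed.

End quartic.

(** * The energy and its cutoffs *)

Section energies.
Context (R : realType) (n : nat) (omega : R).
Context (omega_gt0 : 0 < omega).
Notation Rn := 'rV[R]_n.
Notation mu := (lebesgue_rV R n).
Notation J f := (Rintegral mu setT f).
Notation N2 u := (\int[mu]_x (u x ^+ 2)).
Notation intg f := (mu.-integrable [set: Rn] (EFin \o f)).
Implicit Types (u v w : Rn -> R) (g h : 'I_n -> Rn -> R).

Definition dirichlet g := \sum_i N2 (g i).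

Definition form u g v h := \sum_i J (fun x => g i x * h i x) + omega * J (fun x => u x * v x).

Definition H1energy u g := dirichlet g + omega * N2 u.

Lemma dirichlet_ge0 g : 0 <= dirichlet g.
Proof. by apply: sumr_ge0 => i _; exact: J_sqr_ge0. Qed.

Lemma N2_le_dirichlet g i : N2 (g i) <= dirichlet g.
Proof.
by rewrite /dirichlet (bigD1 i)//= lerDl sumr_ge0// => j _; exact: J_sqr_ge0.
Qed.

Lemma H1energy_ge0 u g : 0 <= H1energy u g.
Proof. by rewrite addr_ge0 ?dirichlet_ge0// mulr_ge0 ?J_sqr_ge0// ltW. Qed.

Lemma dirichlet_le_H1energy u g : dirichlet g <= H1energy u g.
Proof. by rewrite lerDl mulr_ge0 ?J_sqr_ge0// ltW. Qed.

Lemma N2_le_H1energy u g : omega * N2 u <= H1energy u g.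
Proof. by rewrite lerDr dirichlet_ge0. Qed.

Lemma form_self u g : form u g u g = H1energy u g.
Proof. by []. Qed.

Lemma H1energyB u g v h : weak_gradient u g -> weak_gradient v h ->
  H1energy (fun x => u x - v x) (fun i x => g i x - h i x) =
  H1energy u g - 2 * form u g v h + H1energy v h.
Proof.
move=> [u2 ug] [v2 vh].
have E (f k : Rn -> R) : sqint mu f -> sqint mu k ->
    N2 (fun x => f x - k x) = N2 f - 2 * J (fun x => f x * k x) + N2 k.
  move=> f2 k2; rewrite (J_eq mu (g := fun x => (f x + (-1) * k x) ^+ 2)); last by move=> x; ring.
  rewrite (J_sqrD f2 (sqintZ (-1) k2)) (J_sqrZ (-1) k2).
  rewrite (J_eq mu (f := fun x => f x * (-1 * k x)) (g := fun x => -1 * (f x * k x))); last by move=> x; ring.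
  by rewrite JZ; [ring|exact: sqint_mul].
rewrite /H1energy /form /dirichlet E//.
rewrite (eq_bigr (fun i => N2 (g i) - 2 * J (fun x => g i x * h i x) + N2 (h i))); last first.
  by move=> i _; rewrite E//; [case: (ug i)|case: (vh i)].
by rewrite big_split/= sumrB -mulr_sumr; ring.
Qed.

Lemma H1energyZ (a : R) u g : weak_gradient u g ->
  H1energy (fun x => a * u x) (fun i x => a * g i x) = a ^+ 2 * H1energy u g.
Proof.
move=> [u2 ug]; rewrite /H1energy /dirichlet J_sqrZ// mulrDr mulr_sumr; congr (_ + _); last by ring.
by apply: eq_bigr => i _; rewrite J_sqrZ//; case: (ug i).
Qed.

Lemma N2_affine (l : R) y u : l != 0 -> sqint mu u -> N2 (fun x => u (l *: x + y)) = `|l| ^- n * N2 u.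
Proof. by move=> l0 [_ u2]; rewrite -(J_affine y l0 u2). Qed.

Lemma H1energy_scale (l : R) u g : l != 0 -> weak_gradient u g ->
  H1energy (fun x => u (l *: x + 0)) (fun i x => l * g i (l *: x + 0)) =
  `|l| ^- n * (l ^+ 2 * dirichlet g + omega * N2 u).
Proof.
move=> l0 [u2 ug]; rewrite /H1energy /dirichlet N2_affine// mulrDr !mulr_sumr; congr (_ + _); last by ring.
apply: eq_bigr => i _; have [g2 _] := ug i.
by rewrite (J_sqrZ l (sqint_affine 0 l0 g2)) N2_affine//; ring.
Qed.

Lemma H1energy_translate y u g : weak_gradient u g ->
  H1energy (fun x => u (x + y)) (fun i x => g i (x + y)) = H1energy u g.
Proof.
move=> [u2 ug]; rewrite /H1energy /dirichlet N2_translate//; congr (_ + _).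
by apply: eq_bigr => i _; rewrite N2_translate//; case: (ug i).
Qed.

Lemma form_ae u g v h h' : weak_gradient u g -> weak_gradient v h -> weak_gradient v h' ->
  form u g v h = form u g v h'.
Proof.
move=> [u2 ug] vh vh'; congr (_ + _); apply: eq_bigr => i _; apply: J_ae.
- by apply: measurable_funM; [case: (ug i) => -[]|case: (vh.2 i) => -[]].
- by apply: measurable_funM; [case: (ug i) => -[]|case: (vh'.2 i) => -[]].
- by apply: filterS (weak_gradient_unique vh vh' i) => x /= H xT; rewrite H.
Qed.

Lemma formC u g v h : form u g v h = form v h u g.
Proof.
congr (_ + _ * _); last by apply: J_eq => x; rewrite mulrC.
by apply: eq_bigr => i _; apply: J_eq => x; rewrite mulrC.
Qed.

Lemma H1energy_ae u g v h : weak_gradient u g -> weak_gradient v h -> u = v %[ae mu] ->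
  H1energy u g = H1energy v h.
Proof.
move=> ug vh uv; have vg := weak_gradient_ae vh.1.1 uv ug.
rewrite -[RHS]form_self (form_ae vh vh vg) formC (form_ae vg vh vg) form_self.
congr (_ + _ * _); apply: J_ae; [by apply: measurable_funX; case: ug => -[]|by apply: measurable_funX; case: vh => -[]|].
by apply: filterS uv => x /= H xT; rewrite H.
Qed.

Lemma form_cvg (u_ : nat -> Rn -> R) (g_ : nat -> 'I_n -> Rn -> R) u g v h :
  weak_gradient v h -> weakly_cvg mu u_ u -> (forall i, weakly_cvg mu (g_ ^~ i) (g i)) ->
  form (u_ k) (g_ k) v h @[k --> \oo] --> form u g v h.
Proof.
move=> [v2 vh] cu cg; apply: rcvgD; last by apply: rcvgZ; exact: cu.
by apply: rcvg_sum => i; apply: cg; case: (vh i).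
Qed.

Definition cutoff_at (k : nat) (x : Rn) : R := cutoff (k.+1%:R^-1 *: x + 0).

Lemma smooth_cutoff_at k : smooth (cutoff_at k).
Proof. by apply: smooth_affine; exact: smooth_cutoff. Qed.

Lemma cutoff_at_bounded k x : `|cutoff_at k x| <= 1.
Proof. by rewrite ger0_norm ?cutoff_ge0 ?cutoff_le1. Qed.

Lemma cutoff_at_eq1 k (x : Rn) : cube k.+1%:R x -> cutoff_at k x = 1.
Proof.
move=> /cubeP H; apply: cutoff_eq1; apply/cubeP => i; rewrite addr0 mxE normrM normfV [`|k.+1%:R|]ger0_norm//.
by rewrite ler_pdivrMl// mulr1.
Qed.

Lemma cutoff_at_eq0 k (x : Rn) : ~ cube (2 * k.+1%:R) x -> cutoff_at k x = 0.
Proof.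
move=> H; apply: cutoff_eq0 => /cubeP H2; apply: H; apply/cubeP => i.
have := H2 i; rewrite addr0 mxE normrM normfV [`|k.+1%:R|]ger0_norm// ler_pdivrMl// mulrC; exact.
Qed.

Lemma cutoff_pderiv_bounded : exists2 M, 0 <= M & forall i (x : Rn), `|pderiv i (@cutoff R n) x| <= M.
Proof.
have H i : exists M, 0 <= M /\ forall x, `|pderiv i (@cutoff R n) x| <= M.
  by have [M M0 MP] := test_function_bounded (test_function_pderiv i (test_function_cutoff R n)); exists M.
have [M MP] := choice H; exists (\sum_i M i); first by apply: sumr_ge0 => i _; case: (MP i).
move=> i x; have [_ /(_ x)] := MP i; move/le_trans; apply; rewrite (bigD1 i)//= lerDl.
by apply: sumr_ge0 => j _; case: (MP j).
Qed.

Lemma cutoff_at_pderiv k i x : pderiv i (cutoff_at k) x = k.+1%:R^-1 * pderiv i (@cutoff R n) (k.+1%:R^-1 *: x + 0).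
Proof. by rewrite /cutoff_at (pderiv_affine i _ 0 (@smooth_cutoff R n)). Qed.

Lemma cutoff_at_pderiv_bounded (M : R) k i x : (forall i (x : Rn), `|pderiv i (@cutoff R n) x| <= M) ->
  `|pderiv i (cutoff_at k) x| <= M.
Proof.
move=> MP; have M0 : 0 <= M by apply: le_trans (MP i 0).
rewrite cutoff_at_pderiv normrM -[M]mul1r; apply: ler_pM => //.
by rewrite normfV ger0_norm// invf_le1 ?ler1n.
Qed.

Lemma cutoff_at_cvg (x : Rn) : \forall k \near \oo, cutoff_at k x = 1.
Proof.
have : (\bigcup_k cube (n := n) k%:R) x by rewrite (bigcup_cube R n).
move=> [N _ /cubeP xN]; exists N => // k /= Nk; apply: cutoff_at_eq1; apply/cubeP => i.
by apply: le_trans (xN i) _; rewrite ler_nat (leq_trans Nk).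
Qed.

Lemma cutoff_at_sqint_cvg u : sqint mu u -> N2 (fun x => cutoff_at k x * u x - u x) @[k --> \oo] --> 0.
Proof.
move=> u2; have [||||_] := @J_dct _ _ _ mu (fun k x => (cutoff_at k x * u x - u x) ^+ 2) (fun=> 0) (fun x => u x ^+ 2).
- move=> k; apply: measurable_funX; apply: measurable_funB; last by case: u2.
  by apply: measurable_funM; [exact: smooth_measurable (smooth_cutoff_at k)|case: u2].
- move=> x; apply: cvg_near_cst; apply: filterS (cutoff_at_cvg x) => k ->.
  by rewrite mul1r subrr expr0n.
- move=> k x; rewrite ger0_norm ?sqr_ge0// -[leRHS]real_normK ?num_real//; apply: sqr_le_norm.
  rewrite -[X in _ - X]mul1r -mulrBl normrM ler_piMl//.
  have := cutoff_ge0 (k.+1%:R^-1 *: x + 0); have := cutoff_le1 (k.+1%:R^-1 *: x + 0).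
  by rewrite /cutoff_at ler_norml; move: (cutoff _) => t *; apply/andP; split; lra.
- by case: u2.
by rewrite J0.
Qed.

Definition cut_gradient k u g : 'I_n -> Rn -> R :=
  fun i x => cutoff_at k x * g i x + pderiv i (cutoff_at k) x * u x.

Lemma weak_gradient_cut k u g : weak_gradient u g ->
  weak_gradient (fun x => cutoff_at k x * u x) (cut_gradient k u g).
Proof.
have [M M0 MP] := cutoff_pderiv_bounded.
apply: (weak_gradient_cutoff (M := Num.max 1 M) (smooth_cutoff_at k)) => [x|i x].
  by rewrite le_max cutoff_at_bounded.
by rewrite le_max (cutoff_at_pderiv_bounded k i x MP) orbT.
Qed.

Lemma cut_gradient_cvg u g i : weak_gradient u g ->
  N2 (fun x => cut_gradient k u g i x - g i x) @[k --> \oo] --> 0.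
Proof.
move=> [u2 ug]; have [g2 _] := ug i; have [M M0 MP] := cutoff_pderiv_bounded.
have c1 := cutoff_at_sqint_cvg g2.
have mp k : measurable_fun setT (pderiv i (cutoff_at k)).
  by apply: smooth_measurable; apply: smooth_pderiv; exact: smooth_cutoff_at.
have d2 k : sqint mu (fun x => pderiv i (cutoff_at k) x * u x).
  by apply: (sqint_bounded_mul (mp k) (M := M)) => // x; exact: cutoff_at_pderiv_bounded.
have e2 k : sqint mu (fun x => cutoff_at k x * g i x - g i x).
  apply: sqintB => //; apply: (sqint_bounded_mul (M := 1)) => //; last exact: cutoff_at_bounded.
  exact: smooth_measurable (smooth_cutoff_at k).
have c2 : N2 (fun x => pderiv i (cutoff_at k) x * u x) @[k --> \oo] --> 0.
  have : (M ^+ 2 * N2 u) * (k.+1%:R^-1 * k.+1%:R^-1) @[k --> \oo] --> (M ^+ 2 * N2 u) * (0 * 0).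
    by apply: rcvgZ; apply: rcvgM; exact: cvg_invS0.
  rewrite mulr0 mulr0; apply: rcvg_squeeze0 => k; rewrite J_sqr_ge0/= mulrAC -JZ; last by case: u2.
  apply: J_le; [by case: (d2 k)|by apply: intgZ; case: u2|].
  move=> x; rewrite exprMn ler_wpM2r ?sqr_ge0// cutoff_at_pderiv exprMn mulrC -expr2 ler_wpM2r ?sqr_ge0//.
  exact: sqr_le_norm.
have : 2 * N2 (fun x => cutoff_at k x * g i x - g i x) +
       2 * N2 (fun x => pderiv i (cutoff_at k) x * u x) @[k --> \oo] --> (2 * 0 + 2 * 0 : R).
  by apply: rcvgD; apply: rcvgZ.
rewrite !mulr0 addr0; apply: rcvg_squeeze0 => k; rewrite J_sqr_ge0/=.
apply: le_trans (J_sqrD_le (e2 k) (d2 k)).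
by rewrite le_eqVlt; apply/orP; left; apply/eqP; apply: J_eq => x; rewrite /cut_gradient; ring.
Qed.

Lemma H1energy_cut_cvg u g : weak_gradient u g ->
  H1energy (fun x => cutoff_at k x * u x) (cut_gradient k u g) @[k --> \oo] --> H1energy u g.
Proof.
move=> ug; have wk k := weak_gradient_cut k ug; apply: rcvgD.
  apply: rcvg_sum => i; apply: (J_sqr_cvg (u_ := fun k => cut_gradient k u g i)) (cut_gradient_cvg i ug).
    by move=> k; case: ((wk k).2 i).
  by case: (ug.2 i).
apply: rcvgZ; apply: (J_sqr_cvg (u_ := fun k x => cutoff_at k x * u x)) (cutoff_at_sqint_cvg ug.1).
  by move=> k; exact: (wk k).1.
exact: ug.1.
Qed.

Lemma cut_form_cvg u g v h : weak_gradient u g -> weak_gradient v h ->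
  form u g (fun x => cutoff_at k x * v x) (cut_gradient k v h) @[k --> \oo] --> form u g v h.
Proof.
move=> ug vh; have wk k := weak_gradient_cut k vh; apply: rcvgD.
  apply: rcvg_sum => i; have := ip_cvg (fun k => ((wk k).2 i).1) (vh.2 i).1 (ug.2 i).1 (cut_gradient_cvg i vh).
  rewrite (J_eq mu (f := fun x => g i x * h i x) (g := fun x => h i x * g i x)); last by move=> x; rewrite mulrC.
  by apply: rcvg_eq => k; apply: J_eq => x; rewrite mulrC.
apply: rcvgZ; have := ip_cvg (fun k => (wk k).1) vh.1 ug.1 (cutoff_at_sqint_cvg vh.1).
rewrite (J_eq mu (f := fun x => u x * v x) (g := fun x => v x * u x)); last by move=> x; rewrite mulrC.
by apply: rcvg_eq => k; apply: J_eq => x; rewrite mulrC.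
Qed.

Lemma cut_quart k u : quart u -> quart (fun x => cutoff_at k x * u x).
Proof.
move=> u4; apply: (quart_le _ _ u4).
  by apply: measurable_funM; [exact: smooth_measurable (smooth_cutoff_at k)|case: u4].
by move=> x; rewrite normrM ler_piMl// cutoff_at_bounded.
Qed.

Lemma N4_cut_cvg u : quart u -> N4 (fun x => cutoff_at k x * u x) @[k --> \oo] --> N4 u.
Proof.
move=> u4; have [||||_//] := @J_dct _ _ _ mu (fun k x => ((cutoff_at k x * u x) ^+ 2) ^+ 2) (fun x => (u x ^+ 2) ^+ 2) (fun x => (u x ^+ 2) ^+ 2).
- by move=> k; do 2 apply: measurable_funX; case: (cut_quart k u4).
- move=> x; apply: cvg_near_cst; apply: filterS (cutoff_at_cvg x) => k ->.
  by rewrite mul1r.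
- move=> k x; rewrite ger0_norm ?sqr_ge0//; apply: sqr_le_norm; rewrite ger0_norm ?sqr_ge0//.
  by rewrite exprMn ler_piMl ?sqr_ge0// -(expr1n _ 2); apply: sqr_le_norm; exact: cutoff_at_bounded.
- by case: u4 => _ [].
Qed.

End energies.

(** * Variational properties of ground states *)

Section ground_states.
Context (R : realType) (n : nat) (omega b : R).
Context (omega_gt0 : 0 < omega) (b_gt0 : 0 < b) (b_lt : b < n%:R / 2).
Notation Rn := 'rV[R]_n.
Notation mu := (lebesgue_rV R n).
Notation J f := (Rintegral mu setT f).
Notation N2 u := (\int[mu]_x (u x ^+ 2)).
Notation intg f := (mu.-integrable [set: Rn] (EFin \o f)).
Notation grad u := (fun i => weak_pderiv i u).
Notation H1en := (H1energy omega).
Notation L u := (Lop (b / 2) u).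
Implicit Types (u v w phi : Rn -> R) (g h : 'I_n -> Rn -> R) (e c : R).

Lemma Lop_sqint u : X_space b u -> sqint mu (L u) /\ is_Lop (b / 2) u (L u).
Proof.
move=> [_ [g gP]]; have H := @getI _ [set g | is_Lop (b / 2) u g] g gP.
by split => //; case: H => /sqintP.
Qed.

Let H1_sqint u : H1 u -> sqint mu u. Proof. by move=> [/sqintP]. Qed.

Lemma Lop_ae u (f : Rn -> R) : X_space b u -> is_Lop (b / 2) u f -> L u = f %[ae mu].
Proof.
move=> Xu ug; have [_ H] := Lop_sqint Xu.
exact: (multiplier_unique (H1_sqint Xu.1) H ug).
Qed.

Definition action e u := e * N2 (L u) + H1en u (grad u).

Let space_H1 e u : energy_space b e u -> H1 u.
Proof. by rewrite /energy_space; case: eqP => // _ []. Qed.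

Let space_X e u : e != 0 -> energy_space b e u -> X_space b u.
Proof. by rewrite /energy_space => /negbTE ->. Qed.

Let scaled_Lop_mul e u v : energy_space b e u -> energy_space b e v ->
  intg (fun x => e * (L u x * L v x)) /\ J (fun x => e * (L u x * L v x)) = e * J (fun x => L u x * L v x).
Proof.
have [->|e0] := eqVneq e 0.
  move=> _ _; rewrite mul0r; rewrite (_ : (fun x => _) = fun=> 0) ?J0; last by apply/funext => x; rewrite mul0r.
  by split => //; exact: intg0.
move=> /(space_X e0)/Lop_sqint[u2 _] /(space_X e0)/Lop_sqint[v2 _].
have i := sqint_mul u2 v2; split; [exact: intgZ|exact: JZ].
Qed.

Let form_parts u v : H1 u -> H1 v ->
  intg (fun x => omega * (u x * v x) + \sum_(i < n) weak_pderiv i u x * weak_pderiv i v x) /\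
  J (fun x => omega * (u x * v x) + \sum_(i < n) weak_pderiv i u x * weak_pderiv i v x) =
    form omega u (grad u) v (grad v).
Proof.
move=> /weak_gradient_weak_pderiv[u2 ug] /weak_gradient_weak_pderiv[v2 vh].
have i1 := sqint_mul u2 v2.
have i2 i : intg (fun x => weak_pderiv i u x * weak_pderiv i v x).
  by apply: sqint_mul; [case: (ug i)|case: (vh i)].
split; first by apply: intgD; [exact: intgZ|exact: intg_sum].
by rewrite JD; [rewrite JZ// J_sum// addrC|exact: intgZ|exact: intg_sum].
Qed.

Lemma energyE e u : energy_space b e u -> energy omega b e u = action e u.
Proof.
move=> su; have [i1 E1] := scaled_Lop_mul su su; have [i2 E2] := form_parts (space_H1 su) (space_H1 su).
rewrite /action -(form_self omega u (grad u)) -E2 [in X in X + _](_ : N2 (L u) = J (fun x => L u x * L u x))//.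
rewrite -E1 -JD//; apply: J_eq => x; rewrite /= !expr2 addrAC -addrA; congr (_ + _).
Qed.

Lemma solution_form e phi v : solution omega b e phi -> energy_space b e v ->
  form omega phi (grad phi) v (grad v) + e * J (fun x => L phi x * L v x) = J (fun x => phi x ^+ 3 * v x).
Proof.
move=> [sphi _ H] sv; have [i1 E1] := scaled_Lop_mul sphi sv.
have [i2 E2] := form_parts (space_H1 sphi) (space_H1 sv).
by rewrite -H// -E1 -E2 -JD.
Qed.

Let action_ge0 e u : 0 <= e -> 0 <= action e u.
Proof. by move=> e0; rewrite addr_ge0 ?H1energy_ge0// mulr_ge0// J_sqr_ge0. Qed.

Lemma solution_action e phi : solution omega b e phi -> action e phi = N4 phi.
Proof.
move=> sol; have [sphi _ _] := sol; have := solution_form sol sphi; rewrite form_self addrC.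
have -> : J (fun x => phi x ^+ 3 * phi x) = N4 phi by apply: J_eq => x; ring.
by [].
Qed.

Lemma actionZ e c u : energy_space b e u -> action e (fun x => c * u x) = c ^+ 2 * action e u.
Proof.
move=> su; have gu := weak_gradient_weak_pderiv (space_H1 su).
have gcu := weak_gradientZ c gu; have Hcu := weak_gradient_H1 gcu.
rewrite /action mulrDr -(H1energyZ omega c gu); congr (_ + _); last first.
  exact: (H1energy_ae omega (weak_gradient_weak_pderiv Hcu) gcu (ae_eq_refl _ _ _)).
have [E0|e0] := eqVneq e 0; first by rewrite E0 [LHS]mul0r [X in _ = _ * X]mul0r mulr0.
have Xu := space_X e0 su; have [L2 LP] := Lop_sqint Xu.
have LZ : is_Lop (b / 2) (fun x => c * u x) (fun x => c * L u x) by exact: (multiplierZ c gu.1 LP).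
have Xcu : X_space b (fun x => c * u x) by split => //; eexists; exact: LZ.
rewrite mulrCA; congr (_ * _); rewrite -J_sqrZ//; apply: J_ae.
- by apply: measurable_funX; case: (Lop_sqint Xcu) => -[].
- by apply: measurable_funX; case: (sqintZ c L2).
- by apply: filterS (Lop_ae Xcu LZ) => x /= H xT; rewrite H.
Qed.

(** Squaring the quotient leaves only integrals of even powers. *)
Lemma energy_quotient_quart e u : energy_space b e u -> nonzero u -> quart u ->
  energy_quotient omega b e u ^+ 2 * N4 u = action e u ^+ 2.
Proof.
move=> su nu u4; rewrite /energy_quotient energyE// -(L4norm_quart u4) expr_div_n.
rewrite divfK// expf_neq0// expf_neq0//; apply/eqP => L0; apply: nu.
by apply: (N4_eq0 u4); rewrite -(L4norm_quart u4) L0 !expr0n.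
Qed.

Let energy_quotient_ge0 e u : 0 <= e -> energy_space b e u -> 0 <= energy_quotient omega b e u.
Proof. by move=> e0 su; rewrite divr_ge0 ?sqr_ge0// energyE// action_ge0. Qed.

Lemma minimum_le e w : 0 <= e -> energy_space b e w -> nonzero w ->
  minimum n omega b e <= energy_quotient omega b e w.
Proof.
move=> e0 sw nw; apply: ge_inf; last by exists w.
by exists 0 => _ [u [su _] <-]; exact: energy_quotient_ge0.
Qed.

(** Testing the equation with the solution itself equates its action and the
  fourth power of its norm, which fixes the factor by which a minimizer is
  rescaled. *)
Lemma ground_state_facts e phi : 0 <= e -> ground_state omega b e phi ->
  [/\ 0 < minimum n omega b e, N4 phi = minimum n omega b e ^+ 2 & quart phi].
Proof.
move=> e0 [sol [u [c [[su nu uq] c0 phiE]]]]; have [sphi /quartP phi4 _] := sol.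
have c1 := lt0r_neq0 c0.
have u4 : quart u.
  have := quartZ c^-1 phi4; rewrite phiE; congr quart; apply/funext => x.
  by rewrite mulrA mulVf// mul1r.
have Nu : 0 < N4 u.
  rewrite lt_neqAle N4_ge0 andbT eq_sym; apply/eqP => /(N4_eq0 u4); exact: nu.
have E1 : N4 phi = (c ^+ 2) ^+ 2 * N4 u by rewrite phiE N4Z.
have E2 : action e phi = c ^+ 2 * action e u by rewrite phiE actionZ.
have Np : 0 < N4 phi by rewrite E1 mulr_gt0// !exprn_gt0.
have Q := energy_quotient_quart su nu u4; rewrite uq in Q.
have M2 : N4 phi = minimum n omega b e ^+ 2.
  apply: (mulIf (lt0r_neq0 Np)); rewrite [in RHS]E1 mulrCA Q -exprMn -E2 (solution_action sol).
  by rewrite expr2.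
split => //; rewrite lt_neqAle -{2}uq energy_quotient_ge0// andbT eq_sym; apply/eqP => m0.
by move: Np; rewrite M2 m0 expr0n ltxx.
Qed.

(** A competitor of infinite norm would have quotient zero, which is below the
  positive minimum; for all the others minimality is the inequality. *)
Lemma ground_state_compare e phi w : 0 <= e -> ground_state omega b e phi ->
  energy_space b e w -> nonzero w -> quart w /\ N4 phi * N4 w <= action e w ^+ 2.
Proof.
move=> e0 gs sw nw; have [m0 -> _] := ground_state_facts e0 gs.
have mq := minimum_le e0 sw nw.
have w4 : quart w.
  apply: contrapT => nq; move: mq; rewrite /energy_quotient L4norm_not_quart ?expr0n/= ?invr0 ?mulr0 ?leNgt ?m0//.
  exact: (H1_sqint (space_H1 sw)).1.
split => //; rewrite -(energy_quotient_quart sw nw w4) ler_wpM2r ?N4_ge0//.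
by apply: sqr_le_norm; rewrite (ger0_norm (ltW m0)).
Qed.

Lemma ground_state0_sobolev phi0 : ground_state omega b 0 phi0 ->
  forall u g, weak_gradient u g -> quart u /\ N4 phi0 * N4 u <= H1en u g ^+ 2.
Proof.
move=> gs u g ug; have Hu := weak_gradient_H1 ug.
have gu := weak_gradient_weak_pderiv Hu.
have [u0|nu] := pselect (u = cst 0 %[ae mu]).
  have z4 : quart (fun _ : Rn => 0 : R).
    by split => //; have := sqint0 mu; congr sqint; apply/funext => x; rewrite expr0n.
  have mu_ := ug.1.1.
  have u4 : quart u by apply: (quart_ae mu_ _ z4); apply: filterS u0 => x /= H xT; rewrite H.
  have Z : N4 (fun _ : Rn => 0 : R) = 0.
    by rewrite /N4 -[RHS](J0 mu); apply: J_eq => x; rewrite expr0n expr0n.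
  have -> : N4 u = 0 by rewrite -[RHS]Z; exact: (N4_ae mu_ z4.1 u0).
  by split; rewrite ?mulr0 ?sqr_ge0.
have su : energy_space b 0 u by rewrite /energy_space eqxx.
have [u4] := ground_state_compare (lexx 0) gs su nu; split => //.
by move: b0; rewrite /action mul0r add0r (H1energy_ae omega gu ug (ae_eq_refl _ _ _)).
Qed.

(** Both the action and the fourth power of the norm are the square of the
  minimum, so [psi] attains the minimum without rescaling. *)
Lemma extremal_ground_state phi0 psi g : ground_state omega b 0 phi0 -> weak_gradient psi g ->
  H1en psi g = N4 phi0 -> N4 psi = N4 phi0 ->
  (forall v h, weak_gradient v h -> form omega psi g v h = J (fun x => psi x ^+ 3 * v x)) ->
  ground_state omega b 0 psi.
Proof.
move=> gs psig E4 N4E EL; have [m0 M2 _] := ground_state_facts (lexx 0) gs.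
have [psi4 _] := ground_state0_sobolev gs psig.
have Hp := weak_gradient_H1 psig; have gp := weak_gradient_weak_pderiv Hp.
have sp : energy_space b 0 psi by rewrite /energy_space eqxx.
have sol : solution omega b 0 psi.
  split => //; first exact/quartP.
  move=> v sv; have Hv := space_H1 sv; have gv := weak_gradient_weak_pderiv Hv.
  rewrite -(EL _ _ gv) formC (form_ae omega gv psig gp) formC -(form_parts Hp Hv).2.
  by apply: J_eq => x; rewrite mul0r addr0.
split => //; exists psi, 1; split => //; last by apply/funext => x; rewrite mul1r.
have np : nonzero psi by apply: (N4_gt0_nonzero psi4.1); rewrite N4E M2 exprn_gt0.
split => //; have M1 : N4 psi != 0 by rewrite N4E M2 expf_neq0// gt_eqF.
have Q := energy_quotient_quart sp np psi4.
have A : action 0 psi = N4 psi.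
  by rewrite /action mul0r add0r (H1energy_ae omega gp psig (ae_eq_refl _ _ _)) E4 N4E.
apply/eqP; rewrite -(eqrXn2 (n := 2))//; [|exact: (energy_quotient_ge0 (lexx 0))|exact: ltW].
by apply/eqP; apply: (mulIf M1); rewrite Q A -M2 -N4E expr2.
Qed.

Lemma compact_support_X u g r : weak_gradient u g -> (forall x, ~ cube r x -> u x = 0) -> intg u /\ X_space b u.
Proof.
move=> ug ur; have ui : intg u.
  apply: intg_eq (sqint_mul ug.1 (indic_box_sqint (const_mx (- r)) (const_mx r))) => x.
  rewrite indicE; have [xr|xr] := pselect (cube r x); first by rewrite mem_set ?mulr1.
  by rewrite memNset// mulr0 ur.
split => //; split; first exact: weak_gradient_H1 ug.
have [C C0 CP] := Lop_exists b_gt0 b_lt; have [G GP _] := CP u ui ug.1.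
by exists G.
Qed.

(** The bound of [Lop_exists] holds for one representative, and
  [multiplier_unique] carries it over to the chosen one. *)
Lemma Lop_bound : exists2 C, 0 <= C & forall u, intg u -> X_space b u ->
  N2 (L u) <= C * (J (fun x => `|u x|) ^+ 2 + N2 u).
Proof.
have [C C0 CP] := Lop_exists b_gt0 b_lt; exists C => // u ui Xu.
have [G GP GN] := CP u ui (H1_sqint Xu.1); apply: le_trans GN.
rewrite le_eqVlt; apply/orP; left; apply/eqP; apply: J_ae.
- by apply: measurable_funX; case: (Lop_sqint Xu) => -[].
- by apply: measurable_funX; case: GP => /sqintP[].
- by apply: filterS (Lop_ae Xu GP) => x /= H xT; rewrite H.
Qed.

End ground_states.

(** * Consequences of the Sobolev inequality *)

Section sobolev_inequality.
Context (R : realType) (n : nat) (omega M : R) (omega_gt0 : 0 < omega) (M_gt0 : 0 < M).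
Notation Rn := 'rV[R]_n.
Notation mu := (lebesgue_rV R n).
Notation J f := (Rintegral mu setT f).
Notation N2 u := (\int[mu]_x (u x ^+ 2)).
Notation intg f := (mu.-integrable [set: Rn] (EFin \o f)).
Notation H1en := (H1energy omega).
Implicit Types (u v w : Rn -> R) (g h : 'I_n -> Rn -> R) (l : R).

Context (sobolev : forall u g, weak_gradient u g -> quart u /\ M * N4 u <= H1en u g ^+ 2).

(** The inequality is applied to a dilation of [u]. *)
Let sobolev_scaled u g l : 0 < l -> weak_gradient u g ->
  M * l ^+ n * N4 u <= (l ^+ 2 * dirichlet g + omega * N2 u) ^+ 2.
Proof.
move=> l0 ug; have ln := lt0r_neq0 l0; have [u4 _] := sobolev ug.
have [_] := sobolev (weak_gradient_affine 0 ln ug).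
rewrite (H1energy_scale omega ln ug) (N4_affine 0 ln u4) ger0_norm ?(ltW l0)// exprMn.
have p0 : 0 < l ^+ n by rewrite exprn_gt0.
move: (l ^+ n) p0 (N4 u) ((_ + _) ^+ 2) => p p0 a q H.
have := ler_wpM2l (sqr_ge0 p) H.
rewrite (_ : p ^+ 2 * (M * (p^-1 * a)) = M * p * a); last by field; rewrite gt_eqF.
by rewrite (_ : p ^+ 2 * (p^-1 ^+ 2 * q) = q)//; field; rewrite gt_eqF.
Qed.

(** For an extremal function, with [A] and [B] the two parts of its energy,
  the dilation by two gives [2 ^ n * (A + B) ^ 2 <= (4 * A + B) ^ 2], which
  fails for [n >= 4] unless [B = 0]. *)
Lemma sobolev_dimension u g : weak_gradient u g -> N4 u = M -> H1en u g = M -> 0 < N2 u -> (n < 4)%N.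
Proof.
move=> ug NM EM B0; rewrite ltnNge; apply/negP => n4.
have := sobolev_scaled (ltr0n R 2) ug; rewrite NM.
have D0 := dirichlet_ge0 g; move: EM; rewrite /H1energy; have oB : 0 < omega * N2 u by rewrite mulr_gt0.
move: (dirichlet g) (omega * N2 u) D0 oB => A B A0 {}B0 AB; subst M.
have p16 : 16 <= 2 ^+ n :> R by rewrite (_ : 16 = 2 ^+ 4) ?ler_eXn2l ?ltr1n//; ring.
move=> H; have {}H : (A + B) * 16 * (A + B) <= (2 ^+ 2 * A + B) ^+ 2.
  apply: le_trans H; rewrite -AB; apply: ler_wpM2r; first exact: (addr_ge0 A0 (ltW B0)).
  by apply: ler_wpM2l => //; exact: (addr_ge0 A0 (ltW B0)).
by move: H; rewrite !expr2; nra.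
Qed.

Context (n_lt4 : (n < 4)%N).

(** The dilation parameter trades the gradient against the function. Since
  [n <= 3], a positive power of [l] is left in front of the gradient. *)
Lemma sobolev_interpolation u g l : 0 < l -> l <= 1 -> weak_gradient u g ->
  M * N4 u <= 2 * (l * dirichlet g ^+ 2 + l ^- 3 * (omega * N2 u) ^+ 2).
Proof.
move=> l0 l1 ug; have := sobolev_scaled l0 ug.
move: (dirichlet g) (omega * N2 u) (N4 u) => A B q H.
have p0 : 0 < l ^+ n by rewrite exprn_gt0.
rewrite -(ler_pM2l p0); have -> : l ^+ n * (M * q) = M * l ^+ n * q by ring.
apply: le_trans H _.
apply: (@le_trans _ _ (2 * (l ^+ 4 * A ^+ 2 + B ^+ 2))).
  have := sqr_ge0 (l ^+ 2 * A - B); rewrite (_ : l ^+ 4 = l ^+ 2 * l ^+ 2); last by ring.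
  by move: (l ^+ 2) => p; rewrite !expr2; lra.
have nE : l ^+ 3 = l ^+ (3 - n) * l ^+ n by rewrite -exprD subnK.
have q1 : l ^+ (3 - n) <= 1 by rewrite exprn_ile1// ltW.
have l3 : l ^+ 3 <= l ^+ n by rewrite nE ler_piMl// ltW.
rewrite [leRHS]mulrCA ler_wpM2l// [leRHS]mulrDr; apply: lerD.
  rewrite [leRHS]mulrA ler_wpM2r ?sqr_ge0// (_ : l ^+ 4 = l ^+ 3 * l); last by ring.
  by rewrite ler_wpM2r// ltW.
rewrite [leRHS]mulrA -[leLHS]mul1r ler_wpM2r ?sqr_ge0// ler_pdivlMr ?exprn_gt0// mul1r.
exact: l3.
Qed.

Let J_correlation (p q : Rn -> R) : intg p -> intg q ->
  intg (fun y => J (fun x => p (x - y) * q x)) /\ J (fun y => J (fun x => p (x - y) * q x)) = J p * J q.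
Proof.
move=> ip iq; pose F (z : Rn * Rn) := p (z.2 - z.1) * q z.2.
have mF : measurable_fun [set: Rn * Rn] F.
  apply: measurable_funM; last first.
    by apply: measurableT_comp; [exact: intg_measurable iq|exact: measurable_snd].
  apply: (measurableT_comp (intg_measurable ip)).
  exact: measurable_row_sub measurable_snd measurable_fst.
have N1 : (-1 : R) != 0 by rewrite oppr_eq0 oner_neq0.
have ips x (f : Rn -> R) : intg f -> intg (fun y => f (x - y)) /\ J (fun y => f (x - y)) = J f.
  move=> fi; have E : (fun y => f (x - y)) = fun y => f (-1 *: y + x).
    by apply/funext => y; rewrite scaleN1r addrC.
  rewrite E (J_affine x N1 fi) normrN1 expr1n invr1 mul1r; split => //.
  exact: (intg_affine x N1 fi).
have Fx x : intg (fun y => F (y, x)).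
  by apply: intg_eq (intgZ (q x) (ips x p ip).1) => y; rewrite /F /= mulrC.
have FB x : J (fun y => `|F (y, x)|) <= J (fun y => `|p y|) * `|q x|.
  rewrite (J_eq mu (g := fun y => `|q x| * `|p (x - y)|)); last by move=> y; rewrite /F /= normrM mulrC.
  have [i1 E1] := ips x _ (intg_norm ip).
  by rewrite JZ// E1 mulrC.
have s := lebesgue_rV_sigma_finite R n.
have [A B C] := fubini_slices s s mF Fx FB (intgZ _ (intg_norm iq)).
split; first exact: A.
rewrite [LHS]C -JZ//; apply: J_eq => x.
rewrite (J_eq mu (g := fun y => q x * p (x - y))); last by move=> y; rewrite /F /= mulrC.
by rewrite JZ; [rewrite (ips x p ip).2 mulrC|exact: (ips x p ip).1].
Qed.

Definition window (y x : Rn) : R := cutoff (x - y).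

Let window_smooth y : smooth (window y).
Proof.
have := smooth_affine 1 (- y) (@smooth_cutoff R n).
by congr smooth; apply/funext => x; rewrite scale1r.
Qed.

Let window_pderiv y i x : pderiv i (window y) x = pderiv i (@cutoff R n) (x - y).
Proof.
have /(congr1 (@^~ x)) := pderiv_affine i 1 (- y) (@smooth_cutoff R n).
by rewrite mul1r scale1r => <-; congr (pderiv i _ x); apply/funext => z; rewrite scale1r.
Qed.

(** If no window of unit size carries mass, the interpolation inequality,
  applied in every window and integrated over the windows, makes the norm
  small. *)
Lemma nonvanishing (C m : R) : 0 <= C -> 0 < m -> exists2 s, 0 < s &
  forall u g, weak_gradient u g -> H1en u g <= C -> m <= N4 u ->
  exists y, s < N2 (fun x => window y x * u x).
Proof.
move=> C0 m0; have [P P0 PP] := cutoff_pderiv_bounded R n.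
pose th := @cutoff R n; have tth := test_function_cutoff R n.
have th2 : sqint mu th by exact: test_function_sqint.
have thb x : `|th x| <= 1 by rewrite ger0_norm ?cutoff_ge0// cutoff_le1.
have thb2 x : th x ^+ 2 <= 1 by rewrite -(expr1n _ 2); apply: sqr_le_norm; exact: thb.
have th4 : quart th.
  split; first by case: th2.
  apply: (sqint_le _ _ th2); first by apply: measurable_funX; case: th2.
  by move=> x; rewrite expr2 normrM ler_piMl.
have d2 i : sqint mu (pderiv i th) by apply: test_function_sqint; exact: test_function_pderiv.
pose K := N4 th.
have K0 : 0 < K.
  apply: lt_le_trans (indic_cube_gt0 n ltr01) _.
  apply: J_le; [exact: indic_cube_intg|by case: th4 => _ []|move=> x].
  rewrite indicE; have [xc|xc] := pselect (cube 1 x); last by rewrite memNset// sqr_ge0.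
  by rewrite mem_set// /th cutoff_eq1// !expr1n.
pose D := C / omega; have D0 : 0 <= D by rewrite divr_ge0// ltW.
pose CA := \sum_(i < n) (2 * C + 2 * (P ^+ 2 * D)).
pose C1 := \sum_(i < n) (2 * (N2 th * C) + 2 * (N2 (pderiv i th) * D)).
pose X1 := CA * C1; pose X2 := omega ^+ 2 * (N2 th * D).
have CA0 : 0 <= CA.
  by apply: sumr_ge0 => i _; apply: addr_ge0; do 2? [apply: mulr_ge0 => //]; exact: sqr_ge0.
have C10 : 0 <= C1.
  by apply: sumr_ge0 => i _; apply: addr_ge0; do 2? [apply: mulr_ge0 => //]; exact: J_sqr_ge0.
have X10 : 0 <= X1 by rewrite mulr_ge0.
have X20 : 0 <= X2.
  by apply: mulr_ge0; [exact: sqr_ge0|apply: mulr_ge0 => //; exact: J_sqr_ge0].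
pose Q := M * K * m; have Q0 : 0 < Q by rewrite !mulr_gt0.
(* The parameter [l] confines the gradient terms to a quarter of [Q]; given
   [l], the threshold [s] confines the remaining ones to another quarter. *)
pose l := Num.min 1 (Q / (8 * (X1 + 1))).
have l0 : 0 < l by rewrite lt_min ltr01 divr_gt0// mulr_gt0// ltr_wpDl.
have l1 : l <= 1 by rewrite ge_min lexx.
have lX : 2 * (l * X1) <= Q / 4.
  have : l * (8 * (X1 + 1)) <= Q by rewrite -ler_pdivlMr ?mulr_gt0 ?ltr_wpDl// ge_min lexx orbT.
  rewrite (_ : l * (8 * (X1 + 1)) = 8 * (l * X1) + 8 * l); last by ring.
  have arith (p t q : R) : 0 <= p -> 0 <= t -> 8 * p + 8 * t <= q -> 2 * p <= q / 4 by lra.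
  exact: (arith _ _ _ (mulr_ge0 (ltW l0) X10) (ltW l0)).
pose l3 := l ^- 3; have l30 : 0 < l3 by rewrite invr_gt0 exprn_gt0.
pose s := Q / (8 * l3 * (X2 + 1)).
have s0 : 0 < s by rewrite divr_gt0// !mulr_gt0// ltr_wpDl.
have sX : 2 * (l3 * (s * X2)) <= Q / 4.
  have -> : 2 * (l3 * (s * X2)) = Q / 4 * (X2 / (X2 + 1)).
    by rewrite /s; field; rewrite !gt_eqF// ltr_wpDl.
  rewrite ler_piMr//; first by rewrite divr_ge0// ltW.
  by rewrite ler_pdivrMr ?ltr_wpDl// mul1r lerDl.
exists s => // u g ug uC um; apply: contrapT => nope.
have u2 := ug.1; have [u4 _] := sobolev ug.
have Bs y : N2 (fun x => window y x * u x) <= s.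
  by rewrite leNgt; apply/negP => H; apply: nope; exists y.
have uD : N2 u <= D.
  by rewrite ler_pdivlMr// mulrC; apply: le_trans uC; exact: N2_le_H1energy.
have gC i : N2 (g i) <= C.
  by apply: le_trans (N2_le_dirichlet g i) _; apply: le_trans uC; exact: dirichlet_le_H1energy.
have tr2 (f : Rn -> R) y : sqint mu f -> sqint mu (fun x => f (x - y)) by move=> f2; exact: (sqint_translate (- y) f2).
have wb y (f : Rn -> R) : sqint mu f -> sqint mu (fun x => window y x * f x).
  move=> f2; apply: (sqint_bounded_mul (M := 1)) => //; first by case: (tr2 th y th2).
  by move=> x; exact: thb.
have db y i : sqint mu (fun x => pderiv i th (x - y) * u x).
  exact: (sqint_bounded_mul (tr2 _ y (d2 i)).1 (fun x => PP i (x - y)) u2).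
pose B y := J (fun x => th (x - y) ^+ 2 * u x ^+ 2).
have BE y : N2 (fun x => window y x * u x) = B y by apply: J_eq => x; rewrite exprMn.
pose A y := \sum_(i < n) (2 * J (fun x => th (x - y) ^+ 2 * g i x ^+ 2) + 2 * J (fun x => pderiv i th (x - y) ^+ 2 * u x ^+ 2)).
have cor (p q : Rn -> R) := @J_correlation (fun x => p x ^+ 2) (fun x => q x ^+ 2).
have iA : intg A /\ J A <= C1.
  have i1 i := cor th (g i) th2.2 (ug.2 i).1.2; have i2 i := cor (pderiv i th) u (d2 i).2 u2.2.
  split; first by apply: intg_sum => i; apply: intgD; apply: intgZ; [case: (i1 i)|case: (i2 i)].
  rewrite J_sum; last by move=> i; apply: intgD; apply: intgZ; [case: (i1 i)|case: (i2 i)].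
  apply: ler_sum => i _; have [i1i E1] := i1 i; have [i2i E2] := i2 i.
  rewrite JD; [|exact: intgZ|exact: intgZ]; rewrite !JZ// E1 E2.
  by apply: lerD; rewrite ler_wpM2l//; apply: ler_wpM2l => //; exact: J_sqr_ge0.
have iB := cor th u th2.2 u2.2.
have iN := cor (fun x => th x ^+ 2) (fun x => u x ^+ 2) th4.2.2 u4.2.2.
have wg y : weak_gradient (fun x => window y x * u x) (fun i x => window y x * g i x + pderiv i (window y) x * u x).
  apply: (weak_gradient_cutoff (M := Num.max 1 P) (@window_smooth y)) => // [x|i x].
    by rewrite le_max thb.
  by rewrite le_max window_pderiv PP orbT.
have DA y : dirichlet (fun i x => window y x * g i x + pderiv i (window y) x * u x) <= A y.
  apply: ler_sum => i _; have g2 := (ug.2 i).1.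
  rewrite (J_eq mu (g := fun x => (window y x * g i x + pderiv i th (x - y) * u x) ^+ 2)); last first.
    by move=> x; rewrite window_pderiv.
  apply: le_trans (J_sqrD_le (wb y _ g2) (db y i)) _; rewrite le_eqVlt; apply/orP; left; apply/eqP.
  by congr (2 * _ + 2 * _); apply: J_eq => x; rewrite exprMn.
have AC y : A y <= CA.
  apply: ler_sum => i _; apply: lerD; rewrite ler_wpM2l//.
    apply: le_trans (gC i); apply: J_le.
    - by apply: intg_eq (wb y _ (ug.2 i).1).2 => x; rewrite exprMn.
    - by case: (ug.2 i) => -[].
    - by move=> x; rewrite ler_piMl// sqr_ge0.
  apply: (@le_trans _ _ (P ^+ 2 * N2 u)); last by rewrite ler_wpM2l// sqr_ge0.
  rewrite -JZ; last by case: u2.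
  apply: J_le; [by apply: intg_eq (db y i).2 => x; rewrite exprMn|by apply: intgZ; case: u2|].
  by move=> x; rewrite ler_wpM2r ?sqr_ge0//; apply: sqr_le_norm; exact: PP.
have A0 y : 0 <= A y by apply: le_trans (DA y); exact: dirichlet_ge0.
have B0 y : 0 <= B y by rewrite -BE; exact: J_sqr_ge0.
have key y : M * J (fun x => (th (x - y) ^+ 2) ^+ 2 * (u x ^+ 2) ^+ 2) <= 2 * (l * CA) * A y + 2 * (l3 * (omega ^+ 2 * s)) * B y.
  have := sobolev_interpolation l0 l1 (wg y).
  rewrite (_ : N4 _ = J (fun x => (th (x - y) ^+ 2) ^+ 2 * (u x ^+ 2) ^+ 2)); last first.
    by apply: J_eq => x; rewrite -!exprMn.
  move/le_trans; apply.
  have -> : 2 * (l * CA) * A y + 2 * (l3 * (omega ^+ 2 * s)) * B y =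
    2 * (l * CA * A y + l3 * (omega ^+ 2 * s) * B y) by ring.
  apply: ler_wpM2l => //.
  apply: lerD.
    rewrite -mulrA ler_wpM2l ?(ltW l0)// expr2; apply: ler_pM; rewrite ?dirichlet_ge0//.
    exact: le_trans (DA y) (AC y).
  rewrite BE -/l3 -[leRHS]mulrA; apply: ler_wpM2l; first exact: ltW.
  rewrite exprMn -[leRHS]mulrA; apply: ler_wpM2l; first exact: sqr_ge0.
  by rewrite expr2; apply: ler_wpM2r => //; rewrite -BE.
have : M * (K * N4 u) <= 2 * (l * CA) * J A + 2 * (l3 * (omega ^+ 2 * s)) * J B.
  rewrite -iN.2 -!JZ; [|exact: iB.1|exact: iA.1|exact: iN.1].
  rewrite -JD; [|exact: intgZ iA.1|exact: intgZ iB.1].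
  apply: J_le; [exact: intgZ iN.1|by apply: intgD; [exact: intgZ iA.1|exact: intgZ iB.1]|].
  exact: key.
have h1 : Q <= M * (K * N4 u) by rewrite /Q -mulrA ler_wpM2l ?(ltW M_gt0)// ler_wpM2l// ltW.
have h2 : 2 * (l * CA) * J A <= Q / 4.
  apply: le_trans lX; rewrite -mulrA ler_wpM2l// -mulrA ler_wpM2l ?(ltW l0)// ler_wpM2l//.
  exact: iA.2.
have h3 : 2 * (l3 * (omega ^+ 2 * s)) * J B <= Q / 4.
  apply: le_trans sX.
  have -> : 2 * (l3 * (omega ^+ 2 * s)) * J B = 2 * (l3 * (s * (omega ^+ 2 * J B))) by ring.
  apply: ler_wpM2l => //; apply: ler_wpM2l; first exact: ltW.
  apply: ler_wpM2l; first exact: ltW.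
  apply: ler_wpM2l; first exact: sqr_ge0.
  by rewrite iB.2; apply: ler_wpM2l => //; exact: J_sqr_ge0.
move: h1 h2 h3 Q0; move: (_ * J A) (_ * J B) (M * _) (Q) => a c d q; lra.
Qed.

End sobolev_inequality.

Section local_convergence.
Context (R : realType) (n : nat) (omega M : R) (omega_gt0 : 0 < omega) (M_gt0 : 0 < M).
Notation Rn := 'rV[R]_n.
Notation mu := (lebesgue_rV R n).
Notation J f := (Rintegral mu setT f).
Notation N2 u := (\int[mu]_x (u x ^+ 2)).
Notation H1en := (H1energy omega).
Implicit Types (u v w : Rn -> R) (g h : 'I_n -> Rn -> R) (l : R).

Context (sobolev : forall u g, weak_gradient u g -> quart u /\ M * N4 u <= H1en u g ^+ 2).
Context (n_lt4 : (n < 4)%N).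

(** The interpolation inequality with a small parameter bounds the norm by an
  arbitrarily small constant plus a null sequence. *)
Lemma N4_cvg0 (w_ : nat -> Rn -> R) (g_ : nat -> 'I_n -> Rn -> R) (C : R) :
  (forall k, weak_gradient (w_ k) (g_ k)) -> (forall k, H1en (w_ k) (g_ k) <= C) ->
  N2 (w_ k) @[k --> \oo] --> 0 -> N4 (w_ k) @[k --> \oo] --> 0.
Proof.
move=> wg wC w0; have C0 : 0 <= C by apply: le_trans (wC 0%N); exact: H1energy_ge0.
apply: rcvg_approx0 => [k|e e0]; first exact: N4_ge0.
pose l := Num.min 1 (e * M / (2 * (C ^+ 2 + 1))).
have K0 : 0 < 2 * (C ^+ 2 + 1) by rewrite mulr_gt0// ltr_wpDl// sqr_ge0.
have l0 : 0 < l by rewrite lt_min ltr01 divr_gt0// mulr_gt0.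
have l1 : l <= 1 by rewrite ge_min lexx.
have lC : 2 * (l * C ^+ 2) <= e * M.
  have : l * (2 * (C ^+ 2 + 1)) <= e * M by rewrite -ler_pdivlMr// ge_min lexx orbT.
  by apply: le_trans; have := ltW l0; move: (C ^+ 2) => c; nra.
exists (fun k => M^-1 * (2 * (l ^- 3 * (omega * N2 (w_ k)) ^+ 2))).
  have : M^-1 * (2 * (l ^- 3 * (omega * N2 (w_ k)) ^+ 2)) @[k --> \oo] --> M^-1 * (2 * (l ^- 3 * (omega * 0) ^+ 2)).
    by do 3 apply: rcvgZ; apply: rcvgX; apply: rcvgZ.
  by rewrite mulr0 expr0n/= !mulr0.
move=> k; have I := sobolev_interpolation sobolev n_lt4 l0 l1 (wg k).
rewrite -(ler_pM2l M_gt0); apply: le_trans I _.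
rewrite [leRHS]mulrDr mulVKf ?gt_eqF// [leLHS]mulrDr (mulrC M); apply: lerD => //.
apply: le_trans lC; apply: ler_wpM2l => //; apply: ler_wpM2l; first exact: ltW.
apply: sqr_le_norm; rewrite ger0_norm ?dirichlet_ge0//; apply: le_trans (wC k).
exact: dirichlet_le_H1energy.
Qed.

Lemma H1energyB_le u g v h : weak_gradient u g -> weak_gradient v h ->
  H1en (fun x => u x - v x) (fun i x => g i x - h i x) <= 2 * H1en u g + 2 * H1en v h.
Proof.
move=> [u2 ug] [v2 vh].
have -> : 2 * H1en u g + 2 * H1en v h =
    \sum_(i < n) (2 * N2 (g i) + 2 * N2 (h i)) + omega * (2 * N2 u + 2 * N2 v).
  by rewrite big_split/= -!mulr_sumr /H1energy /dirichlet; ring.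
apply: lerD; last by apply: ler_wpM2l; [exact: ltW|exact: J_sqrB_le].
by apply: ler_sum => i _; apply: J_sqrB_le; [case: (ug i)|case: (vh i)].
Qed.

(** The derivatives of the cutoffs are bounded independently of the radius, so
  one constant serves all cutoffs. *)
Lemma H1energy_cut_le : exists2 K, 0 <= K & forall j u g, weak_gradient u g ->
  H1en (fun x => cutoff_at j x * u x) (cut_gradient j u g) <= K * H1en u g.
Proof.
have [P P0 PP] := cutoff_pderiv_bounded R n.
pose K := 2 * P ^+ 2 * n%:R / omega + 2.
have K0 : 0 <= 2 * P ^+ 2 * n%:R / omega by rewrite divr_ge0 ?(ltW omega_gt0)// !mulr_ge0// sqr_ge0.
exists K => [|j u g ug]; first exact: addr_ge0.
have mc := smooth_measurable (@smooth_cutoff_at R n j).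
have md i := smooth_measurable (smooth_pderiv i (@smooth_cutoff_at R n j)).
have cb := @cutoff_at_bounded R n j.
have u2 := ug.1; have g2 i := (ug.2 i).1.
have N2le (a v : Rn -> R) (c : R) : measurable_fun setT a -> (forall x, `|a x| <= c) -> sqint mu v ->
    N2 (fun x => a x * v x) <= c ^+ 2 * N2 v.
  move=> ma ac v2; rewrite -(J_sqrZ c v2); apply: J_le.
  - by case: (sqint_bounded_mul ma ac v2).
  - by case: (sqintZ c v2).
  - by move=> x; rewrite !exprMn; apply: ler_wpM2r; [exact: sqr_ge0|exact: sqr_le_norm].
have D : dirichlet (cut_gradient j u g) <= 2 * dirichlet g + 2 * P ^+ 2 * n%:R * N2 u.
  have -> : 2 * dirichlet g + 2 * P ^+ 2 * n%:R * N2 u = \sum_(i < n) (2 * N2 (g i) + 2 * (P ^+ 2 * N2 u)).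
    by rewrite big_split/= -mulr_sumr sumr_const card_ord -mulr_natr; congr (_ + _); ring.
  apply: ler_sum => i _; have pb x := cutoff_at_pderiv_bounded j i x PP.
  apply: le_trans (J_sqrD_le (sqint_bounded_mul mc cb (g2 i)) (sqint_bounded_mul (md i) pb u2)) _.
  apply: lerD; apply: ler_wpM2l => //; last exact: N2le.
  by rewrite -[leRHS]mul1r -(expr1n _ 2); exact: N2le.
have U : N2 (fun x => cutoff_at j x * u x) <= N2 u.
  by rewrite -[leRHS]mul1r -(expr1n _ 2); exact: N2le.
have E : K * H1en u g = 2 * P ^+ 2 * n%:R / omega * dirichlet g + (2 * dirichlet g + 2 * P ^+ 2 * n%:R * N2 u) + 2 * (omega * N2 u).
  by rewrite /K /H1energy; field; rewrite gt_eqF.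
rewrite E; apply: lerD.
  apply: le_trans D _; rewrite lerDr; apply: mulr_ge0 => //; exact: dirichlet_ge0.
apply: (@le_trans _ _ (omega * N2 u)); first by apply: ler_wpM2l => //; exact: ltW.
have := mulr_ge0 (ltW omega_gt0) (J_sqr_ge0 mu u); move: (omega * _) => t; lra.
Qed.

(** On bounded sets weak convergence in [H^1] is strong in [L^2], hence in
  [L^4], so the nonlinearity passes to the limit against compactly supported
  functions. *)
Lemma cube_weak_cvg (v_ : nat -> Rn -> R) (g_ : nat -> 'I_n -> Rn -> R) psi g (C : R) eta r :
  (forall k, weak_gradient (v_ k) (g_ k)) -> (forall k, H1en (v_ k) (g_ k) <= C) ->
  weak_gradient psi g -> weakly_cvg mu v_ psi ->
  quart eta -> (forall x, ~ cube r x -> eta x = 0) ->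
  J (fun x => v_ k x ^+ 3 * eta x) @[k --> \oo] --> J (fun x => psi x ^+ 3 * eta x).
Proof.
move=> vg vC psig vw eta4 etar.
have [j jr] : exists j, forall x : Rn, cube r x -> cutoff_at j x = 1.
  exists (Num.truncn `|r|) => x /cubeP xr; apply: cutoff_at_eq1; apply/cubeP => i.
  by apply: le_trans (xr i) (le_trans (ler_norm r) _); apply: ltW; exact: truncnS_gt.
pose chi := @cutoff_at R n j.
have v4 k : quart (v_ k) by case: (sobolev (vg k)).
have p4 : quart psi by case: (sobolev psig).
pose w_ k x := v_ k x - psi x; have wg k := weak_gradientB (vg k) psig.
have wE k : H1en (w_ k) (fun i x => g_ k i x - g i x) <= 2 * C + 2 * H1en psi g.
  apply: le_trans (H1energyB_le (vg k) psig) _; apply: lerD => //.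
  by apply: ler_wpM2l.
have [K K0 KP] := H1energy_cut_le.
pose C2 := 2 * C + 2 * H1en psi g.
have wC i k : N2 (fun x => g_ k i x - g i x) <= C2.
  apply: le_trans (wE k); apply: le_trans (dirichlet_le_H1energy omega_gt0 _ _).
  exact: (N2_le_dirichlet (fun i x => g_ k i x - g i x) i).
have wN k : N2 (w_ k) <= C2 / omega.
  by rewrite ler_pdivlMr// mulrC; apply: le_trans (wE k); exact: N2_le_H1energy.
have w0 : weakly_cvg mu w_ (fun=> 0).
  exact: (weakly_cvg_sub0 (fun k => (vg k).1) psig.1 vw).
have chi2 : sqint mu chi.
  apply: (bounded_support_sqint (smooth_measurable (@smooth_cutoff_at R n j))).
  - by move=> x; exact: cutoff_at_eq0.
  - exact: cutoff_at_bounded.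
have c2 : N2 (fun x => chi x * w_ k x) @[k --> \oo] --> 0.
  have CC k i : N2 (fun x => g_ k i x - g i x) <= Num.max (C2 / omega) C2 by rewrite le_max wC orbT.
  have CN k : N2 (w_ k) <= Num.max (C2 / omega) C2 by rewrite le_max wN.
  exact: (local_compactness wg CN CC w0 chi2 (@cutoff_at_bounded R n j)).
have c4 : N4 (fun x => chi x * w_ k x) @[k --> \oo] --> 0.
  apply: (N4_cvg0 (g_ := fun k => cut_gradient j (w_ k) (fun i x => g_ k i x - g i x)) (C := K * C2)) => //.
  - by move=> k; exact: (weak_gradient_cut j (wg k)).
  - by move=> k; apply: le_trans (KP j _ _ (wg k)) _; exact: (ler_wpM2l K0 (wE k)).
have vB k : N4 (fun x => chi x * v_ k x) <= (K * C) ^+ 2 / M.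
  have [_] := sobolev (weak_gradient_cut j (vg k)); rewrite ler_pdivlMr// mulrC; move/le_trans; apply.
  apply: sqr_le_norm; rewrite ger0_norm ?H1energy_ge0//; apply: le_trans (KP j _ _ (vg k)) _.
  exact: ler_wpM2l.
have E k : J (fun x => v_ k x ^+ 3 * eta x) - J (fun x => psi x ^+ 3 * eta x) =
    J (fun x => ((chi x * v_ k x) ^+ 3 - (chi x * psi x) ^+ 3) * eta x).
  rewrite -JB; [|exact: cube_intg|exact: cube_intg]; apply: J_eq => x.
  have [xr|xr] := pselect (cube r x); last by rewrite (etar _ xr); ring.
  by rewrite /chi (jr _ xr) !mul1r; ring.
have D0 : J (fun x => v_ k x ^+ 3 * eta x) - J (fun x => psi x ^+ 3 * eta x) @[k --> \oo] --> (0 : R).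
  do 2 apply: rcvg_sqr0.
  pose B := 16 * ((K * C) ^+ 2 / M + N4 (fun x => chi x * psi x)).
  have : (B ^+ 2 * N4 eta) * N4 (fun x => chi x * w_ k x) @[k --> \oo] --> (B ^+ 2 * N4 eta) * 0.
    exact: rcvgZ.
  rewrite mulr0; apply: rcvg_squeeze0 => k; rewrite sqr_ge0/= E.
  apply: le_trans (cube_diff_le (cut_quart j (v4 k)) (cut_quart j p4) eta4) _.
  rewrite -[leRHS]mulrA [X in _ <= _ * X]mulrC.
  have -> : N4 (fun x => cutoff_at j x * v_ k x - cutoff_at j x * psi x) = N4 (fun x => chi x * w_ k x).
    by apply: J_eq => x; rewrite /chi /w_ mulrBr.
  apply: ler_wpM2r; first by apply: mulr_ge0; exact: N4_ge0.
  have b0 := addr_ge0 (N4_ge0 (fun x => cutoff_at j x * v_ k x)) (N4_ge0 (fun x => cutoff_at j x * psi x)).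
  apply: sqr_le_norm; rewrite ger0_norm; last exact: mulr_ge0.
  by apply: ler_wpM2l => //; apply: lerD => //; exact: vB.
pose proof (rcvgD D0 (rcvg_cst (J (fun x => psi x ^+ 3 * eta x)))) as H; move: H; rewrite add0r.
by apply: rcvg_eq => k; rewrite subrK.
Qed.

End local_convergence.

(** * Convergence of ground states *)

Section ground_state_sequences.
Context (R : realType) (n : nat) (omega b : R).
Context (omega_gt0 : 0 < omega) (b_gt0 : 0 < b) (b_lt : b < n%:R / 2).
Notation Rn := 'rV[R]_n.
Notation mu := (lebesgue_rV R n).
Notation J f := (Rintegral mu setT f).
Notation N2 u := (\int[mu]_x (u x ^+ 2)).
Notation intg f := (mu.-integrable [set: Rn] (EFin \o f)).
Notation grad u := (fun i => weak_pderiv i u).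
Notation H1en := (H1energy omega).
Notation L u := (Lop (b / 2) u).
Implicit Types (u v w psi : Rn -> R) (g h : 'I_n -> Rn -> R).

Context (phi0 : Rn -> R) (phi0_ground : ground_state omega b 0 phi0).
Context (eps : nat -> R) (eps_gt0 : forall k, 0 < eps k) (eps_cvg : eps k @[k --> \oo] --> 0).
Context (phi : nat -> Rn -> R) (phi_ground : forall k, ground_state omega b (eps k) (phi k)).

Let M := N4 phi0.

Let M_gt0 : 0 < M.
Proof. by have [m0 E _] := ground_state_facts omega_gt0 (lexx 0) phi0_ground; rewrite /M E exprn_gt0. Qed.

Let sob : forall u g, weak_gradient u g -> quart u /\ M * N4 u <= H1en u g ^+ 2.
Proof. exact: (ground_state0_sobolev omega_gt0 phi0_ground). Qed.

Let phi0_wg : weak_gradient phi0 (grad phi0).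
Proof.
by have [[]] := phi0_ground; rewrite /energy_space eqxx => /weak_gradient_weak_pderiv.
Qed.

Let phi0_energy : H1en phi0 (grad phi0) = M.
Proof. by have [sol _] := phi0_ground; have := solution_action sol; rewrite /action mul0r add0r. Qed.

Let n_lt4 : (n < 4)%N.
Proof.
apply: (sobolev_dimension omega_gt0 M_gt0 sob phi0_wg erefl phi0_energy).
rewrite lt_neqAle J_sqr_ge0 andbT eq_sym; apply/eqP => /(J_sqr_eq0 phi0_wg.1).
exact: (N4_gt0_nonzero phi0_wg.1.1 M_gt0).
Qed.

Let eps_ge0 k : 0 <= eps k. Proof. exact: ltW. Qed.

Let space_eps k v : energy_space b (eps k) v <-> X_space b v.
Proof. by rewrite /energy_space gt_eqF. Qed.

Let phi_X k : X_space b (phi k).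
Proof. by have [[/space_eps]] := phi_ground k. Qed.

Let phi_wg k : weak_gradient (phi k) (grad (phi k)).
Proof. by apply: weak_gradient_weak_pderiv; have [] := phi_X k. Qed.

Let phi_energy k : eps k * N2 (L (phi k)) + H1en (phi k) (grad (phi k)) = N4 (phi k).
Proof. by have [sol _] := phi_ground k; exact: (solution_action sol). Qed.

Let phi_H1energy_le k : H1en (phi k) (grad (phi k)) <= N4 (phi k).
Proof. by rewrite -phi_energy lerDr; apply: mulr_ge0 => //; exact: J_sqr_ge0. Qed.

Let phi_Lop_le k : eps k * N2 (L (phi k)) <= N4 (phi k).
Proof. by rewrite -phi_energy lerDl; exact: H1energy_ge0. Qed.

Let mass_ge k : M <= N4 (phi k).
Proof.
have [_ H] := sob (phi_wg k).
have [m0 E _] := ground_state_facts omega_gt0 (eps_ge0 k) (phi_ground k).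
have p : 0 < N4 (phi k) by rewrite E exprn_gt0.
rewrite -(ler_pM2r p) -expr2; apply: le_trans H _; apply: sqr_le_norm.
by rewrite ger0_norm// H1energy_ge0.
Qed.

(** Minimality of [phi0] gives the lower bound. For the upper bound,
  truncations of [phi0] compete in every perturbed problem, where their
  nonlocal energy is multiplied by a vanishing factor. *)
Lemma ground_state_mass_cvg : N4 (phi k) @[k --> \oo] --> M.
Proof.
suff D0 : N4 (phi k) - M @[k --> \oo] --> (0 : R).
  pose proof (rcvgD D0 (rcvg_cst M)) as H; move: H; rewrite add0r.
  by apply: rcvg_eq => k; rewrite subrK.
apply: rcvg_approx0 => [k|e e0]; first by rewrite subr_ge0.
pose w j x := cutoff_at j x * phi0 x; pose H j := H1en (w j) (cut_gradient j phi0 (grad phi0)).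
have [phi04 _] := sob phi0_wg.
have c : (M + e) * N4 (w j) - H j ^+ 2 @[j --> \oo] --> (M + e) * M - M ^+ 2.
  apply: rcvgB; first by apply: rcvgZ; exact: N4_cut_cvg.
  by apply: rcvgX; rewrite -[in X in _ --> X]phi0_energy; exact: H1energy_cut_cvg.
have eM : 0 < e * M by exact: mulr_gt0.
(* One truncation of nearly minimal quotient is kept while [eps] tends to
   zero. *)
have [j jP] : exists j, 0 < (M + e) * N4 (w j) - H j ^+ 2.
  have /cvgrPdist_lt /(_ _ eM) /filter_ex[j] := c.
  rewrite (_ : (M + e) * M - M ^+ 2 = e * M); last by ring.
  move=> jP; exists j; have := ler_norm (e * M - ((M + e) * N4 (w j) - H j ^+ 2)).
  by move: jP; move: (e * M) (_ - _ ^+ 2) => p q; lra.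
have wg := weak_gradient_cut j phi0_wg.
have Nw : 0 < N4 (w j).
  have Me : 0 < M + e by exact: addr_gt0.
  rewrite -(pmulr_rgt0 _ Me); apply: le_lt_trans (sqr_ge0 (H j)) _; by rewrite -subr_gt0.
have [wi wX] := compact_support_X b_gt0 b_lt wg (r := 2 * j.+1%:R)
  (fun x xr => etrans (congr1 (fun t => t * phi0 x) (cutoff_at_eq0 xr)) (mul0r _)).
have w_nz := N4_gt0_nonzero wg.1.1 Nw.
pose q k := (eps k * N2 (L (w j)) + H j) ^+ 2 / N4 (w j).
exists (fun k => q k - H j ^+ 2 / N4 (w j)).
  have : q k - H j ^+ 2 / N4 (w j) @[k --> \oo] --> (0 * N2 (L (w j)) + H j) ^+ 2 / N4 (w j) - H j ^+ 2 / N4 (w j).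
    apply: rcvgB; last exact: rcvg_cst.
    apply: rcvgM; last exact: rcvg_cst.
    apply: rcvgX; apply: rcvgD; last exact: rcvg_cst.
    by apply: rcvgM; [exact: eps_cvg|exact: rcvg_cst].
  by rewrite mul0r add0r subrr.
move=> k; have [_] := ground_state_compare omega_gt0 (eps_ge0 k) (phi_ground k) ((space_eps k (w j)).2 wX) w_nz.
have gw := weak_gradient_weak_pderiv wX.1.
rewrite /action (H1energy_ae omega gw wg (ae_eq_refl _ _ _)) -ler_pdivlMr// -/(H j) -/(q k).
have : H j ^+ 2 / N4 (w j) <= M + e by rewrite ler_pdivrMr// ltW// -subr_gt0.
by move: (_ / _) (q k) (N4 (phi k)) => a q1 c1; lra.
Qed.

Lemma ground_state_mass_bounded : exists2 C, 0 <= C & forall k, N4 (phi k) <= C.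
Proof.
have /cvgP /cvg_seq_bounded [C [Cr CP]] := ground_state_mass_cvg.
exists (`|C| + 1); first by rewrite addr_ge0.
move=> k; apply: le_trans (ler_norm _) _; apply: CP => //.
by apply: le_lt_trans (ler_norm C) _; rewrite ltrDl.
Qed.

Let translated y v h r : weak_gradient v h -> (forall x, ~ cube r x -> v x = 0) ->
  [/\ weak_gradient (fun x => v (x - y)) (fun i x => h i (x - y)),
      intg (fun x => v (x - y)) & X_space b (fun x => v (x - y))].
Proof.
move=> vh vr; have wg := weak_gradient_translate (- y) vh.
have [|i X] := compact_support_X b_gt0 b_lt wg (r := r + \sum_i `|y 0 i|); last by [].
move=> x xr; apply: vr => /cubeP xc; apply: xr; apply/cubeP => i.
have := xc i; rewrite !mxE => xci; have := ler_normD (x 0 i - y 0 i) (y 0 i); rewrite subrK.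
move/le_trans; apply; apply: lerD => //; rewrite (bigD1 i)//= lerDl.
by apply: sumr_ge0 => j _.
Qed.

(** Writing [eps] as a product of square roots, Cauchy--Schwarz pairs one with
  [L phi], where the energy bounds it, and leaves the other in front of [L v],
  whose norm is bounded uniformly over translations. *)
Lemma nonlocal_term_cvg0 (y_ : nat -> Rn) v h r : weak_gradient v h -> (forall x, ~ cube r x -> v x = 0) ->
  eps k * J (fun x => L (phi k) x * L (fun z => v (z - y_ k)) x) @[k --> \oo] --> (0 : R).
Proof.
move=> vh vr; have [C C0 CP] := ground_state_mass_bounded.
have [D D0 DP] := Lop_bound b_gt0 b_lt.
have [vi vX] := compact_support_X b_gt0 b_lt vh vr.
pose B := D * (J (fun x => `|v x|) ^+ 2 + N2 v).
apply: rcvg_sqr0; have : (C * B) * eps k @[k --> \oo] --> (C * B) * 0 by apply: rcvgZ.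
rewrite mulr0; apply: rcvg_squeeze0 => k; rewrite sqr_ge0/=.
have [wg wi wX] := translated (y_ k) vh vr.
have [l2 _] := Lop_sqint (phi_X k); have [w2 _] := Lop_sqint wX.
have wB : N2 (L (fun z => v (z - y_ k))) <= B.
  apply: le_trans (DP _ wi wX) _; rewrite le_eqVlt; apply/orP; left; apply/eqP.
  congr (_ * (_ ^+ 2 + _)); first exact: (J_translate (- y_ k) (intg_norm vi)).
  exact: (N2_translate (- y_ k) vh.1).
rewrite exprMn; have cs := cauchy_schwarz l2 w2.
have B0 : 0 <= B by apply: le_trans wB; exact: J_sqr_ge0.
apply: (@le_trans _ _ (eps k ^+ 2 * (N2 (L (phi k)) * N2 (L (fun z => v (z - y_ k)))))).
  by apply: ler_wpM2l => //; exact: sqr_ge0.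
have arith (p q s : R) : p ^+ 2 * (q * s) = p * q * s * p by ring.
rewrite arith.
apply: (ler_wpM2r (eps_ge0 k)); apply: ler_pM.
- exact: (mulr_ge0 (eps_ge0 k) (J_sqr_ge0 mu _)).
- exact: J_sqr_ge0.
- exact: le_trans (phi_Lop_le k) (CP k).
- exact: wB.
Qed.

(** Each function has a window that carries a fixed amount of mass.
  Translating it to the origin prevents the weak limit from vanishing, because
  convergence is strong in the window. *)
Lemma nonzero_weak_limit : exists (sub : nat -> nat) (y_ : nat -> Rn) psi g,
  [/\ {homo sub : i j / (i < j)%N}, weak_gradient psi g, 0 < N2 psi,
      weakly_cvg mu (fun k x => phi (sub k) (x + y_ (sub k))) psi &
      forall i, weakly_cvg mu (fun k x => weak_pderiv i (phi (sub k)) (x + y_ (sub k))) (g i)].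
Proof.
have [C C0 CP] := ground_state_mass_bounded.
have [s s0 sP] := nonvanishing omega_gt0 M_gt0 sob n_lt4 C0 M_gt0.
have /choice[y_ yP] k : exists y, s < N2 (fun x => window y x * phi k x).
  by apply: (sP _ _ (phi_wg k)); [exact: le_trans (phi_H1energy_le k) (CP k)|exact: mass_ge].
pose v_ k x := phi k (x + y_ k); pose g_ k i x := weak_pderiv i (phi k) (x + y_ k).
have vg k : weak_gradient (v_ k) (g_ k) by exact: (weak_gradient_translate (y_ k) (phi_wg k)).
have vC k : H1en (v_ k) (g_ k) <= C.
  have -> : H1en (v_ k) (g_ k) = H1en (phi k) (grad (phi k)) by exact: (H1energy_translate omega (y_ k) (phi_wg k)).
  exact: le_trans (phi_H1energy_le k) (CP k).
pose C' := Num.max (C / omega) C.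
have vN k : N2 (v_ k) <= C'.
  rewrite le_max; apply/orP; left; rewrite ler_pdivlMr// mulrC; apply: le_trans (vC k); exact: N2_le_H1energy.
have gN k i : N2 (g_ k i) <= C'.
  rewrite le_max; apply/orP; right; apply: le_trans (vC k).
  exact: le_trans (N2_le_dirichlet (g_ k) i) (dirichlet_le_H1energy omega_gt0 _ _).
have [sub [psi [hs p2 cv]]] := weak_compactness (fun k => (vg k).1) vN.
have [g [pg cg]] := weakly_cvg_gradient (fun k => vg (sub k)) (fun k => gN (sub k)) p2 cv.
exists sub, y_, psi, g; split => //.
rewrite lt_neqAle J_sqr_ge0 andbT eq_sym; apply/eqP => pz.
pose w_ k x := v_ (sub k) x - psi x.
have wg k := weak_gradientB (vg (sub k)) pg.
have wE k := H1energyB_le omega_gt0 (vg (sub k)) pg.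
pose D := Num.max ((2 * C + 2 * H1en psi g) / omega) (2 * C + 2 * H1en psi g).
have wC k : H1en (w_ k) (fun i x => g_ (sub k) i x - g i x) <= 2 * C + 2 * H1en psi g.
  by apply: le_trans (wE k) _; apply: lerD => //; apply: ler_wpM2l.
have w0 : weakly_cvg mu w_ (fun=> 0).
  exact: (weakly_cvg_sub0 (fun k => (vg (sub k)).1) p2 cv).
pose th := @cutoff R n; have th2 : sqint mu th by apply: test_function_sqint; exact: test_function_cutoff.
have thb x : `|th x| <= 1 by rewrite ger0_norm ?cutoff_ge0// cutoff_le1.
have wD k : N2 (w_ k) <= D.
  rewrite le_max; apply/orP; left; rewrite ler_pdivlMr// mulrC; apply: le_trans (wC k); exact: N2_le_H1energy.
have gD k i : N2 (fun x => g_ (sub k) i x - g i x) <= D.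
  rewrite le_max; apply/orP; right; apply: le_trans (wC k).
  apply: le_trans (dirichlet_le_H1energy omega_gt0 _ _).
  exact: (N2_le_dirichlet (fun i x => g_ (sub k) i x - g i x) i).
have c := local_compactness wg wD gD w0 th2 thb.
have tb (f : Rn -> R) : sqint mu f -> sqint mu (fun x => th x * f x) by exact: (sqint_bounded_mul th2.1 thb).
have psi_window : N2 (fun x => th x * psi x) = 0.
  apply/eqP; rewrite eq_le J_sqr_ge0 andbT -pz; apply: J_le.
  - by case: (tb _ p2).
  - by case: p2.
  - by move=> x; rewrite exprMn ler_piMl ?sqr_ge0// -(expr1n _ 2); apply: sqr_le_norm; exact: thb.
have : s <= 2 * 0.
  apply: (rcvg_ge_cst (rcvgZ 2 c)) => k; apply: ltW; apply: lt_le_trans (yP (sub k)) _.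
  have -> : N2 (fun x => window (y_ (sub k)) x * phi (sub k) x) = N2 (fun x => th x * w_ k x + th x * psi x).
    have t2 := sqint_translate (- y_ (sub k)) th2.
    have i2 : sqint mu (fun x => window (y_ (sub k)) x * phi (sub k) x).
      exact: (sqint_bounded_mul t2.1 (fun x => thb _) (phi_wg (sub k)).1).
    rewrite -(N2_translate (y_ (sub k)) i2); apply: J_eq => x.
    by rewrite /window addrK /w_ /v_ -mulrDr subrK.
  apply: le_trans (J_sqrD_le (tb _ (wg k).1) (tb _ p2)) _.
  by rewrite psi_window mulr0 addr0.
by rewrite mulr0 leNgt s0.
Qed.

Section weak_limit.
Context (y_ : nat -> Rn) (psi : Rn -> R) (g : 'I_n -> Rn -> R).
Let v_ k x := phi k (x + y_ k).
Let g_ k i x := weak_pderiv i (phi k) (x + y_ k).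
Context (psi_g : weak_gradient psi g) (v_cvg : weakly_cvg mu v_ psi).
Context (g_cvg : forall i, weakly_cvg mu (fun k => g_ k i) (g i)).

Let v_wg k : weak_gradient (v_ k) (g_ k).
Proof. exact: (weak_gradient_translate (y_ k) (phi_wg k)). Qed.

Let v_energy k : H1en (v_ k) (g_ k) = H1en (phi k) (grad (phi k)).
Proof. exact: (H1energy_translate omega (y_ k) (phi_wg k)). Qed.

Let equation_compact v h r : weak_gradient v h -> (forall x, ~ cube r x -> v x = 0) ->
  form omega psi g v h = J (fun x => psi x ^+ 3 * v x).
Proof.
move=> vh vr; have [C C0 CP] := ground_state_mass_bounded.
have v4 : quart v by case: (sob vh).
have vC k : H1en (v_ k) (g_ k) <= C by rewrite v_energy; exact: le_trans (phi_H1energy_le k) (CP k).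
have c3 := cube_weak_cvg omega_gt0 M_gt0 sob n_lt4 v_wg vC psi_g v_cvg v4 vr.
have c1 := form_cvg (omega := omega) vh v_cvg g_cvg.
pose proof (rcvgD c1 (nonlocal_term_cvg0 y_ vh vr)) as c2.
move: c2; rewrite addr0 => c2; apply: (rcvg_unique c2); apply: rcvg_eq c3 => k.
have [wg wi wX] := translated (y_ k) vh vr; have [sol _] := phi_ground k.
have := solution_form sol ((space_eps k _).2 wX).
rewrite (form_ae omega (phi_wg k) (weak_gradient_weak_pderiv wX.1) wg) => E.
have p4 : quart (phi k) by case: (sob (phi_wg k)).
have w4 : quart (fun x => v (x - y_ k)) by exact: quart_translate.
have -> : J (fun x => v_ k x ^+ 3 * v x) = J (fun x => phi k x ^+ 3 * v (x - y_ k)).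
  rewrite -(J_translate (y_ k) (cube_intg p4 w4)); apply: J_eq => x.
  by rewrite addrK.
rewrite -E; congr (_ + _); congr (_ + _ * _).
  apply: eq_bigr => i _; have i2 := sqint_mul ((phi_wg k).2 i).1 (wg.2 i).1.
  by rewrite -(J_translate (y_ k) i2); apply: J_eq => x; rewrite addrK.
have i2 := sqint_mul (phi_wg k).1 wg.1.
by rewrite -(J_translate (y_ k) i2); apply: J_eq => x; rewrite addrK.
Qed.

(** Compactly supported functions belong to the space of the perturbed problem
  and test it; general ones are reached by truncation. *)
Lemma weak_limit_equation v h : weak_gradient v h -> form omega psi g v h = J (fun x => psi x ^+ 3 * v x).
Proof.
move=> vh; have c1 := cut_form_cvg (omega := omega) psi_g vh; apply: (rcvg_unique c1).
have [v4 _] := sob vh; have [p4 _] := sob psi_g; have i3 := cube_intg p4 v4.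
have [||||_ c2] := @J_dct _ _ _ mu (fun j x => psi x ^+ 3 * (cutoff_at j x * v x)) (fun x => psi x ^+ 3 * v x) (fun x => `|psi x ^+ 3 * v x|).
- by move=> j; exact: intg_measurable (cube_intg p4 (cut_quart j v4)).
- move=> x; apply: cvg_near_cst; apply: filterS (cutoff_at_cvg x) => j ->.
  by rewrite mul1r.
- move=> j x; rewrite mulrCA normrM ler_piMl//; exact: cutoff_at_bounded.
- exact: intg_norm.
apply: rcvg_eq c2 => j; rewrite (equation_compact (weak_gradient_cut j vh) (r := 2 * j.+1%:R))// => x xr.
by rewrite cutoff_at_eq0// mul0r.
Qed.

(** A nonzero solution of the limit equation has at least the minimal energy
  [M]. The energy of the difference is bounded by a quantity tending to
  [M - H1en psi g], so no energy is lost. *)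
Lemma weak_limit_strong : 0 < N2 psi ->
  [/\ H1en psi g = M, N4 psi = M &
      H1en (fun x => v_ k x - psi x) (fun i x => g_ k i x - g i x) @[k --> \oo] --> 0].
Proof.
move=> psi0; have E : H1en psi g = N4 psi.
  by rewrite -form_self (weak_limit_equation psi_g); apply: J_eq => x; ring.
have [p4 S] := sob psi_g.
have H0 : 0 < H1en psi g.
  by apply: lt_le_trans (N2_le_H1energy omega psi g); rewrite mulr_gt0.
have HM : M <= H1en psi g by rewrite -(ler_pM2r H0) -expr2; apply: le_trans S; rewrite E.
have c : N4 (phi k) - 2 * form omega (v_ k) (g_ k) psi g + H1en psi g @[k --> \oo] --> M - 2 * H1en psi g + H1en psi g.
  apply: rcvgD; last exact: rcvg_cst.
  apply: rcvgB; first exact: ground_state_mass_cvg.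
  by apply: rcvgZ; exact: (form_cvg (omega := omega) psi_g v_cvg g_cvg).
have bd k : 0 <= H1en (fun x => v_ k x - psi x) (fun i x => g_ k i x - g i x) <=
    N4 (phi k) - 2 * form omega (v_ k) (g_ k) psi g + H1en psi g.
  rewrite H1energy_ge0//= (H1energyB omega (v_wg k) psi_g) v_energy.
  by apply: lerD => //; apply: lerD => //; exact: phi_H1energy_le.
have ME : H1en psi g = M.
  apply/eqP; rewrite eq_le HM andbT.
  have : 0 <= M - 2 * H1en psi g + H1en psi g.
    by apply: (rcvg_ge_cst c) => k; have /andP[] := bd k; exact: le_trans.
  by move: (H1en psi g) => t; lra.
split => //; first by rewrite -E.
apply: (rcvg_squeeze0 bd).
by move: c; rewrite ME (_ : M - 2 * M + M = 0)//; ring.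
Qed.

End weak_limit.

End ground_state_sequences.

Lemma H1norm_cvg0 (R : realType) (n : nat) (omega : R) (u_ : nat -> 'rV[R]_n -> R)
    (g_ : nat -> 'I_n -> 'rV[R]_n -> R) : 0 < omega ->
  (forall k, weak_gradient (u_ k) (g_ k)) -> H1energy omega (u_ k) (g_ k) @[k --> \oo] --> 0 ->
  H1norm (u_ k) @[k --> \oo] --> (0 : R).
Proof.
move=> omega_gt0 ug c; apply: rcvg_sqr0.
have : (omega^-1 + 1) * H1energy omega (u_ k) (g_ k) @[k --> \oo] --> (omega^-1 + 1) * 0 by apply: rcvgZ.
rewrite mulr0; apply: rcvg_squeeze0 => k; rewrite sqr_ge0/=.
have gu := weak_gradient_weak_pderiv (weak_gradient_H1 (ug k)).
rewrite -(H1energy_ae omega gu (ug k) (ae_eq_refl _ _ _)).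
have u2 := gu.1.2; have g2 i := (gu.2 i).1.2.
rewrite /H1norm sqr_sqrtr; last first.
  by apply: J_ge0 => x; apply: addr_ge0; [exact: sqr_ge0|apply: sumr_ge0 => i _; exact: sqr_ge0].
rewrite JD; [|exact: u2|exact: intg_sum]; rewrite J_sum// mulrDl mul1r; apply: lerD.
  by rewrite -(ler_pM2l omega_gt0) mulVKf ?gt_eqF//; exact: N2_le_H1energy.
exact: dirichlet_le_H1energy.
Qed.

(* A ground state is only determined up to sign (phi and - phi solve the same
   problem), so uniqueness of phi0 and the limit are both taken up to sign. *)
Theorem theorem3p8 (R : realType) (n : nat) (omega b : R)
  (omega_gt0 : 0 < omega) (b_gt0 : 0 < b) (b_lt : b < n%:R / 2)
  (phi0 : 'rV[R]_n -> R)
  (phi0_ground : ground_state omega b 0 phi0)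
  (phi0_unique : forall psi, ground_state omega b 0 psi ->
     exists (s : bool) (y : 'rV[R]_n),
       psi = (fun x => (-1) ^+ s * phi0 (x + y)) %[ae lebesgue_rV R n])
  (eps : nat -> R) (eps_gt0 : forall k, 0 < eps k)
  (eps_cvg : eps k @[k --> \oo] --> 0)
  (phi : nat -> 'rV[R]_n -> R)
  (phi_ground : forall k, ground_state omega b (eps k) (phi k)) :
  exists (sub : nat -> nat) (y : nat -> 'rV[R]_n) (s : bool),
    {homo sub : i j / (i < j)%N} /\
    H1norm (fun x => phi (sub k) (x + y k) - (-1) ^+ s * phi0 x)
      @[k --> \oo] --> 0.
Proof.
have [sub [y_ [psi [g [hs pg p0 cv cg]]]]] :=
  nonzero_weak_limit omega_gt0 b_gt0 b_lt phi0_ground eps_gt0 eps_cvg phi_ground.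
have gs k := phi_ground (sub k); have e0 k := eps_gt0 (sub k).
have ec := rcvg_subsequence hs eps_cvg.
have EL := weak_limit_equation omega_gt0 b_gt0 b_lt phi0_ground e0 ec gs (y_ := fun k => y_ (sub k)) pg cv cg.
have [E1 E2 c] := weak_limit_strong omega_gt0 b_gt0 b_lt phi0_ground e0 ec gs (y_ := fun k => y_ (sub k)) pg cv cg p0.
have [s [z psiE]] := phi0_unique psi (extremal_ground_state omega_gt0 phi0_ground pg E1 E2 EL).
exists sub, (fun k => y_ (sub k) - z), s; split => //.
have phi_wg k : weak_gradient (phi k) (fun i => weak_pderiv i (phi k)).
  have [[+ _ _] _] := phi_ground k; rewrite /energy_space gt_eqF// => -[+ _].
  exact: weak_gradient_weak_pderiv.
have phi0_wg : weak_gradient phi0 (fun i => weak_pderiv i phi0).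
  by have [[+ _ _] _] := phi0_ground; rewrite /energy_space eqxx => /weak_gradient_weak_pderiv.
have ug k := weak_gradientB (weak_gradient_translate (y_ (sub k) - z) (phi_wg (sub k)))
  (weak_gradientZ ((-1) ^+ s) phi0_wg).
apply: (H1norm_cvg0 omega_gt0 ug); apply: rcvg_eq c => k.
have wg := weak_gradientB (weak_gradient_translate (y_ (sub k)) (phi_wg (sub k))) pg.
rewrite -(H1energy_translate omega (- z) wg); apply: H1energy_ae (weak_gradient_translate (- z) wg) (ug k) _.
have := ae_translate (- z) psiE; apply: filterS => x /= H xT.
by rewrite H// subrK addrA addrAC.
Qed.
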